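(* Let $\mathcal{D}$ be a continuous distribution with cdf $F$ supported on $[0,x^* )$, $x^*\le+\infty$. (1) (I.I.D. Max-Prophet Inequality.) For every $\gamma\in\mathbb{R}$, if $F\in D_\gamma$ for maxima, then the asymptotic competitive ratio of the optimal threshold policy as $n\to\infty$ is $$\lambda_M=\min\left\{\frac{(1-\gamma)^{-\gamma}}{\Gamma(1-\gamma)},\,1\right\},$$ where for $\gamma\ge 1$ the right-hand side is understood to be $1$. (2) (I.I.D. Min-Prophet Inequality.) If $F\in D_\gamma$ for minima, then $\gamma\le 0$, and the asymptotic competitive ratio of the optimal threshold policy as $n\to\infty$ is $$\lambda_m=\max\left\{\frac{(1-\gamma)^{-\gamma}}{\Gamma(1-\gamma)},\,1\right\}.$$
   Context: $X_1,X_2,\dots$ are i.i.d. from the known distribution $\mathcal{D}$ (independent of $n$), which is continuous with cdf $F$ and density $f$ and support $[0,x^* )$ (left endpoint $0$, right endpoint $x^*\le+\infty$). Domain of attraction. For maxima, $F\in D_\gamma$ means there exist sequences $a_n>0$, $b_n\in\mathbb{R}$ with $\lim_{n\to\infty}F^n(a_nx+b_n)=G_\gamma(x)$, where $G_\gamma(x)=\exp(-(1+\gamma x)^{-1/\gamma})$ for $1+\gamma x>0$ if $\gamma\ne0$, and $G_0(x)=\exp(-e^{-x})$. For minima, $F\in D_\gamma$ means there exist $a'_n>0$, $b'_n\in\mathbb{R}$ with $\lim_{n\to\infty}(1-F(a'_nx+b'_n))^n=G^*_\gamma(x)$, where $G^*_\gamma(x)=\exp(-(1-\gamma x)^{-1/\gamma})$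 for $1-\gamma x>0$ if $\gamma\neq0$, and $G^*_0(x)=\exp(-e^{x})$. Prophet inequality. $X_1,\dots,X_n$ are observed sequentially; at each step one irrevocably accepts the current value and stops, or rejects it forever. In the min setting one is forced to select a value (the last one if nothing was accepted before). $G_M(n)$ (resp. $G_m(n)$) is the expected value of the optimal online policy for maximizing (resp. minimizing) the expected selected value: $G_M(1)=G_m(1)=\mathbb{E}[X_1]$, $G_M(n)=\mathbb{E}[\max\{X,G_M(n-1)\}]$, $G_m(n)=\mathbb{E}[\min\{X,G_m(n-1)\}]$, where $X\sim\mathcal{D}$. The asymptotic competitive ratios are $\lambda_M=\lim_{n\to\infty}G_M(n)/\mathbb{E}[\max_{i\le n}X_i]$ and $\lambda_m=\lim_{n\to\infty}G_m(n)/\mathbb{E}[\min_{i\le n}X_i]$. When $\mathbb{E}[X]=+\infty$ in the max setting, the ratio is regarded as $1$. $\Gamma$ is the Gamma function.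
   Formalization: In part (2), the value of the asymptotic ratio is stated only for distributions with finite mean E[X]; if E[X] is infinite then G_m(n) is infinite for every n and the claimed ratio fails or is undefined (e.g. F(x)=1-1/(1+x)). *)

(* Defs.v *)
From HB Require Import structures.
From mathcomp Require Import all_boot all_order all_algebra finmap.
From mathcomp Require Import all_classical all_reals all_analysis.

Set Implicit Arguments.
Unset Strict Implicit.
Unset Printing Implicit Defensive.

Import Order.TTheory GRing.Theory Num.Theory.
Import numFieldNormedType.Exports.

Local Open Scope classical_set_scope.
Local Open Scope ring_scope.

(** Distributions on the real line *)

Section distributions.
Context {R : realType} (D : probability (measurableTypeR R) R).

Definition dist_cdf (x : R) : R := fine (D `]-oo, x]%classic).

Definition mean : \bar R := (\int[D]_x x%:E)%E.

Definition has_density (f : R -> R) : Prop :=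
  [/\ measurable_fun [set: R] f,
      forall x, 0 <= f x
    & forall A : set (measurableTypeR R), measurable A ->
        D A = (\int[lebesgue_measure]_(x in A) (f x)%:E)%E].

Definition left_endpoint : \bar R :=
  ereal_inf [set x%:E | x in [set x : R | 0 < dist_cdf x]].

Definition right_endpoint : \bar R :=
  ereal_sup [set x%:E | x in [set x : R | dist_cdf x < 1]].

(** Value of the optimal online policy on [n] values drawn from [D], by backward
    induction.  The values are extended reals since [mean] may be [+oo]; the
    entry at [n = 0] is a dummy. *)

Fixpoint opt_max (n : nat) : \bar R :=
  match n with
  | 0 => 0%E
  | 1 => mean
  | m.+1 => (\int[D]_x maxe x%:E (opt_max m))%E
  end.

Fixpoint opt_min (n : nat) : \bar R :=
  match n with
  | 0 => 0%E
  | 1 => mean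
  | m.+1 => (\int[D]_x mine x%:E (opt_min m))%E
  end.

End distributions.

(** Extreme value laws and domains of attraction *)

Section extreme_value.
Context {R : realType}.

(* [gev_max g] and [gev_min g] are only meaningful where [0 < 1 + g * x],
   resp. [0 < 1 - g * x], since [powR] is total. *)
Definition gev_max (g x : R) : R :=
  if g == 0 then expR (- expR (- x))
  else expR (- ((1 + g * x) `^ (- g^-1))).

Definition gev_min (g x : R) : R :=
  if g == 0 then expR (- expR x)
  else expR (- ((1 - g * x) `^ (- g^-1))).

Definition attracted_max (F : R -> R) (g : R) : Prop :=
  exists a b : nat -> R, (forall n, 0 < a n) /\
    forall x, 0 < 1 + g * x ->
      F (a n * x + b n) ^+ n @[n --> \oo] --> gev_max g x.

Definition attracted_min (F : R -> R) (g : R) : Prop :=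
  exists a b : nat -> R, (forall n, 0 < a n) /\
    forall x, 0 < 1 - g * x ->
      (1 - F (a n * x + b n)) ^+ n @[n --> \oo] --> gev_min g x.

(* Euler's integral: this is the Gamma function for [0 < s] only. *)
Definition Gamma (s : R) : R :=
  (\int[lebesgue_measure]_(t in `]0%R, +oo[) (t `^ (s - 1) * expR (- t)))%R.

Definition prophet_const (g : R) : R := (1 - g) `^ (- g) / Gamma (1 - g).

End extreme_value.

(** I.i.d. samples and competitive ratios *)

Section sample.
Context {R : realType} {d : measure_display} {T : measurableType d}.
Context (P : probability T R) (X : nat -> {RV P >-> R}).
Context (D : probability (measurableTypeR R) R).

Definition mutually_independent : Prop :=
  forall (J : {fset nat}) (A : nat -> set (measurableTypeR R)),
    (forall j, measurable (A j)) ->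
    P (\bigcap_(j in [set` J]) (X j @^-1` A j)) =
    (\prod_(j <- J) P (X j @^-1` A j))%E.

Definition iid : Prop :=
  mutually_independent /\
  forall i (A : set (measurableTypeR R)), measurable A ->
    distribution P (X i) A = D A.

(* The sample is [X 0, ..., X (n - 1)].  The default element [X 0] of the
   iterated max/min belongs to it as soon as [0 < n]. *)
Definition sample_max (n : nat) (w : T) : R :=
  \big[Num.max/X 0%N w]_(i < n) X i w.

Definition sample_min (n : nat) (w : T) : R :=
  \big[Num.min/X 0%N w]_(i < n) X i w.

(* In the max setting the ratio is 1 by convention when the mean is infinite. *)
Definition ratio_max (n : nat) : \bar R :=
  if mean D == +oo%E then 1%E else (opt_max D n / 'E_P[sample_max n])%E.

Definition ratio_min (n : nat) : \bar R :=
  (opt_min D n / 'E_P[sample_min n])%E.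

End sample.

(* Main.v *)
Require Import Defs.
From HB Require Import structures.
From mathcomp Require Import all_boot all_order all_algebra finmap.
From mathcomp Require Import all_classical all_reals all_analysis.
From mathcomp Require Import measurable_realfun ring lra zify.

Set Implicit Arguments.
Unset Strict Implicit.
Unset Printing Implicit Defensive.

Import Order.TTheory GRing.Theory Num.Theory.
Import numFieldNormedType.Exports.

Local Open Scope classical_set_scope.
Local Open Scope ring_scope.

(** Write [S] for the survival function, [S x = 1 - F x] for maxima and
    [S x = F (- x)] for minima, and [H x] for the integral of [S] over
    [[x, +oo[].  In both settings the optimal value (up to sign) satisfies
    [y (n + 1) = y n + H (y n)].  Attraction makes [S] vary regularly with index
    [- 1 / g] at its right endpoint (rapidly if [g = 0]), so Karamata's theorem gives
    [x * S x / H x --> 1 / g - 1], and the recursion then forces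
    [n * S (y n) --> 1 - g].  Hence [n * S (y n * x) --> (1 - g) * x `^ (- 1 / g)], and
    integrating the tail of the sample extremum, rescaled by [y n], produces
    [(1 - g) `^ g * Gamma (1 - g)].  When the ratio tends to [1], it is enough to
    compare the sample extremum with [y n] through [E max <= s + n * H s], or its
    analogue for minima. *)

(** Everything is expressed through [S] and [H]: [E max(X, v) = v + H v] and
    [E min(X, v) = v - H (- v)] give the optimal values, while the prophet's value is the integral
    of [1 - (1 - S)^n] or of [(1 - S)^n]. The index and the endpoint constrain each other: [g > 0]
    forces an unbounded support and [g < 0] a bounded one. Hence [g > 0] cannot occur for minima,
    whose reflected endpoint is [0]; for maxima a finite endpoint is settled by an elementary
    argument. The constant [1 - g] comes from the sequence [y n / H (y n)]: its increments tend to
    [1 + (1 / g - 1) = 1 / g], so by Cesaro it grows like [n / g], and [n * S (y n)] is the quotient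
    of [y * S / H] by [y / (H * n)], which tends to [(1 / g - 1) * g]. The obstacle is the limit
    under the integral sign. Regular variation is used as a pointwise limit only and provides no
    dominating function. Dominated convergence is applied on bounded intervals, and the tails are
    made uniformly small by other means: the bound [n * H] for maxima; for minima, the inequality
    between prophet and online value at half the sample size. *)

Section gev_tail.
Context {R : realType}.
Implicit Types g x y z : R.

(** Minus the logarithm of the extreme value law. It is the limit of [n * S], which is easier to
    handle than the limit of [n]-th powers. *)
Definition tau g x : R :=
  if g == 0 then expR (- x) else (1 + g * x) `^ (- g^-1).

Lemma gev_maxE g x : gev_max g x = expR (- tau g x).
Proof. by rewrite /gev_max /tau; case: ifP. Qed.

Lemma gev_minE g x : gev_min g x = expR (- tau g (- x)).
Proof. by rewrite /gev_min /tau opprK mulrN; case: ifP. Qed.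

Lemma tau_gt0 g x : 0 < 1 + g * x -> 0 < tau g x.
Proof.
by rewrite /tau; case: ifP => // _ h; [exact: expR_gt0 | exact: powR_gt0].
Qed.

Lemma tau0 g : tau g 0 = 1.
Proof. by rewrite /tau oppr0 mulr0 addr0 expR0 powR1 if_same. Qed.

Lemma powR_expR x y : 0 < x -> x `^ y = expR (y * ln x).
Proof. by move=> x0; rewrite /powR gt_eqF. Qed.

Lemma ltr_tau g x y : 0 < 1 + g * x -> 0 < 1 + g * y -> x < y ->
  tau g y < tau g x.
Proof.
rewrite /tau; case: ifPn => [_ _ _ xy|g0 hx hy xy]; first by rewrite ltr_expR ltrN2.
rewrite !powR_expR// ltr_expR !mulNr ltrN2.
have [gp|gn|/eqP] := ltgtP g 0; last by rewrite (negbTE g0).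
- rewrite -subr_gt0 -mulrBr nmulr_rgt0 ?invr_lt0// subr_lt0 ltr_ln ?posrE//.
  by rewrite ltrD2l ltr_nM2l.
- rewrite -subr_gt0 -mulrBr pmulr_rgt0 ?invr_gt0// subr_gt0 ltr_ln ?posrE//.
  by rewrite ltrD2l ltr_pM2l.
Qed.

(** The operation on the right is multiplication of the factors [1 + g * x]. It describes the
    composition of two shifts [x + f x * y] when the scale [f] itself gets multiplied by
    [1 + g * y]. *)
Lemma tauM g x y : 0 < 1 + g * x -> 0 < 1 + g * y ->
  tau g x * tau g y = tau g (x + y + g * x * y).
Proof.
move=> hx hy; rewrite /tau; case: eqP => [->|_].
  by rewrite -expRD; congr expR; ring.
by rewrite -powRM ?ltW//; congr powR; ring.
Qed.

Lemma near_tau_dom g x : 0 < 1 + g * x -> \forall y \near x, 0 < 1 + g * y.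
Proof.
have c : (fun y => 1 + g * y) y @[y --> x] --> 1 + g * x.
  by apply: cvgD; [exact: cvg_cst|apply: cvgMl_tmp; exact: cvg_id].
exact: (cvgr_gt _ c).
Qed.

Lemma continuous_tau g x : 0 < 1 + g * x -> {for x, continuous (tau g)}.
Proof.
move=> hx; rewrite /tau; case: eqP => [_|/eqP g0].
  apply: continuous_comp; last exact: continuous_expR.
  exact: opp_continuous.
rewrite /prop_for /continuous_at powR_expR//.
have hn := near_tau_dom hx.
apply: (@cvg_trans _ ((fun y => expR (- g^-1 * ln (1 + g * y))) @ x)).
  apply: near_eq_cvg; near=> y; rewrite powR_expR//; near: y; exact: hn.
apply: (@continuous_comp _ _ _ (fun y => - g^-1 * ln (1 + g * y)) expR x);
  last exact: continuous_expR.
apply: cvgMl_tmp.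
apply: (@continuous_comp _ _ _ (fun y => 1 + g * y) (@ln R) x); last first.
  exact: continuous_ln.
by apply: cvgD; [exact: cvg_cst|apply: cvgMl_tmp; exact: cvg_id].
Unshelve. all: by end_near. Qed.

(** When [f x] behaves like [g * x], the shift by [(r - 1) / g] units of [f] is the dilation by [r];
    this turns [tau] into a power law. *)
Lemma tau_powR g r : g != 0 -> 0 < r -> tau g ((r - 1) / g) = r `^ (- g^-1).
Proof.
move=> g0 r0; rewrite /tau (negbTE g0); congr powR; field => //.
Qed.

End gev_tail.

(** * Limits of powers, and limits squeezed by monotone families *)

Section filter_lemmas.
Context {R : realType}.

Lemma cvg_natV0 : n%:R^-1 @[n --> \oo] --> (0 : R).
Proof.
apply/(gtr0_cvgV0 (f := fun n => n%:R)); last exact: cvgr_idn.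
by near=> n; rewrite ltr0n; near: n; exact: nbhs_infty_gt.
Unshelve. all: by end_near. Qed.

Lemma cvg_succ (u : nat -> R) (l : R) :
  u n.+1 @[n --> \oo] --> l <-> u n @[n --> \oo] --> l.
Proof. by rewrite -(cvg_shiftS u (nbhs l)). Qed.

(** The bounds [ln u <= u - 1] and [- ln u <= u^-1 - 1] give
    [(1 + ln u) * - ln u <= 1 - u <= - ln u]. After multiplication by [n] both ends tend to [t],
    because [ln u] tends to [0]. *)
Lemma cvg_expn_onem (u : nat -> R) (t : R) :
  (forall n, 0 <= u n <= 1) ->
  u n ^+ n @[n --> \oo] --> expR (- t) -> n%:R * (1 - u n) @[n --> \oo] --> t.
Proof.
move=> u01 ut.
have wt : ln (u n ^+ n) @[n --> \oo] --> - t.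
  rewrite -[X in _ --> X]expRK.
  by apply: (@cvg_comp _ _ _ (fun n => u n ^+ n) (@ln R) _ _ _ ut);
    exact: continuous_ln (expR_gt0 _).
have upos : \forall n \near \oo, 0 < u n ^+ n by exact: (cvgr_gt _ ut) (expR_gt0 _).
have lnu : \forall n \near \oo, 0 < u n /\ ln (u n ^+ n) = n%:R * ln (u n).
  near=> n; have n0 : (0 < n)%N by near: n; exact: nbhs_infty_gt.
  have un : 0 < u n.
    have : 0 < u n ^+ n by near: n.
    have /andP[] := u01 n; rewrite le_eqVlt => /orP[/eqP <- _|//].
    by rewrite expr0n eqn0Ngt n0 ltxx.
  by split => //; rewrite lnXn// mulr_natl.
have vt : (1 + n%:R^-1 * ln (u n ^+ n)) * - ln (u n ^+ n) @[n --> \oo] --> t.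
  rewrite -[X in _ --> X](_ : (1 + 0 * - t) * (- - t) = t); last by ring.
  apply: cvgM; last exact: cvgN.
  apply: cvgD; first exact: cvg_cst.
  by apply: cvgM => //; exact: cvg_natV0.
apply: (@squeeze_cvgr _ _ _ _ _ _ _ _ t vt); last first.
  by rewrite -[X in _ --> X](opprK t); apply: cvgN; exact: wt.
near=> n.
have [un lnE] : 0 < u n /\ ln (u n ^+ n) = n%:R * ln (u n) by near: n.
have n0 : (0 : R) < n%:R by rewrite ltr0n; near: n; exact: nbhs_infty_gt.
rewrite lnE mulrA mulVf ?gt_eqF// mul1r.
have h1 : ln (u n) <= u n - 1.
  by rewrite -[X in ln X](subrK 1) addrC; apply: le_ln1Dx; lra.
have h2 : - ln (u n) <= (u n)^-1 - 1.
  rewrite -lnV ?posrE// -[X in ln X](subrK 1) addrC; apply: le_ln1Dx.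
  by have := invr_gt0 (u n); rewrite un; lra.
have h3 : u n * - ln (u n) <= 1 - u n.
  have := ler_wpM2l (ltW un) h2.
  by rewrite mulrBr mulfV ?gt_eqF// mulr1.
have h4 : ln (u n) <= 0 by apply: ln_le0; have /andP[] := u01 n.
apply/andP; split; last first.
  by rewrite -[leRHS]/(- ln (u n ^+ n)) lnE -mulrN ler_pM2l//; lra.
rewrite (_ : _ * - _ = n%:R * ((1 + ln (u n)) * - ln (u n))); last by ring.
by rewrite ler_pM2l// (le_trans _ h3)// ler_wpM2r ?oppr_ge0//; lra.
Unshelve. all: by end_near. Qed.

(** Convergence of [n * p n] forces [p n] to tend to [0], and [(1 - p)^n] lies between
    [exp (- n p / (1 - p))] and [exp (- n p)]. *)
Lemma cvg_onem_expn (p : nat -> R) (c : R) :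
  (forall n, 0 <= p n <= 1) ->
  n%:R * p n @[n --> \oo] --> c -> (1 - p n) ^+ n @[n --> \oo] --> expR (- c).
Proof.
move=> p01 pc.
have p0 : p n @[n --> \oo] --> 0.
  have -> : 0 = 0 * c by rewrite mul0r.
  have h : n%:R^-1 * (n%:R * p n) @[n --> \oo] --> 0 * c.
    by apply: cvgM => //; exact: cvg_natV0.
  apply: cvg_trans h; apply: near_eq_cvg; near=> n.
  rewrite mulrA mulVf ?mul1r// pnatr_eq0 -lt0n.
  by near: n; exact: nbhs_infty_gt.
have lo : expR (- (n%:R * p n) / (1 - p n)) @[n --> \oo] --> expR (- c).
  apply: continuous_cvg; first exact: continuous_expR.
  rewrite -[X in _ --> X]divr1 -[X in _ / X](subr0 1).
  apply: cvgM; first exact: cvgN.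
  apply: cvgV; first by rewrite subr0 oner_neq0.
  by apply: cvgB => //; exact: cvg_cst.
have hi : expR (- (n%:R * p n)) @[n --> \oo] --> expR (- c).
  apply: continuous_cvg; first exact: continuous_expR.
  exact: cvgN.
apply: (@squeeze_cvgr _ _ _ _ _ _ _ _ _ lo hi); near=> n.
have pn1 : p n < 1 by near: n; apply: (cvgr_lt _ p0).
have q0 : 0 < 1 - p n by rewrite subr_gt0.
have /andP[pn0 _] := p01 n.
rewrite -!mulrN -mulrA !expRM_natl; apply/andP; split.
  apply: lerXn2r; rewrite ?nnegrE ?expR_ge0 ?(ltW q0)//.
  rewrite -[leRHS]lnK ?posrE// ler_expR mulNr -lerN2 opprK -lnV ?posrE//.
  rewrite (_ : p n / (1 - p n) = (1 - p n)^-1 - 1); last by field; rewrite gt_eqF.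
  rewrite -[X in ln X](subrK 1) addrC; apply: le_ln1Dx.
  by have := invr_gt0 (1 - p n); rewrite q0; lra.
apply: lerXn2r; rewrite ?nnegrE ?expR_ge0 ?(ltW q0)//.
exact: expR_ge1Dx.
Unshelve. all: by end_near. Qed.

Lemma exprn_lt_eps (c e : R) : 0 <= c < 1 -> 0 < e -> exists k, c ^+ k < e.
Proof.
move=> /andP[c0 c1] e0.
have : c ^+ n @[n --> \oo] --> 0 by apply: cvg_expr; rewrite ger0_norm.
move=> /(cvgr_lt _)/(_ _ e0) [k _ /(_ k)] /=; rewrite leqnn => /(_ isT) ?.
by exists k.
Qed.

Lemma exprn_gt_big (c e : R) : 1 < c -> 0 < e -> exists k, 1 < e * c ^+ k.
Proof.
move=> c1 e0; have c0 : 0 < c by lra.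
have [|k ck] := @exprn_lt_eps c^-1 e _ e0.
  by rewrite invr_ge0 ltW//= invf_lt1.
by exists k; rewrite -ltr_pdivrMr ?exprn_gt0// div1r -exprVn.
Qed.

(** Substitute for locally uniform convergence: a quantity caught between the values of the family
    at [y + e] and [y - e], for every [e], converges because [tau g] is continuous at [y]. *)
Lemma sandwich_tau {T : Type} (F : set_system T) {FF : Filter F}
    (Q : T -> R) (L : R -> T -> R) (g y : R) :
  0 < 1 + g * y ->
  (forall z, 0 < 1 + g * z -> L z @ F --> tau g z) ->
  (forall e, 0 < e -> \forall x \near F, L (y + e) x <= Q x <= L (y - e) x) ->
  Q @ F --> tau g y.
Proof.
move=> hy hL hQ; apply/cvgrPdist_lt => e e0.
have e20 : 0 < e / 2 by lra.
have ct := continuous_tau hy.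
have dom := near_tau_dom hy.
have clo : \forall z \near y, `|tau g y - tau g z| < e / 2.
  by move/cvgrPdist_lt : ct; exact.
have [r /= r0 hr] : nbhs y [set z | 0 < 1 + g * z /\ `|tau g y - tau g z| < e / 2].
  by apply: filterI.
pose h := r / 2; have h0 : 0 < h by rewrite /h; lra.
have [d1 c1] : 0 < 1 + g * (y + h) /\ `|tau g y - tau g (y + h)| < e / 2.
  by apply: hr; rewrite /ball_/= opprD addNKr normrN gtr0_norm// /h; lra.
have [d2 c2] : 0 < 1 + g * (y - h) /\ `|tau g y - tau g (y - h)| < e / 2.
  by apply: hr; rewrite /ball_/= opprB addrC subrK gtr0_norm// /h; lra.
have n1 : \forall x \near F, `|tau g (y + h) - L (y + h) x| < e / 2.
  by move/cvgrPdist_lt : (hL _ d1); exact.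
have n2 : \forall x \near F, `|tau g (y - h) - L (y - h) x| < e / 2.
  by move/cvgrPdist_lt : (hL _ d2); exact.
have n3 := hQ _ h0.
near=> x.
have /andP[q1 q2] : L (y + h) x <= Q x <= L (y - h) x by near: x; exact: n3.
have : `|tau g (y - h) - L (y - h) x| < e / 2 by near: x; exact: n2.
have : `|tau g (y + h) - L (y + h) x| < e / 2 by near: x; exact: n1.
move: c1 c2; rewrite !ltr_norml => /andP[? ?] /andP[? ?] /andP[? ?] /andP[? ?].
by apply/andP; split; lra.
Unshelve. all: by end_near. Qed.

End filter_lemmas.

(** * Limits at the right endpoint of the support *)

Section vanishing_filter.
Context {R : realType}.

(* Approaching the right endpoint of the support of a survival function [S],
   from inside the support, without naming that endpoint. *)
Definition vanishing (S : R -> R) : set_system R :=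
  [set P | exists2 d, 0 < d & forall x, 0 < S x < d -> P x].

(** Properness is not part of the instance: the filter is trivial when [S] has no small positive
    values. Where it matters, it enters as the hypothesis [nonvoid]. *)
#[global] Instance vanishing_filter S : Filter (vanishing S).
Proof.
split.
- by exists 1.
- move=> P Q [d d0 hP] [e e0 hQ]; exists (Num.min d e); first by rewrite lt_min d0.
  by move=> x /andP[x0]; rewrite lt_min => /andP[xd xe]; split;
    [apply: hP; rewrite x0|apply: hQ; rewrite x0].
- by move=> P Q PQ [d d0 hP]; exists d => // x /hP /PQ.
Qed.

Context (S : R -> R).
Context (S_ge0 : forall x, 0 <= S x).
Context (S_le1 : forall x, S x <= 1).
Context (S_ni : forall x y, x <= y -> S y <= S x).

Lemma surv_lt x y : S y < S x -> x < y.
Proof. by move=> h; rewrite ltNge; apply/negP => /S_ni; rewrite leNgt h. Qed.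

Lemma near_vanishing_gt0 : \forall x \near vanishing S, 0 < S x.
Proof. by exists 1 => // x /andP[]. Qed.

Lemma cvg_vanishing : S @ vanishing S --> (0 : R).
Proof.
apply/cvgrPdist_lt => e e0; exists e => // x /andP[x0 xe].
by rewrite sub0r normrN gtr0_norm.
Qed.

Lemma cvg_to_vanishing {T : Type} (F : set_system T) {FF : Filter F} (u : T -> R) :
  (\forall x \near F, 0 < S (u x)) -> S (u x) @[x --> F] --> 0 ->
  u @ F --> vanishing S.
Proof.
move=> u0 uS P [d d0 hP]; near=> x.
apply: hP; apply/andP; split; first by near: x.
by near: x; apply: (cvgr_lt _ uS).
Unshelve. all: by end_near. Qed.

Lemma vanishing_cvg_gt (u : R -> R) (l z : R) :
  u @ vanishing S --> l -> z < l -> \forall x \near vanishing S, z < u x.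
Proof. by move=> ul; exact: cvgr_gt. Qed.

Lemma vanishing_cvg_lt (u : R -> R) (l z : R) :
  u @ vanishing S --> l -> l < z -> \forall x \near vanishing S, u x < z.
Proof. by move=> ul; exact: cvgr_lt. Qed.

End vanishing_filter.

(** * Extreme value attraction and regular variation *)

Section auxiliary_function.
Context {R : realType} (S : R -> R).
Context (S_ge0 : forall x, 0 <= S x).
Context (S_le1 : forall x, S x <= 1).
Context (S_ni : forall x y, x <= y -> S y <= S x).

Context (a b : nat -> R) (g : R).
Context (a_gt0 : forall n, 0 < a n).
Context (S_cvg : forall x, 0 < 1 + g * x ->
  n%:R * S (a n * x + b n) @[n --> \oo] --> tau g x).

(** The sample size for which [x] is a typical extremum: [N x * S x] tends to [1]. *)
Let N (x : R) := Num.trunc (S x)^-1.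

Let N_oo : N @ vanishing S --> \oo.
Proof.
apply/cvgnyPge => A; exists (A.+1%:R^-1); first by rewrite invr_gt0.
move=> x /andP[x0 xA] /=.
have Sx0 : 0 <= (S x)^-1 by rewrite invr_ge0.
have /andP[_] := truncn_itv Sx0.
rewrite -/(N x) => h.
have : A.+1%:R < (N x).+1%:R :> R.
  apply: lt_trans h; rewrite -[ltLHS]invrK ltf_pV2 ?posrE ?invr_gt0//.
by rewrite ltr_nat ltnS => /ltnW.
Qed.

Let NS_cvg : (N x)%:R * S x @[x --> vanishing S] --> (1 : R).
Proof.
have lo : 1 - S x @[x --> vanishing S] --> (1 : R).
  rewrite -[X in _ --> X]subr0; apply: cvgB; first exact: cvg_cst.
  exact: cvg_vanishing.
apply: (@squeeze_cvgr _ _ _ _ _ _ _ _ _ lo (cvg_cst _)).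
near=> x; have x0 : 0 < S x by near: x; exact: near_vanishing_gt0.
have Sx0 : 0 <= (S x)^-1 by rewrite invr_ge0.
have := truncn_itv Sx0.
rewrite -/(N x) -natr1 => /andP[h1 h2].
rewrite -(ler_pM2r x0) mulVf ?gt_eqF// in h1.
rewrite -(ltr_pM2r x0) mulVf ?gt_eqF// mulrDl mul1r in h2.
by apply/andP; split; lra.
Unshelve. all: by end_near. Qed.

Let S_cvgN z : 0 < 1 + g * z ->
  (N x)%:R * S (a (N x) * z + b (N x)) @[x --> vanishing S] --> tau g z.
Proof.
move=> hz; exact: (cvg_comp N (fun n => n%:R * S (a n * z + b n)) N_oo (S_cvg hz)).
Qed.

(** The limit [1 = tau g 0] of [N x * S x] lies strictly between [tau g e] and [tau g (- e)];
    comparing values of the monotone [S] then locates [x] itself. *)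
Let near_center e : 0 < e ->
  \forall x \near vanishing S, a (N x) * (- e) + b (N x) < x < a (N x) * e + b (N x).
Proof.
(* Shrinking [e] to [e1] with [|g * e1| < 1] puts both [e1] and [- e1] in the domain of [tau g]. *)
suff main e1 : 0 < e1 -> 0 < 1 + g * e1 -> 0 < 1 + g * (- e1) ->
    \forall x \near vanishing S,
      a (N x) * (- e1) + b (N x) < x < a (N x) * e1 + b (N x).
  move=> e0; pose e1 := Num.min e (`|g| + 1)^-1.
  have ag : 0 < `|g| + 1 by have := normr_ge0 g; lra.
  have e10 : 0 < e1 by rewrite /e1 lt_min e0 invr_gt0.
  have ge1 : `|g * e1| < 1.
    have e1g : e1 <= (`|g| + 1)^-1 by rewrite /e1 ge_min lexx orbT.
    rewrite normrM (gtr0_norm e10) (le_lt_trans (ler_wpM2l (normr_ge0 g) e1g))//.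
    by rewrite ltr_pdivrMr// mul1r; lra.
  have e1e : e1 <= e by rewrite /e1 ge_min lexx.
  move: ge1; rewrite ltr_norml => /andP[? ?].
  near=> x.
  have /andP[] : a (N x) * (- e1) + b (N x) < x < a (N x) * e1 + b (N x).
    by near: x; apply: main => //; lra.
  have := a_gt0 (N x) => ? ? ?.
  have : a (N x) * e1 <= a (N x) * e by rewrite ler_pM2l.
  by move=> ?; apply/andP; split; lra.
move=> e10 h1 h2.
have t1 : tau g e1 < 1 by rewrite -(tau0 g); apply: ltr_tau => //; lra.
have t2 : 1 < tau g (- e1) by rewrite -[ltLHS](tau0 g); apply: ltr_tau => //; lra.
pose m1 := (tau g e1 + 1) / 2; pose m2 := (tau g (- e1) + 1) / 2.
have c1 := vanishing_cvg_lt (S_cvgN h1) (z := m1) ltac:(rewrite /m1; lra).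
have c2 := vanishing_cvg_gt (S_cvgN h2) (z := m2) ltac:(rewrite /m2; lra).
have d1 := vanishing_cvg_gt NS_cvg (z := m1) ltac:(rewrite /m1; lra).
have d2 := vanishing_cvg_lt NS_cvg (z := m2) ltac:(rewrite /m2; lra).
near=> x; apply/andP; split; apply: (surv_lt S_ni).
- rewrite ltNge; apply/negP => h.
  have : (N x)%:R * S (a (N x) * - e1 + b (N x)) <= (N x)%:R * S x by rewrite ler_wpM2l.
  suff : (N x)%:R * S x < m2 /\ m2 < (N x)%:R * S (a (N x) * - e1 + b (N x)) by lra.
  by split; near: x.
- rewrite ltNge; apply/negP => h.
  have : (N x)%:R * S x <= (N x)%:R * S (a (N x) * e1 + b (N x)) by rewrite ler_wpM2l.
  suff : (N x)%:R * S (a (N x) * e1 + b (N x)) < m1 /\ m1 < (N x)%:R * S x by lra.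
  by split; near: x.
Unshelve. all: by end_near. Qed.

(** With [f = a \o N], the discrete parameter [n] is replaced by the point [x]: [x] is within
    [o(f x)] of [b (N x)], so [S (x + f x * y) / S x] is compared with [n * S (a n * z + b n)] at
    [n = N x], for [z] near [y]. *)
Lemma auxiliary_function : exists f : R -> R, (forall x, 0 < f x) /\
  forall y, 0 < 1 + g * y ->
    S (x + f x * y) / S x @[x --> vanishing S] --> tau g y.
Proof.
exists (a \o N); split=> [x|y hy]; first exact: a_gt0.
apply: (@sandwich_tau _ _ _ _ _
  (fun z x => ((N x)%:R * S (a (N x) * z + b (N x))) / ((N x)%:R * S x))) => //.
  move=> z hz; rewrite -[X in _ --> X]divr1; apply: cvgM; first exact: S_cvgN.
  by apply: cvgV; [exact: oner_neq0|exact: NS_cvg].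
move=> e e0; near=> x.
have x0 : 0 < S x by near: x; exact: near_vanishing_gt0.
have NS : 0 < (N x)%:R * S x by near: x; apply: (cvgr_gt _ NS_cvg).
have Npos : (N x)%:R != 0 :> R.
  by apply/eqP => N0; move: NS; rewrite N0 mul0r ltxx.
have /andP[c1 c2] : a (N x) * (- e) + b (N x) < x < a (N x) * e + b (N x).
  by near: x; exact: near_center.
rewrite -!mulf_div divff// !mul1r !ler_pM2r ?invr_gt0// /=.
by apply/andP; split; apply: S_ni; rewrite ?mulrDr ?mulrBr; lra.
Unshelve. all: by end_near. Qed.

End auxiliary_function.

Section regular_variation.
Context {R : realType} (S : R -> R).
Context (S_ge0 : forall x, 0 <= S x).
Context (S_le1 : forall x, S x <= 1).
Context (S_ni : forall x y, x <= y -> S y <= S x).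

Context (f : R -> R) (g : R).
Context (f_gt0 : forall x, 0 < f x).
Context (S_cvg : forall y, 0 < 1 + g * y ->
  S (x + f x * y) / S x @[x --> vanishing S] --> tau g y).

Lemma surv_shift_cvg y : 0 < 1 + g * y ->
  (fun x => x + f x * y) @ vanishing S --> vanishing S.
Proof.
move=> hy; apply: cvg_to_vanishing.
  have := vanishing_cvg_gt (S_cvg hy) (tau_gt0 hy) => h; near=> x.
  have x0 : 0 < S x by near: x; exact: near_vanishing_gt0.
  have : 0 < S (x + f x * y) / S x by near: x.
  by rewrite pmulr_lgt0 ?invr_gt0.
have h : S (x + f x * y) / S x * S x @[x --> vanishing S] --> tau g y * 0.
  by apply: cvgM; [exact: S_cvg|exact: cvg_vanishing].
rewrite mulr0 in h; apply: cvg_trans h; apply: near_eq_cvg; near=> x.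
have x0 : 0 < S x by near: x; exact: near_vanishing_gt0.
by rewrite divfK// gt_eqF.
Unshelve. all: by end_near. Qed.

Lemma surv_moving_cvg (w : R -> R) y : 0 < 1 + g * y ->
  w @ vanishing S --> y ->
  S (x + f x * w x) / S x @[x --> vanishing S] --> tau g y.
Proof.
move=> hy wy.
apply: (@sandwich_tau _ _ _ _ _ (fun z x => S (x + f x * z) / S x)) => //.
move=> e e0; near=> x.
have x0 : 0 < S x by near: x; exact: near_vanishing_gt0.
have : `|y - w x| < e by near: x; move/cvgrPdist_lt : wy; exact.
rewrite ltr_norml => /andP[w1 w2]; have := f_gt0 x => fx.
rewrite !ler_pM2r ?invr_gt0//.
by apply/andP; split; apply: S_ni; rewrite lerD2l ler_pM2l//; lra.
Unshelve. all: by end_near. Qed.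

(** The shift at which [1 + g * y = 1 / 2], after which [f] is expected to be halved. It points
    towards the endpoint when [g < 0] and away from it when [g > 0]. *)
Let y0 := - (2 * g)^-1.

Let gy0 : g != 0 -> g * y0 = - 2^-1.
Proof. by move=> g0; rewrite /y0; field. Qed.

(** If [f] were larger at the shifted point, a further shift by [z] of its units would pass
    [x + f x * y1]. But by [tauM] the two successive shifts have limit [tau g (y0 + z / 2)], larger
    than [tau g y1] since [y1 = y0 + (1/2 + e) * z]. The choice [|g * z| = 1 / 4] keeps all
    arguments in the domain. *)
Lemma auxiliary_contraction e : g != 0 -> 0 < e < 2^-1 ->
  \forall x \near vanishing S, f (x + f x * y0) <= (2^-1 + e) * f x.
Proof.
move=> g0 /andP[e0 e2].
have gn : 0 < `|g| by rewrite normr_gt0.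
have g4 := gy0 g0.
pose z := (4 * `|g|)^-1; have z0 : 0 < z by rewrite /z invr_gt0 mulr_gt0.
have gz : `|g * z| = 4^-1.
  by rewrite normrM (gtr0_norm z0) /z; field; rewrite gt_eqF.
have {gz} /andP[gz1 gz2] : - 4^-1 <= g * z <= 4^-1 by rewrite -ler_norml gz.
have hy : 0 < 1 + g * y0 by rewrite g4; lra.
have hz : 0 < 1 + g * z by lra.
pose y1 := y0 + (2^-1 + e) * z.
have h1 : 0 < 1 + g * y1 by rewrite /y1 mulrDr mulrCA g4; nra.
have h2 : 0 < 1 + g * (y0 + z + g * y0 * z) by rewrite g4; lra.
have h3 : tau g y1 < tau g y0 * tau g z.
  rewrite tauM//; apply: ltr_tau => //; rewrite g4 /y1; nra.
have c1 : S ((x + f x * y0) + f (x + f x * y0) * z) / S x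
    @[x --> vanishing S] --> tau g y0 * tau g z.
  have c : S (x + f x * y0) / S x * (S ((x + f x * y0) + f (x + f x * y0) * z) /
      S (x + f x * y0)) @[x --> vanishing S] --> tau g y0 * tau g z.
    apply: cvgM; first exact: S_cvg.
    exact: (cvg_comp (fun x => x + f x * y0) (fun x => S (x + f x * z) / S x)
              (surv_shift_cvg hy) (S_cvg hz)).
  apply: cvg_trans c; apply: near_eq_cvg.
  have := vanishing_cvg_gt (S_cvg hy) (tau_gt0 hy) => h; near=> x.
  have x0 : 0 < S x by near: x; exact: near_vanishing_gt0.
  have : 0 < S (x + f x * y0) / S x by near: x.
  rewrite pmulr_lgt0 ?invr_gt0// => x1.
  by field; rewrite !gt_eqF.
pose m := (tau g y1 + tau g y0 * tau g z) / 2.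
have d1 := vanishing_cvg_gt c1 (z := m) ltac:(rewrite /m; lra).
have d2 := vanishing_cvg_lt (S_cvg h1) (z := m) ltac:(rewrite /m; lra).
near=> x; rewrite leNgt; apply/negP => fx.
have x0 : 0 < S x by near: x; exact: near_vanishing_gt0.
have : m < S ((x + f x * y0) + f (x + f x * y0) * z) / S x by near: x.
have : S (x + f x * y1) / S x < m by near: x.
suff : S ((x + f x * y0) + f (x + f x * y0) * z) / S x <= S (x + f x * y1) / S x.
  by lra.
rewrite ler_pM2r ?invr_gt0//; apply: S_ni; rewrite /y1 mulrDr addrA lerD2l.
by rewrite mulrA ler_pM2r// mulrC ltW.
Unshelve. all: by end_near. Qed.

(** Iterate [x := x + f x * y0]. Each step divides [f] by almost two and multiplies [S] by at most
    some [c < 1], so [S] falls below [S z] after finitely many steps, while the total displacement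
    is bounded by a geometric series. *)
Lemma auxiliary_ge_neg C : g < 0 -> - g^-1 < C ->
  \forall x \near vanishing S, forall z, 0 < S z -> z - x <= C * f x.
Proof.
move=> g0 gC; have gn0 : g != 0 by rewrite lt_eqF.
have y00 : 0 < y0 by rewrite /y0 oppr_gt0 invr_lt0 pmulr_rlt0.
have yE : y0 = 2^-1 * - g^-1 by rewrite /y0; field.
have C0 : 0 < C by lra.
(* Chosen so that the geometric sum [y0 / (1 - (1/2 + e))] equals [C]; the assumption [- g^-1 < C]
   is what makes [e] positive. *)
pose e := 2^-1 - y0 / C.
have CE : C * (2^-1 - e) = y0 by rewrite /e; field; rewrite gt_eqF.
have e0 : 0 < e < 2^-1.
  rewrite /e; apply/andP; split; last by rewrite gtrBl divr_gt0.
  by rewrite subr_gt0 ltr_pdivrMr// yE ltr_pM2l.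
have hy : 0 < 1 + g * y0 by rewrite gy0//; lra.
have t1 : tau g y0 < 1 by rewrite -(tau0 g); apply: ltr_tau => //; rewrite mulr0; lra.
pose c := (1 + tau g y0) / 2.
have n1 := vanishing_cvg_lt (S_cvg hy) (z := c) ltac:(rewrite /c; lra).
have [d d0 hd] : vanishing S [set x | f (x + f x * y0) <= (2^-1 + e) * f x /\
    S (x + f x * y0) / S x < c].
  by apply: filterI n1; exact: auxiliary_contraction.
have := tau_gt0 hy => t0.
exists d => // x xd z z0.
have [k] := @exprn_lt_eps _ c (S z) ltac:(rewrite /c; apply/andP; split; lra) z0.
have : S x * c ^+ k <= c ^+ k.
  by rewrite -[leRHS]mul1r ler_wpM2r// exprn_ge0// /c; lra.
move=> /le_lt_trans /[apply].
elim: k x xd => [x /andP[x0 _]|k IH x xd].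
  rewrite mulr1 => /(surv_lt S_ni) zx.
  by have := mulr_gt0 C0 (f_gt0 x); lra.
rewrite exprS mulrA => h.
have [f1 s1] := hd x xd; case/andP: xd => x0 xd.
have fx := f_gt0 x; have yfx : 0 < f x * y0 by rewrite mulr_gt0.
have [zx|xz] := leP z (x + f x * y0).
  have : f x * y0 <= C * f x by rewrite mulrC ler_pM2r// -CE; nra.
  by lra.
have : z - (x + f x * y0) <= C * f (x + f x * y0).
  apply: IH.
    apply/andP; split; first by rewrite (lt_le_trans z0)// S_ni// ltW.
    by apply: le_lt_trans xd; apply: S_ni; lra.
  have sx : S (x + f x * y0) <= S x * c by rewrite (mulrC (S x)) -ler_pdivrMr// ltW.
  have c0 : 0 <= c by rewrite /c; lra.
  by apply: le_lt_trans h; rewrite ler_wpM2r ?exprn_ge0.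
have : C * f (x + f x * y0) <= C * ((2^-1 + e) * f x) by rewrite ler_pM2l.
have : C * f x = y0 * f x + C * ((2^-1 + e) * f x) by rewrite -CE; field.
by rewrite (mulrC y0); lra.
Qed.

(** Mirror image of the case [g < 0]: the steps go left, [S] is multiplied by more than some [c > 1]
    each time, and since [S <= 1] the point [x1] is crossed after finitely many of them. *)
Lemma auxiliary_ge_pos C : 0 < g -> g^-1 < C ->
  (forall d, 0 < d -> exists x, 0 < S x < d) ->
  exists2 x1, 0 < S x1 & \forall x \near vanishing S, x - x1 <= C * f x.
Proof.
move=> g0 gC nonvoid; have gn0 : g != 0 by rewrite gt_eqF.
have gi : 0 < g^-1 by rewrite invr_gt0.
have yE : y0 = - (2^-1 * g^-1) by rewrite /y0; field.
have y00 : y0 < 0 by lra.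
have C0 : 0 < C by lra.
pose e := 2^-1 + y0 / C.
have CE : C * (2^-1 - e) = - y0 by rewrite /e; field; rewrite gt_eqF.
have e0 : 0 < e < 2^-1.
  rewrite /e; apply/andP; split; last first.
    by rewrite gtrDl pmulr_llt0 ?invr_gt0.
  by rewrite yE mulNr subr_gt0 ltr_pdivrMr// ltr_pM2l.
have hy : 0 < 1 + g * y0 by rewrite gy0//; lra.
have t1 : 1 < tau g y0 by rewrite -[ltLHS](tau0 g); apply: ltr_tau => //; rewrite mulr0; lra.
pose c := (1 + tau g y0) / 2.
have c1 : 1 < c by rewrite /c; lra.
have n1 := vanishing_cvg_gt (S_cvg hy) (z := c) ltac:(rewrite /c; lra).
have [d d0 hd] : vanishing S [set x | f (x + f x * y0) <= (2^-1 + e) * f x /\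
    c < S (x + f x * y0) / S x].
  by apply: filterI n1; exact: auxiliary_contraction.
have [x1 /andP[x10 x1d]] := nonvoid d d0.
exists x1 => //; exists (S x1) => // x /andP[x0 xx1].
have {xx1} : x1 <= x by rewrite ltW// (surv_lt S_ni).
have [k] := @exprn_gt_big _ c (S x) c1 x0.
elim: k x x0 => [x x0|k IH x x0].
  by rewrite mulr1 ltNge S_le1.
rewrite exprS mulrA => h x1x.
have xd : 0 < S x < d by rewrite x0 (le_lt_trans (S_ni x1x)).
have [f1 s1] := hd x xd.
have fx := f_gt0 x; have yfx : f x * y0 < 0 by rewrite pmulr_rlt0.
have CfE : C * f x = - (f x * y0) + C * ((2^-1 + e) * f x).
  by rewrite -mulrN -CE; field.
have Cf : 0 < C * ((2^-1 + e) * f x).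
  by rewrite !mulr_gt0//; case/andP: e0; lra.
have [xx|xx] := ltP (x + f x * y0) x1; first by lra.
have : (x + f x * y0) - x1 <= C * f (x + f x * y0).
  have sx : S x * c < S (x + f x * y0) by rewrite (mulrC (S x)) -ltr_pdivlMr.
  apply: IH => //.
    by apply: lt_trans sx; rewrite mulr_gt0//; lra.
  by apply: (lt_trans h); rewrite ltr_pM2r// exprn_gt0//; lra.
have : C * f (x + f x * y0) <= C * ((2^-1 + e) * f x) by rewrite ler_pM2l.
by lra.
Qed.

(** Beyond [x2] the scale [f] is at least [(x2 - x1) / C], and the step [x + f x] stays in the
    support, so walking from [x2] by steps of at least this fixed length never leaves it. *)
Lemma surv_unbounded : 0 < g ->
  (forall d, 0 < d -> exists x, 0 < S x < d) ->
  forall M, exists2 x, 0 < S x & M < x.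
Proof.
move=> g0 nonvoid M.
have gi : 0 < g^-1 by rewrite invr_gt0.
pose C := g^-1 + 1; have C0 : 0 < C by rewrite /C; lra.
have [x1 x10 n1] := @auxiliary_ge_pos C g0 ltac:(rewrite /C; lra) nonvoid.
have hy : 0 < 1 + g * 1 by lra.
have [d d0 hd] : vanishing S [set x | x - x1 <= C * f x /\
    0 < S (x + f x * 1) / S x].
  by apply: filterI n1 _; exact: (vanishing_cvg_gt (S_cvg hy) (tau_gt0 hy)).
have [x2 /andP[x20]] := nonvoid (Num.min d (S x1)) ltac:(by rewrite lt_min d0).
rewrite lt_min => /andP[x2d x2x1].
have x12 := surv_lt S_ni x2x1.
pose c := (x2 - x1) / C.
have c0 : 0 < c by rewrite /c divr_gt0// subr_gt0.
have step k : exists2 x, 0 < S x & x2 + k%:R * c <= x.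
  elim: k => [|k [x x0 xk]]; first by exists x2 => //; rewrite mul0r addr0.
  have kc : 0 <= k%:R * c by apply: mulr_ge0 => //; exact: ltW.
  have x2x : x2 <= x by lra.
  have [h1 h2] : x - x1 <= C * f x /\ 0 < S (x + f x * 1) / S x.
    by apply: hd; rewrite x0 (le_lt_trans (S_ni x2x)).
  exists (x + f x * 1); first by move: h2; rewrite pmulr_lgt0 ?invr_gt0.
  rewrite -natr1 mulrDl mul1r mulr1.
  suff : c <= f x by lra.
  by rewrite /c ler_pdivrMr// mulrC; lra.
have [k hk] : exists k : nat, M - x2 < k%:R * c.
  exists (Num.trunc (`|M - x2| / c)).+1.
  rewrite -ltr_pdivrMr//.
  have h : 0 <= `|M - x2| / c by apply: divr_ge0 => //; exact: ltW.
  have /andP[_] := truncn_itv h; apply: le_lt_trans.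
  by rewrite ler_pM2r ?invr_gt0// ler_norm.
by have [x x0 xk] := step k; exists x => //; lra.
Qed.

Lemma surv_bounded : g < 0 ->
  (forall d, 0 < d -> exists x, 0 < S x < d) ->
  exists M, forall x, 0 < S x -> x <= M.
Proof.
move=> g0 nonvoid.
have [d d0 hd] := @auxiliary_ge_neg (- g^-1 + 1) g0 ltac:(lra).
have [x /hd h] := nonvoid d d0.
by exists ((- g^-1 + 1) * f x + x) => z /h; lra.
Qed.

End regular_variation.

Section regular_variation_at_endpoint.
Context {R : realType} (S : R -> R).
Context (S_ge0 : forall x, 0 <= S x).
Context (S_le1 : forall x, S x <= 1).
Context (S_ni : forall x y, x <= y -> S y <= S x).

Lemma near_vanishing_gt M : 0 < S M -> \forall x \near vanishing S, M < x.
Proof. by move=> M0; exists (S M) => // x /andP[_ /(surv_lt S_ni)]. Qed.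

Context (f : R -> R) (g : R).
Context (f_gt0 : forall x, 0 < f x).
Context (S_cvg : forall y, 0 < 1 + g * y ->
  S (x + f x * y) / S x @[x --> vanishing S] --> tau g y).

(** Upper bound: moving left by [f x / (g + e)] is an admissible shift, which still approaches the
    endpoint and so remains positive. Lower bound: [auxiliary_ge_pos] with a constant slightly above
    [g^-1], the fixed [x1] being negligible. *)
Lemma auxiliary_ratio_infinite : (forall x, 0 < S x) ->
  (forall d, 0 < d -> exists x, 0 < S x < d) -> 0 <= g ->
  f x / x @[x --> vanishing S] --> g.
Proof.
move=> S_gt0 nonvoid g0; apply/cvgrPdist_lt => e e0.
have ge : 0 < g + e by lra.
pose y := (g + e)^-1.
have hy : 0 < 1 + g * - y.
  by rewrite mulrN subr_gt0 /y ltr_pdivrMr//; lra.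
have n1 : \forall x \near vanishing S, 0 < x + f x * - y.
  by have := surv_shift_cvg S_cvg hy (near_vanishing_gt (S_gt0 0)).
have n2 : \forall x \near vanishing S, (g - e) * x < f x.
  have [ge0|ge0] := leP (g - e) 0.
    near=> x; have x0 : 0 < x by near: x; exact: near_vanishing_gt.
    by have := f_gt0 x; have := mulr_le0_ge0 ge0 (ltW x0); lra.
  have gp : 0 < g by lra.
  pose h := g - e / 2; have h0 : 0 < h by rewrite /h; lra.
  have [|x1 _ n2] := auxiliary_ge_pos S_le1 S_ni f_gt0 S_cvg (C := h^-1) gp _ nonvoid.
    by rewrite ltf_pV2 ?posrE// /h; lra.
  near=> x.
  have x0 : 0 < x by near: x; exact: near_vanishing_gt.
  have x2 : 2 * h * x1 / e < x by near: x; exact: near_vanishing_gt.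
  have : x - x1 <= h^-1 * f x by near: x.
  rewrite ler_pdivlMl// => hx.
  rewrite ltr_pdivrMr// in x2.
  apply: lt_le_trans hx; rewrite mulrBr {1}/h; lra.
near=> x.
have x0 : 0 < x by near: x; exact: near_vanishing_gt.
have h1 : 0 < x + f x * - y by near: x.
have h2 : (g - e) * x < f x by near: x.
rewrite mulrN subr_gt0 /y ltr_pdivrMr// in h1.
rewrite ltr_distlC ltr_pdivlMr// ltr_pdivrMr//.
by apply/andP; split => //; rewrite mulrC.
Unshelve. all: by end_near. Qed.

(** Here [x] is negative. Moving right by [f x / (e - g)] stays in the support, hence below [0],
    which bounds [f] from above; the bound from below lets [z] range up to the endpoint [0] in
    [auxiliary_ge_neg]. *)
Lemma auxiliary_ratio_zero : (forall x, (0 < S x) = (x < 0)) -> g <= 0 ->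
  f x / x @[x --> vanishing S] --> g.
Proof.
move=> S_gt0 g0; apply/cvgrPdist_lt => e e0.
have ge : 0 < e - g by lra.
pose y := (e - g)^-1.
have hy : 0 < 1 + g * y.
  rewrite (_ : 1 + g * y = e / (e - g)); last by rewrite /y; field; rewrite gt_eqF.
  by rewrite divr_gt0.
have n0 : \forall x \near vanishing S, x < 0.
  by exists 1 => // x /andP[]; rewrite S_gt0.
have n1 : \forall x \near vanishing S, x + f x * y < 0.
  by have := surv_shift_cvg S_cvg hy n0.
have n2 : \forall x \near vanishing S, (g + e) * x < f x.
  have [ge0|ge0] := leP 0 (g + e).
    near=> x; have x0 : x < 0 by near: x.
    by have := f_gt0 x; have := mulr_ge0_le0 ge0 (ltW x0); lra.
  have gn : g < 0 by lra.
  pose h := - (g + e / 2); have h0 : 0 < h by rewrite /h; lra.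
  have [|d d0 n2] := auxiliary_ge_neg S_le1 S_ni f_gt0 S_cvg (C := h^-1) gn _.
    by rewrite -invrN ltf_pV2 ?posrE// /h; lra.
  exists d => // x xd; have := n2 x xd => {}n2.
  have x0 : x < 0 by case/andP: xd; rewrite S_gt0.
  suff : - x <= h^-1 * f x.
    rewrite ler_pdivlMl// => /lt_le_trans; apply.
    by rewrite /h; nra.
  rewrite leNgt; apply/negP => xf.
  (* The midpoint of [x + h^-1 * f x] and [0]: a point of the support lying further from [x] than
     [n2] allows. *)
  have := n2 (- (- x - h^-1 * f x) / 2); rewrite S_gt0.
  have hf : - (- x - h^-1 * f x) / 2 < 0 by lra.
  by move=> /(_ hf); lra.
near=> x.
have x0 : x < 0 by near: x.
have h1 : x + f x * y < 0 by near: x.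
have h2 : (g + e) * x < f x by near: x.
have h3 : f x < (g - e) * x.
  have : f x * y < - x by lra.
  by rewrite /y ltr_pdivrMr//; lra.
by rewrite ltr_distlC ltr_ndivlMr// ltr_ndivrMr// h3 h2.
Unshelve. all: by end_near. Qed.

(** The point [r * x] is [x + f x * w x] with [w x = (r - 1) / (f x / x)], which tends to
    [(r - 1) / g]. *)
Lemma surv_regular r : g != 0 -> (\forall x \near vanishing S, x != 0) ->
  f x / x @[x --> vanishing S] --> g -> 0 < r ->
  S (r * x) / S x @[x --> vanishing S] --> r `^ (- g^-1).
Proof.
move=> g0 xn fg r0; rewrite -tau_powR//.
have hy : 0 < 1 + g * ((r - 1) / g) by rewrite mulrC divfK// addrC subrK.
have wy : (r - 1) / (f x / x) @[x --> vanishing S] --> (r - 1) / g.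
  by apply: cvgMl_tmp; exact: cvgV.
have := surv_moving_cvg S_ni f_gt0 S_cvg hy wy.
apply: cvg_trans; apply: near_eq_cvg; near=> x.
have x0 : x != 0 by near: x.
by congr (S _ / _); field; rewrite x0 gt_eqF.
Unshelve. all: by end_near. Qed.

(** Since [f x = o(x)], the point [r * x] ends up beyond [x + f x * Y] for every fixed [Y], where
    the limit ratio is [exp (- Y)]. The sign condition covers both [r > 1] at [+oo] and [r < 1] at
    [0]. *)
Lemma surv_rapid r : g = 0 -> (\forall x \near vanishing S, 0 < (r - 1) * x) ->
  f x / x @[x --> vanishing S] --> 0 ->
  S (r * x) / S x @[x --> vanishing S] --> 0.
Proof.
move=> g0 rx f0; apply/cvgrPdist_lt => e e0.
have [Y Y0 Ye] : exists2 Y, 0 < Y & expR (- Y) < e.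
  exists (1 + e^-1); first by have := invr_gt0 e; rewrite e0; lra.
  rewrite expRN -[ltRHS]invrK ltf_pV2 ?posrE ?expR_gt0 ?invr_gt0//.
  by have := expR_ge1Dx (1 + e^-1); lra.
have hY : 0 < 1 + g * Y by rewrite g0; lra.
have tY : tau g Y < e by rewrite /tau g0 eqxx.
have n1 := vanishing_cvg_lt (S_cvg hY) tY.
have n2 : \forall x \near vanishing S, r != 1 -> `|f x / x| < `|r - 1| / Y.
  have [r1|r1] := eqVneq r 1; first by near=> x.
  have p : 0 < `|r - 1| / Y by rewrite divr_gt0// normr_gt0 subr_eq0.
  move/cvgrPdist_lt : f0 => /(_ _ p) f0; near=> x => _.
  by rewrite -normrN -sub0r; near: x; exact: f0.
near=> x.
have x0 : 0 < S x by near: x; exact: near_vanishing_gt0.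
have rx0 : 0 < (r - 1) * x by near: x.
have r1 : r != 1 by apply/eqP => r1; move: rx0; rewrite r1 subrr mul0r ltxx.
have xn : x != 0 by apply/eqP => x1; move: rx0; rewrite x1 mulr0 ltxx.
have h2 : r != 1 -> `|f x / x| < `|r - 1| / Y by near: x.
have h1 : S (x + f x * Y) / S x < e by near: x.
move: (h2 r1); rewrite normrM normfV (gtr0_norm (f_gt0 x)) ltr_pdivlMr//.
rewrite mulrAC ltr_pdivrMr ?normr_gt0// -normrM (gtr0_norm rx0) => h3.
rewrite sub0r normrN ger0_norm ?divr_ge0//.
apply: le_lt_trans h1; rewrite ler_pM2r ?invr_gt0//; apply: S_ni; lra.
Unshelve. all: by end_near. Qed.

End regular_variation_at_endpoint.

Section attraction.
Context {R : realType} (S : R -> R).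
Context (S_ge0 : forall x, 0 <= S x).
Context (S_le1 : forall x, S x <= 1).
Context (S_ni : forall x y, x <= y -> S y <= S x).
Context (nonvoid : forall d, 0 < d -> exists x, 0 < S x < d).
Context (a b : nat -> R) (g : R).
Context (a_gt0 : forall n, 0 < a n).
Context (S_cvg : forall x, 0 < 1 + g * x ->
  n%:R * S (a n * x + b n) @[n --> \oo] --> tau g x).

Lemma attraction_unbounded : 0 < g -> forall M, exists2 x, 0 < S x & M < x.
Proof.
have [f [f0 fS]] := auxiliary_function S_ge0 S_ni a_gt0 S_cvg.
by move=> g0; exact: (surv_unbounded S_le1 S_ni f0 fS g0 nonvoid).
Qed.

Lemma attraction_bounded : g < 0 -> exists M, forall x, 0 < S x -> x <= M.
Proof.
have [f [f0 fS]] := auxiliary_function S_ge0 S_ni a_gt0 S_cvg.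
by move=> g0; exact: (surv_bounded S_le1 S_ni f0 fS g0 nonvoid).
Qed.

Lemma attraction_regular_infinite r : (forall x, 0 < S x) -> 0 < g -> 0 < r ->
  S (r * x) / S x @[x --> vanishing S] --> r `^ (- g^-1).
Proof.
have [f [f0 fS]] := auxiliary_function S_ge0 S_ni a_gt0 S_cvg.
move=> S_gt0 g0 r0; apply: (surv_regular S_ni f0 fS) => //.
- by rewrite gt_eqF.
- by apply: filterS (near_vanishing_gt S_ni (S_gt0 0)) => x /gt_eqF ->.
- exact: (auxiliary_ratio_infinite S_le1 S_ni f0 fS S_gt0 nonvoid (ltW g0)).
Qed.

Lemma attraction_rapid_infinite r : (forall x, 0 < S x) -> g = 0 -> 1 < r ->
  S (r * x) / S x @[x --> vanishing S] --> 0.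
Proof.
have [f [f0 fS]] := auxiliary_function S_ge0 S_ni a_gt0 S_cvg.
move=> S_gt0 g0 r1; apply: (surv_rapid S_ge0 S_ni f0 fS) => //.
  apply: filterS (near_vanishing_gt S_ni (S_gt0 0)) => x x0.
  by rewrite mulr_gt0// subr_gt0.
rewrite -[X in _ --> X]g0.
by apply: (auxiliary_ratio_infinite S_le1 S_ni f0 fS S_gt0 nonvoid); rewrite g0.
Qed.

Lemma attraction_regular_zero r : (forall x, (0 < S x) = (x < 0)) -> g < 0 ->
  0 < r -> S (r * x) / S x @[x --> vanishing S] --> r `^ (- g^-1).
Proof.
have [f [f0 fS]] := auxiliary_function S_ge0 S_ni a_gt0 S_cvg.
move=> S_gt0 g0 r0; apply: (surv_regular S_ni f0 fS) => //.
- by rewrite lt_eqF.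
- by exists 1 => // x /andP[]; rewrite S_gt0 => /lt_eqF ->.
- exact: (auxiliary_ratio_zero S_le1 S_ni f0 fS S_gt0 (ltW g0)).
Qed.

Lemma attraction_rapid_zero r : (forall x, (0 < S x) = (x < 0)) -> g = 0 ->
  r < 1 -> S (r * x) / S x @[x --> vanishing S] --> 0.
Proof.
have [f [f0 fS]] := auxiliary_function S_ge0 S_ni a_gt0 S_cvg.
move=> S_gt0 g0 r1; apply: (surv_rapid S_ge0 S_ni f0 fS) => //.
  by exists 1 => // x /andP[]; rewrite S_gt0 => x0 _; rewrite nmulr_rgt0// subr_lt0.
rewrite -[X in _ --> X]g0.
by apply: (auxiliary_ratio_zero S_le1 S_ni f0 fS S_gt0); rewrite g0.
Qed.

End attraction.

Lemma powR_slope {R : realType} (p : R) :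
  ((1 + h) `^ p - 1) / h @[h --> (0 : R)^'] --> p.
Proof.
have d1 : derivable (@powR R ^~ p) 1 1.
  by apply: derivable_powR; rewrite in_itv/= andbT.
have /= dE := @powR_derive1 R p 1; rewrite in_itv/= andbT ltr01 in dE.
have := d1; rewrite /derivable => /cvg_ex[l hl].
have lE : l = p.
  rewrite -(cvg_lim _ hl)//.
  by rewrite -[lim _]/('D_1 (@powR R ^~ p) 1) -derive1E dE// powR1 mulr1.
rewrite lE in hl; apply: cvg_trans hl; apply: near_eq_cvg; near=> h.
by rewrite /= powR1 /GRing.scale/= mulr1 (addrC h) mulrC.
Unshelve. all: by end_near. Qed.

(** * The integrated tail and Karamata's theorem *)

Section integrated_tail.
Context {R : realType} (S H : R -> R).
Context (S_ge0 : forall x, 0 <= S x).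
Context (S_ni : forall x y, x <= y -> S y <= S x).
Context (H_gt0 : forall x, 0 < S x -> 0 < H x).
Context (H_bounds : forall v w, v <= w ->
  (w - v) * S w <= H v - H w <= (w - v) * S v).

Lemma tail_ni x y : x <= y -> H y <= H x.
Proof.
move=> xy; have /andP[h _] := H_bounds xy; rewrite -subr_ge0 (le_trans _ h)//.
by rewrite mulr_ge0// subr_ge0.
Qed.

Section ratio.
Context (H_scale_le : forall r c x, 0 < r ->
  (forall y, x <= y -> S (r * y) <= c * S y) -> H (r * x) <= r * c * H x).
Context (H_scale_ge : forall r c x, 0 < r -> 0 <= c ->
  (forall y, x <= y -> c * S y <= S (r * y)) -> r * c * H x <= H (r * x)).
Context (H_ge0 : forall x, 0 <= H x).

(** Substitution gives [H (r * x) = r * integral of S (r * t)] over [t >= x], so a two-sided bound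
    on [S (r * t) / S t] integrates to one on [H]. The hypothesis on zeros of [S] handles the points
    beyond the endpoint. *)
Lemma tail_ratio r l : 0 < r -> (forall y, S y = 0 -> S (r * y) = 0) ->
  S (r * x) / S x @[x --> vanishing S] --> l ->
  H (r * x) / H x @[x --> vanishing S] --> r * l.
Proof.
move=> r0 Sr0 hl; apply/cvgrPdist_le => e e0.
pose e1 := e / r; have e10 : 0 < e1 by rewrite divr_gt0.
have [d d0 hd] : \forall x \near vanishing S, `|l - S (r * x) / S x| <= e1.
  by move/cvgrPdist_le : hl; exact.
exists d => // x /andP[x0 xd].
have bnd y : x <= y -> (l - e1) * S y <= S (r * y) <= (l + e1) * S y.
  move=> xy; have := S_ge0 y; rewrite le_eqVlt => /orP[/eqP y0|y0].
    by rewrite -y0 !mulr0 Sr0// lexx.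
  have : `|l - S (r * y) / S y| <= e1.
    by apply: hd; rewrite y0 (le_lt_trans (S_ni xy)).
  by rewrite ler_distlC ler_pdivlMr// ler_pdivrMr.
have Hx := H_gt0 x0.
rewrite ler_distlC ler_pdivlMr// ler_pdivrMr//.
have re : e = r * e1 by rewrite /e1 mulrC divfK// gt_eqF.
rewrite re -mulrBr -mulrDr; apply/andP; split; last first.
  by apply: H_scale_le => // y /bnd /andP[].
(* The lower scaling bound requires a nonnegative factor; a negative one makes the claim trivial. *)
have [c0|c0] := leP 0 (l - e1).
  by apply: H_scale_ge => // y /bnd /andP[].
apply: (le_trans _ (H_ge0 _)); apply: mulr_le0_ge0; last exact: ltW.
by apply: mulr_ge0_le0; exact: ltW.
Qed.

End ratio.

(** Apply [H_bounds] between [x] and [(1 + h) * x] and divide by [h * H x]: in the limit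
    [x * S x / H x] is caught between [L1 h] and [L2 h], and both tend to [b - 1] as [h] tends to
    [0], by differentiating powers at [1]. *)
Lemma karamata b : ((\forall x \near vanishing S, 0 < x) \/
    (\forall x \near vanishing S, x < 0)) ->
  (forall r, 0 < r -> S (r * x) / S x @[x --> vanishing S] --> r `^ (- b)) ->
  (forall r, 0 < r -> H (r * x) / H x @[x --> vanishing S] --> r * r `^ (- b)) ->
  x * S x / H x @[x --> vanishing S] --> b - 1.
Proof.
move=> sgn rS rH; apply/cvgrPdist_lt => e e0.
pose L1 h := (1 - (1 + h) * (1 + h) `^ (- b)) / h.
pose L2 h := L1 h * (1 + h) `^ b.
have h1 : \forall h \near (0 : R)^', 0 < 1 + h.
  apply: nbhs_dnbhs; have : 0 < 1 + (0 : R) by rewrite addr0.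
  by have := @near_tau_dom R 1 0; rewrite mulr0 => /[apply]; apply: filterS => h; rewrite mul1r.
have cL1 : L1 h @[h --> (0 : R)^'] --> b - 1.
  have c : - (((1 + h) `^ (1 - b) - 1) / h) @[h --> (0 : R)^'] --> - (1 - b).
    by apply: cvgN; exact: powR_slope.
  rewrite -opprB; apply: cvg_trans c; apply: near_eq_cvg; near=> h.
  have h0 : 0 < 1 + h by near: h.
  rewrite powRD; last by rewrite (gt_eqF h0) implybT.
  by rewrite powRr1 ?(ltW h0)// -mulNr opprB.
have cpow : (1 + h) `^ b @[h --> (0 : R)^'] --> (1 : R).
  have c : 1 + ((1 + h) `^ b - 1) / h * h @[h --> (0 : R)^'] --> 1 + b * 0.
    apply: cvgD; first exact: cvg_cst.
    by apply: cvgM; [exact: powR_slope|apply: cvg_within; exact: cvg_id].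
  rewrite mulr0 addr0 in c; apply: cvg_trans c; apply: near_eq_cvg; near=> h.
  have h0 : h != 0 by near: h; exact: nbhs_dnbhs_neq.
  by rewrite divfK// addrC subrK.
have cL2 : L2 h @[h --> (0 : R)^'] --> b - 1.
  by rewrite -[X in _ --> X]mulr1; exact: cvgM.
have good : \forall h \near (0 : R)^',
    [/\ 0 < 1 + h, `|b - 1 - L1 h| < e / 2 & `|b - 1 - L2 h| < e / 2].
  have e2 : 0 < e / 2 by lra.
  move/cvgrPdist_lt : cL1 => /(_ _ e2) c1; move/cvgrPdist_lt : cL2 => /(_ _ e2) c2.
  by near=> h; split; near: h.
(* The sign of [h] is that of [x], so that [(1 + h) * x] lies to the right of [x]. *)
have [h [hn [h0 l1 l2] sh]] : exists h : R, [/\ h != 0,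
    [/\ 0 < 1 + h, `|b - 1 - L1 h| < e / 2 & `|b - 1 - L2 h| < e / 2] &
    \forall x \near vanishing S, 0 < h * x].
  case: sgn => sx.
    have [h [hp hg]] : exists h : R, 0 < h /\ [/\ 0 < 1 + h,
        `|b - 1 - L1 h| < e / 2 & `|b - 1 - L2 h| < e / 2].
      apply: (@filter_ex _ (0 : R)^'+); apply: filterI; first exact: nbhs_right_gt.
      by apply: (@filterS _ (nbhs (0 : R)) _ _ _ _ good) => k + k0; apply; rewrite gt_eqF.
    exists h; split => //; first by rewrite gt_eqF.
    by apply: filterS sx => x x0; rewrite mulr_gt0.
  have [h [hp hg]] : exists h : R, h < 0 /\ [/\ 0 < 1 + h,
      `|b - 1 - L1 h| < e / 2 & `|b - 1 - L2 h| < e / 2].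
    apply: (@filter_ex _ (0 : R)^'-); apply: filterI; first exact: nbhs_left_lt.
    by apply: (@filterS _ (nbhs (0 : R)) _ _ _ _ good) => k + k0; apply; rewrite lt_eqF.
  exists h; split => //; first by rewrite lt_eqF.
  by apply: filterS sx => x x0; rewrite nmulr_lgt0.
pose r := 1 + h; pose T x := 1 - H (r * x) / H x.
have hh : 0 < `|h| by rewrite normr_gt0.
have p0 : 0 < r `^ (- b) by exact: powR_gt0.
have cT : T x @[x --> vanishing S] --> h * L1 h.
  rewrite [X in _ --> X](_ : _ = 1 - r * r `^ (- b)).
    by apply: cvgB; [exact: cvg_cst|exact: rH].
  by rewrite /L1 mulrC divfK.
have cT2 : T x / (S (r * x) / S x) @[x --> vanishing S] --> h * L2 h.
  rewrite /L2 mulrA -[X in _ * X]invrK -powRN.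
  by apply: cvgM => //; apply: cvgV; [rewrite gt_eqF|exact: rS].
have e1 : 0 < `|h| * (e / 2) by rewrite mulr_gt0//; lra.
have n1 := vanishing_cvg_gt cT (z := h * L1 h - `|h| * (e / 2)) ltac:(lra).
have n2 := vanishing_cvg_lt cT2 (z := h * L2 h + `|h| * (e / 2)) ltac:(lra).
have n3 := vanishing_cvg_gt (rS _ h0) p0.
near=> x.
have x0 : 0 < S x by near: x; exact: near_vanishing_gt0.
have Hx := H_gt0 x0.
have hx : 0 < h * x by near: x.
have t1 : h * L1 h - `|h| * (e / 2) < T x by near: x.
have t2 : T x / (S (r * x) / S x) < h * L2 h + `|h| * (e / 2) by near: x.
have t3 : 0 < S (r * x) / S x by near: x.
have xr : x <= r * x by rewrite /r mulrDl mul1r; lra.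
have := H_bounds xr; rewrite (_ : r * x - x = h * x); last by rewrite /r; ring.
set K := x * S x / H x.
have KE : h * K * H x = h * x * S x by rewrite /K; field; rewrite gt_eqF.
have TE : H x - H (r * x) = T x * H x by rewrite /T; field; rewrite gt_eqF.
have SE : h * x * S (r * x) = h * K * (S (r * x) / S x) * H x.
  by rewrite /K; field; rewrite !gt_eqF.
rewrite TE -KE SE !ler_pM2r// => /andP[k2 k1].
rewrite -ler_pdivlMr// in k2.
have k3 : h * K < h * L2 h + `|h| * (e / 2) by exact: le_lt_trans t2.
have k4 : h * L1 h - `|h| * (e / 2) < h * K by exact: lt_le_trans k1.
move: l1 l2; rewrite !ltr_distlC => /andP[? ?] /andP[? ?].
case: (ltgtP h 0) hn => // hs _.
- rewrite (ltr0_norm hs) in k3 k4.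
  have : K < L1 h + e / 2 by rewrite -(ltr_nM2l hs); lra.
  have : L2 h - e / 2 < K by rewrite -(ltr_nM2l hs); lra.
  by move=> ? ?; apply/andP; split; lra.
- rewrite (gtr0_norm hs) in k3 k4.
  have : K < L2 h + e / 2 by rewrite -(ltr_pM2l hs); lra.
  have : L1 h - e / 2 < K by rewrite -(ltr_pM2l hs); lra.
  by move=> ? ?; apply/andP; split; lra.
Unshelve. all: by end_near. Qed.

End integrated_tail.

(** * The recursion of the optimal values *)

Section recursion.
Context {R : realType} (S H : R -> R).
Context (S_ge0 : forall x, 0 <= S x).
Context (S_ni : forall x y, x <= y -> S y <= S x).
Context (H_gt0 : forall x, 0 < S x -> 0 < H x).
Context (H_bounds : forall v w, v <= w ->
  (w - v) * S w <= H v - H w <= (w - v) * S v).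
Context (y : nat -> R).
Context (yS : forall n, y n.+1 = y n + H (y n)).
Context (y_supp : forall n, 0 < S (y n)).

Lemma rec_nd m n : (m <= n)%N -> y m <= y n.
Proof.
move=> /subnK <-; elim: (n - m)%N => // k IH.
by rewrite addSn yS (le_trans IH)// lerDl ltW// H_gt0.
Qed.

Lemma rec_gt z : 0 < S z -> \forall n \near \oo, z < y n.
Proof.
move=> z0; have Hz := H_gt0 z0.
suff [N yN] : exists N, z < y N.
  by exists N => // n /= Nn; exact: lt_le_trans (rec_nd Nn).
apply: contrapT => /forallNP yz.
have {}yz n : y n <= z by rewrite leNgt; apply/negP; exact: yz.
have lin n : y 0 + n%:R * H z <= y n.
  elim: n => [|n IH]; first by rewrite mul0r addr0.
  rewrite yS -natr1 mulrDl mul1r addrA lerD//.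
  exact: (tail_ni S_ge0 H_bounds).
pose k := (Num.trunc (`|z - y 0| / H z)).+1.
have h : 0 <= `|z - y 0| / H z by apply: divr_ge0 => //; exact: ltW.
have /andP[_] := truncn_itv h; rewrite ltr_pdivrMr// => kz.
by have := lin k; have := yz k; have := ler_norm (z - y 0); rewrite /k; lra.
Qed.

Lemma rec_vanishing : (forall d, 0 < d -> exists x, 0 < S x < d) ->
  y @ \oo --> vanishing S.
Proof.
move=> nonvoid; apply: cvg_to_vanishing; first exact: nearW.
apply/cvgrPdist_lt => e e0; have [z /andP[z0 ze]] := nonvoid e e0.
near=> n; rewrite sub0r normrN gtr0_norm// (le_lt_trans _ ze)// S_ni// ltW//.
by near: n; exact: rec_gt.
Unshelve. all: by end_near. Qed.

Section quotient_growth.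
Context (y_vanish : y @ \oo --> vanishing S).

Let rho n := H (y n) / H (y n.+1).

Let H_pos n : 0 < H (y n). Proof. exact: H_gt0. Qed.

Let rho_ge1 n : 1 <= rho n.
Proof.
by rewrite ler_pdivlMr// mul1r; apply: (tail_ni S_ge0 H_bounds); exact: rec_nd.
Qed.

(** The step has length [H (y n)], so [H] loses at most the fraction [S (y n)] of itself. *)
Lemma rec_ratio_cvg1 : H (y n) / H (y n.+1) @[n --> \oo] --> (1 : R).
Proof.
have cS : S (y n) @[n --> \oo] --> (0 : R).
  by have := cvg_comp y S y_vanish (@cvg_vanishing R S).
have hi : (1 - S (y n))^-1 @[n --> \oo] --> (1 - 0 : R)^-1.
  apply: cvgV; first by rewrite subr0 oner_neq0.
  by apply: cvgB => //; exact: cvg_cst.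
rewrite subr0 invr1 in hi.
apply: (@squeeze_cvgr _ _ _ _ _ _ _ _ _ (cvg_cst _) hi); near=> n.
apply/andP; split; first exact: rho_ge1.
have Sy : S (y n) < 1 by near: n; apply: (cvgr_lt _ cS).
have S1 : 0 < 1 - S (y n) by rewrite subr_gt0.
rewrite ler_pdivrMr// -ler_pdivrMl ?invr_gt0// invrK.
have /andP[_] := H_bounds (rec_nd (leqnSn n)).
by rewrite yS [X in X * _](_ : _ = H (y n)); [lra|ring].
Unshelve. all: by end_near. Qed.

Let qdiffE n : y n != 0 ->
  y n.+1 / H (y n.+1) - y n / H (y n) =
  rho n + y n * ((H (y n) - H (y n.+1)) / H (y n)) / H (y n.+1).
Proof.
move=> y0; rewrite /rho yS; field.
by rewrite -yS !gt_eqF.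
Qed.

(** The step length [H (y n)] cancels the denominator and leaves exactly the two survival values. *)
Let rec_step n : S (y n.+1) <= (H (y n) - H (y n.+1)) / H (y n) <= S (y n).
Proof.
rewrite ler_pdivlMr// ler_pdivrMr// !(mulrC _ (H (y n))).
have := H_bounds (rec_nd (leqnSn n)).
by rewrite {1 5}yS (addrC (y n)) addrK.
Qed.

Context (y_sgn : (forall n, 0 < y n) \/ (forall n, y n < 0)).

Let y_neq0 n : y n != 0.
Proof. by case: y_sgn => h; [rewrite gt_eqF|rewrite lt_eqF]. Qed.

(** Discrete form of [(y / H)' = 1 + y * S / H] along [y' = H]: the increment of [y / H] is a ratio
    tending to [1] plus a term [D n] squeezed to [b - 1], and Cesaro's theorem concludes. *)
Lemma rec_quotient_cvg (b : R) : b - 1 != 0 ->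
  x * S x / H x @[x --> vanishing S] --> b - 1 ->
  y n / H (y n) / n.+1%:R @[n --> \oo] --> b.
Proof.
move=> b0 cK.
have cKy : y n * S (y n) / H (y n) @[n --> \oo] --> b - 1.
  exact: (cvg_comp y (fun x => x * S x / H x) y_vanish cK).
have cKyS : y n.+1 * S (y n.+1) / H (y n.+1) @[n --> \oo] --> b - 1.
  exact: (cvg_succ (fun n => y n * S (y n) / H (y n)) (b - 1)).2.
have cS : S (y n) @[n --> \oo] --> (0 : R).
  by have := cvg_comp y S y_vanish (@cvg_vanishing R S).
have cyy : y n / y n.+1 @[n --> \oo] --> (1 : R).
  have c : (1 + S (y n) / (y n * S (y n) / H (y n)))^-1 @[n --> \oo] --> (1 + 0 / (b - 1))^-1.
    apply: cvgV; first by rewrite mul0r addr0 oner_neq0.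
    apply: cvgD; first exact: cvg_cst.
    by apply: cvgM => //; exact: cvgV.
  rewrite mul0r addr0 invr1 in c; apply: cvg_trans c; apply: near_eq_cvg.
  near=> n; rewrite yS; field.
  by rewrite -yS !y_neq0 !gt_eqF// H_pos.
pose D n := y n * ((H (y n) - H (y n.+1)) / H (y n)) / H (y n.+1).
have c1 : y n.+1 * S (y n.+1) / H (y n.+1) * (y n / y n.+1) @[n --> \oo] --> b - 1.
  by rewrite -[X in _ --> X]mulr1; exact: cvgM.
have c2 : y n * S (y n) / H (y n) * (H (y n) / H (y n.+1)) @[n --> \oo] --> b - 1.
  by rewrite -[X in _ --> X]mulr1; apply: cvgM => //; exact: rec_ratio_cvg1.
have E1 n : y n.+1 * S (y n.+1) / H (y n.+1) * (y n / y n.+1) =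
    y n * S (y n.+1) / H (y n.+1).
  by field; rewrite y_neq0 gt_eqF.
have E2 n : y n * S (y n) / H (y n) * (H (y n) / H (y n.+1)) =
    y n * S (y n) / H (y n.+1).
  by field; rewrite !gt_eqF.
have cD : D n @[n --> \oo] --> b - 1.
  (* Multiplying [rec_step] by [y n] keeps or exchanges the two bounds according to the sign of
     [y]. *)
  case: y_sgn => sy.
    apply: (@squeeze_cvgr _ _ _ _ _ _ _ _ _ c1 c2); near=> n.
    have /andP[s1 s2] := rec_step n.
    by rewrite E1 E2 /D !ler_pM2r ?invr_gt0// !ler_pM2l// s1.
  apply: (@squeeze_cvgr _ _ _ _ _ _ _ _ _ c2 c1); near=> n.
  have /andP[s1 s2] := rec_step n.
  by rewrite E1 E2 /D !ler_pM2r ?invr_gt0// !ler_nM2l// s1 s2.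
pose u n := y n.+1 / H (y n.+1) - y n / H (y n).
have cu : u n @[n --> \oo] --> b.
  rewrite (_ : b = 1 + (b - 1)); last by ring.
  rewrite /u; under eq_fun do rewrite qdiffE//.
  by apply: cvgD => //; exact: rec_ratio_cvg1.
have := cesaro cu; rewrite /arithmetic_mean.
have E n : series u n.+1 = y n.+1 / H (y n.+1) - y 0%N / H (y 0%N).
  by rewrite /series/= telescope_sumr.
move=> c3.
have c4 : n.+1%:R^-1 * series u n.+1 + y 0%N / H (y 0%N) * n.+1%:R^-1 @[n --> \oo] --> b.
  rewrite -[X in _ --> X]addr0 -[X in _ + X](mulr0 (y 0%N / H (y 0%N))).
  by apply: cvgD => //; apply: cvgMl_tmp; exact: cvg_harmonic.
(* The factor [1 - 1 / (n + 2) = (n + 1) / (n + 2)] reconciles the Cesaro denominator with the index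
   of [y n.+1]. *)
have c5 : (1 - n.+2%:R^-1) * (n.+1%:R^-1 * series u n.+1 + y 0%N / H (y 0%N) * n.+1%:R^-1) @[n --> \oo] --> (1 - 0) * b.
  apply: cvgM => //; apply: cvgB; first exact: cvg_cst.
  exact: (cvg_succ (fun n => n.+1%:R^-1) (0 : R)).2 (@cvg_harmonic R).
rewrite subr0 mul1r in c5.
apply: (cvg_succ (fun n => y n / H (y n) / n.+1%:R) b).1.
apply: cvg_trans c5; apply: near_eq_cvg; near=> n.
rewrite E /= -[n.+2]addn1 natrD.
have n0 : n.+1%:R != 0 :> R by rewrite pnatr_eq0.
have n1 : n.+1%:R + 1 != 0 :> R by rewrite natr1 pnatr_eq0.
move: (y n.+1 / H (y n.+1)) (y 0%N / H (y 0%N)) (n.+1%:R : R) n0 n1 => q1 q0 m m0 m1.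
by field; rewrite m0 m1.
Unshelve. all: by end_near. Qed.

Lemma rec_survival_cvg (b : R) : b - 1 != 0 -> b != 0 ->
  x * S x / H x @[x --> vanishing S] --> b - 1 ->
  n.+1%:R * S (y n) @[n --> \oo] --> 1 - b^-1.
Proof.
move=> b1 b0 cK.
have cKy : y n * S (y n) / H (y n) @[n --> \oo] --> b - 1.
  exact: (cvg_comp y (fun x => x * S x / H x) y_vanish cK).
have c : y n * S (y n) / H (y n) / (y n / H (y n) / n.+1%:R) @[n --> \oo] --> (b - 1) / b.
  by apply: cvgM => //; apply: cvgV => //; exact: rec_quotient_cvg.
rewrite (_ : 1 - b^-1 = (b - 1) / b); last by field.
apply: cvg_trans c; apply: near_eq_cvg; near=> n.
have n0 : n.+1%:R != 0 :> R by rewrite pnatr_eq0.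
by move: (n.+1%:R : R) n0 => m m0; field; rewrite m0 y_neq0 gt_eqF.
Unshelve. all: by end_near. Qed.

End quotient_growth.

(** [y n] is [y 0] plus the increments [H (y k)] for [k < n], and each of these [n + 1] terms is at
    least [H (y n)]. *)
Lemma rec_tail_le : (forall n, 0 < y n) -> H (y 0) <= y 0 ->
  forall n, n.+1%:R * H (y n) <= y n.
Proof.
move=> y0 Hy0; elim=> [|n IH]; first by rewrite mul1r.
rewrite -natr1 mulrDl mul1r [leRHS]yS.
have : H (y n.+1) <= H (y n) by apply: (tail_ni S_ge0 H_bounds); exact: rec_nd.
move=> h; have : n.+1%:R * H (y n.+1) <= n.+1%:R * H (y n) by rewrite ler_wpM2l.
by lra.
Qed.

(* For [y < 0], so that [vanishing S] is approached from the left of [0] *)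
Lemma rec_tail_cvg0 : (forall n, y n < 0) -> y @ \oo --> vanishing S ->
  (forall M : R, \forall x \near vanishing S, x * S x / H x < M) ->
  n.+1%:R * (H (y n) / y n) @[n --> \oo] --> (0 : R).
Proof.
move=> yn y_vanish hK.
have H_pos n : 0 < H (y n) by exact: H_gt0.
pose p n := - (y n / H (y n)).
have p_gt0 n : 0 < p n by rewrite oppr_gt0 pmulr_llt0 ?invr_gt0.
have rho2 : \forall n \near \oo, H (y n) / H (y n.+1) < 2.
  by apply: (cvgr_lt _ (rec_ratio_cvg1 y_vanish)); lra.
(* The increment of [p = - y / H] is at least [- y * S / H], taken at [n + 1], minus a ratio smaller
   than [2]; hence the margin [M + 2]. *)
have grow M : 0 < M -> \forall n \near \oo, M < p n.+1 - p n.
  move=> M0; have n1 : \forall n \near \oo, y n * S (y n) / H (y n) < - (M + 2).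
    exact: (y_vanish _ (hK _)).
  have n2 : \forall n \near \oo, y n.+1 * S (y n.+1) / H (y n.+1) < - (M + 2).
    by case: n1 => N _ hN; exists N => // n /= Nn; apply: hN => /=; exact: leqW.
  near=> n.
  have h1 : y n.+1 * S (y n.+1) / H (y n.+1) < - (M + 2) by near: n.
  have h2 : H (y n) / H (y n.+1) < 2 by near: n.
  have /andP[h3 _] := H_bounds (rec_nd (leqnSn n)).
  have E : p n.+1 - p n = - (H (y n) / H (y n.+1)) +
      - y n * ((H (y n) - H (y n.+1)) / H (y n)) / H (y n.+1).
    by rewrite /p yS; field; rewrite -yS !gt_eqF.
  have h4 : S (y n.+1) <= (H (y n) - H (y n.+1)) / H (y n).
    rewrite ler_pdivlMr// mulrC.
    by move: h3; rewrite {1}yS (addrC (y n)) addrK.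
  have h5 : - y n.+1 * S (y n.+1) / H (y n.+1) <=
      - y n * ((H (y n) - H (y n.+1)) / H (y n)) / H (y n.+1).
    rewrite ler_pM2r ?invr_gt0//; apply: ler_pM => //.
    - by rewrite oppr_ge0 ltW.
    - by rewrite lerN2 rec_nd.
  by rewrite E; move: h5; rewrite !mulNr; lra.
apply/cvgrPdist_lt => e e0.
(* For [n > 2 * N] one has [n + 1 < 4 * (n - N)], so linear growth of slope [4 / e] from [N] on
   gives [p n > (n + 1) / e]. *)
pose M := 4 / e; have M0 : 0 < M by rewrite divr_gt0.
have [N _ hN] := grow M M0.
have lin k : k%:R * M <= p (N + k)%N.
  elim: k => [|k IH]; first by rewrite mul0r ltW.
  rewrite addnS -natr1 mulrDl mul1r.
  by have := hN (N + k)%N (leq_addr _ _); lra.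
exists (2 * N + 1)%N => // n /= nN.
have nE : n = (N + (n - N))%N by rewrite subnKC//; lia.
have n2 : n.+1%:R < 4 * (n - N)%:R :> R by rewrite -natrM ltr_nat; lia.
have pn : n.+1%:R / p n < e.
  rewrite ltr_pdivrMr//.
  have := lin (n - N)%N; rewrite -nE => h.
  have : e * ((n - N)%:R * M) <= e * p n by rewrite ler_pM2l.
  rewrite /M mulrCA (mulrC e) divfK ?gt_eqF//; lra.
rewrite (_ : n.+1%:R * _ = - (n.+1%:R / p n)); last first.
  by rewrite /p; move: (n.+1%:R : R) => m; field; rewrite gt_eqF// lt_eqF.
by rewrite sub0r opprK gtr0_norm// divr_gt0.
Unshelve. all: by end_near. Qed.

End recursion.

(** * Affine changes of variable and the layer-cake formula *)

Section lebesgue_affine.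
Context {R : realType}.
Local Notation mu := (@lebesgue_measure R).
Local Open Scope ereal_scope.

Definition affine (a b : R) (x : measurableTypeR R) : measurableTypeR R :=
  (a * x + b)%R.

Lemma measurable_affine (a b : R) : measurable_fun setT (affine a b).
Proof. by apply: measurable_funD => //; exact: measurable_funM. Qed.

(** By uniqueness of Lebesgue measure, it suffices to compare both sides on half-open intervals. *)
Lemma lebesgue_measure_affine (a b : R) (A : set R) : (0 < a)%R ->
  measurable A -> mu A = a%:E * mu (affine a b @^-1` A).
Proof.
move=> a0 mA.
apply: (lebesgue_measure_unique
  (mu := mscale (NngNum (ltW a0)) (pushforward mu (affine a b)))) => //.
  exact: measurable_affine.
move=> mf.
move=> _ [[c d]] _ <-; rewrite /mscale/= /pushforward.
rewrite -[RHS]/(a%:E * mu (affine a b @^-1` `]c, d])).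
rewrite (_ : _ @^-1` _ = `]((c - b) / a)%R, ((d - b) / a)%R]%classic); last first.
  apply/seteqP; split => x /=;
    rewrite !in_itv/= ltr_pdivrMr// ler_pdivlMr// /affine (mulrC x).
    by move=> /andP[? ?]; apply/andP; split; lra.
  by move=> /andP[? ?]; apply/andP; split; lra.
rewrite !lebesgue_measure_itv/= !lte_fin ltr_pM2r ?invr_gt0// ltrBlDr subrK.
case: ifPn; last by rewrite mule0.
by move=> _; rewrite -!EFinB -EFinM; congr EFin; field; rewrite gt_eqF.
Qed.

Lemma integral_affine (a b : R) (D : set R) (f : R -> \bar R) : (0 < a)%R ->
  measurable D -> measurable_fun D f -> (forall x, D x -> 0 <= f x) ->
  \int[mu]_(x in D) f x =
  a%:E * \int[mu]_(x in (fun x => a * x + b)%R @^-1` D) f (a * x + b)%R.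
Proof.
move=> a0 mD mf f0.
rewrite (eq_measure_integral
  (mscale (NngNum (ltW a0)) (pushforward mu (affine a b)))).
  exact: measurable_affine.
all: move=> maff.
2: by move=> A mA _; exact: lebesgue_measure_affine.
rewrite ge0_integral_mscale//; congr *%E.
rewrite ge0_integral_pushforward//.
by move=> y; rewrite inE; exact: f0.
Qed.

Lemma integral_scale_itv (a x : R) (f : R -> \bar R) : (0 < a)%R ->
  measurable_fun setT f -> (forall x, 0 <= f x) ->
  \int[mu]_(t in `[(a * x)%R, +oo[) f t = a%:E * \int[mu]_(t in `[x, +oo[) f (a * t)%R.
Proof.
move=> a0 mf f0; rewrite (@integral_affine a 0)//; last exact: measurable_funTS.
congr *%E; rewrite (_ : _ @^-1` _ = `[x, +oo[%classic).
  by under eq_integral do rewrite addr0.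
by apply/seteqP; split => t /=; rewrite !in_itv/= !andbT addr0 ler_pM2l.
Qed.

Lemma integral_shift_itv (b : R) (f : R -> \bar R) :
  measurable_fun setT f -> (forall x, 0 <= f x) ->
  \int[mu]_(t in `[b, +oo[) f t = \int[mu]_(t in `[0%R, +oo[) f (t + b)%R.
Proof.
move=> mf f0; rewrite (@integral_affine 1 b)//; last exact: measurable_funTS.
rewrite mul1e (_ : _ @^-1` _ = `[0%R, +oo[%classic).
  by under eq_integral do rewrite mul1r.
by apply/seteqP; split => t /=; rewrite !in_itv/= !andbT mul1r lerDr.
Qed.

End lebesgue_affine.

Section layer_cake.
Context {R : realType} d (T : measurableType d) (P : probability T R).
Local Notation mu := (@lebesgue_measure R).
Local Open Scope ereal_scope.

(** The tail of [Z] is prescribed above [w] only. One statement thus serves expectations, with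
    [w = 0], and steps of the optimal policy, with [w] the continuation value up to sign. *)
Lemma layer_cake (Z : T -> R) (w : R) (S : R -> R) :
  measurable_fun setT Z -> measurable_fun setT S -> (forall x, 0 <= S x)%R ->
  (forall x, (w <= x)%R -> P [set t | (x < Z t)%R] = (S x)%:E) ->
  \int[P]_t (Num.max (Z t - w) 0)%:E = \int[mu]_(x in `[w, +oo[) (S x)%:E.
Proof.
move=> mZ mS S0 PZ.
have mX : measurable_fun setT (fun t => Num.max (Z t - w)%R 0%R).
  by apply: measurable_maxr => //; exact: measurable_funB.
pose X : {RV P >-> R} :=
  HB.pack (fun t => Num.max (Z t - w)%R 0%R) (isMeasurableFun.Build _ _ _ _ _ mX).
have := @ge0_expectation_ccdf _ _ _ P X; rewrite expectation_def => ->; last first.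
  by move=> t; rewrite /X/= le_max lexx orbT.
rewrite integral_shift_itv//; last exact/measurable_EFinP.
apply: eq_integral => r; rewrite inE/= in_itv/= andbT => r0.
rewrite /ccdf /distribution/= /pushforward -PZ; last by rewrite lerDr.
congr (P _); apply/seteqP; split => t /=; rewrite in_itv/= andbT.
  by rewrite lt_max ltrBrDr [X in _ || X]ltNge r0 orbF.
by rewrite lt_max ltrBrDr => ->.
Qed.

End layer_cake.

(** * Tail integrals of survival functions *)

Section tail_integral.
Context {R : realType}.
Local Notation mu := (@lebesgue_measure R).
Local Open Scope ereal_scope.

Lemma ge0_integral_split (f : R -> \bar R) (v : R) (a b : itv_bound R) :
  measurable_fun setT f -> (forall x, 0 <= f x) ->
  (a <= BLeft v)%O -> (BLeft v <= b)%O ->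
  \int[mu]_(x in [set` Interval a b]) f x =
  \int[mu]_(x in [set` Interval a (BLeft v)]) f x +
  \int[mu]_(x in [set` Interval (BLeft v) b]) f x.
Proof.
move=> mf f0 av vb; rewrite (itv_bndbnd_setU av vb) ge0_integral_setU//.
  exact: measurable_funTS.
apply/disj_set2P; rewrite -subset0 => x /= []; rewrite !itv_boundlr => /andP[_].
by rewrite !bnd_simp => xv /andP[vx _]; move: xv; rewrite ltNge vx.
Qed.

Lemma integral_co_cst (c v w : R) : (v <= w)%R ->
  \int[mu]_(x in `[v, w[) c%:E = ((w - v) * c)%:E.
Proof.
move=> vw; rewrite -[LHS]/(\int[mu]_(x in `[v, w[) (cst c%:E) x) integral_cst//=.
rewrite lebesgue_measure_itv/= lte_fin; case: ltP => [_|wv].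
  by rewrite -EFinB -EFinM mulrC.
by rewrite mule0 (_ : w - v = 0)%R ?mul0r//; apply/eqP; rewrite subr_eq0 eq_le vw wv.
Qed.

Section survival.
Context (S : R -> R).
Context (S_ge0 : forall x, (0 <= S x)%R).
Context (S_ni : forall x y, (x <= y)%R -> (S y <= S x)%R).

Lemma surv_measurable : measurable_fun setT S.
Proof. by apply: nonincreasing_measurable => // x y; exact: S_ni. Qed.

Let mES (D : set R) : measurable_fun D (EFin \o S).
Proof. by apply: measurable_funTS; apply/measurable_EFinP; exact: surv_measurable. Qed.

Let ES0 x : 0 <= (S x)%:E. Proof. by rewrite lee_fin. Qed.

Lemma integral_co_bounds v w : (v <= w)%R ->
  ((w - v) * S w)%:E <= \int[mu]_(x in `[v, w[) (S x)%:E <= ((w - v) * S v)%:E.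
Proof.
move=> vw; rewrite -!integral_co_cst//; apply/andP; split; apply: ge0_le_integral => //.
- exact: mES.
- by move=> x; rewrite /= in_itv/= lee_fin => /andP[_ /ltW]; exact: S_ni.
- exact: mES.
- by move=> x; rewrite /= in_itv/= lee_fin => /andP[+ _]; exact: S_ni.
Qed.

Lemma tail_split v w : (v <= w)%R ->
  \int[mu]_(x in `[v, +oo[) (S x)%:E =
  \int[mu]_(x in `[v, w[) (S x)%:E + \int[mu]_(x in `[w, +oo[) (S x)%:E.
Proof.
by move=> vw; apply: ge0_integral_split => // x; rewrite lee_fin.
Qed.

Lemma tail_fin_num u x : \int[mu]_(t in `[u, +oo[) (S t)%:E < +oo ->
  \int[mu]_(t in `[x, +oo[) (S t)%:E \is a fin_num.
Proof.
move=> hu; rewrite ge0_fin_numE; last by apply: integral_ge0 => t _; rewrite lee_fin.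
have [xu|ux] := leP x u.
  rewrite (tail_split xu) lte_add_pinfty//.
  by have /andP[_ /le_lt_trans] := integral_co_bounds xu; apply; rewrite ltry.
apply: le_lt_trans hu; apply: ge0_subset_integral => //; first exact: mES.
by apply: subset_itvr; rewrite bnd_simp ltW.
Qed.

(** The function [H] of the overview. Since [fine] maps [+oo] to [0], it has this meaning only once
    some tail integral is known to be finite. *)
Definition tail_int (x : R) : R := fine (\int[mu]_(t in `[x, +oo[) (S t)%:E).

Lemma tail_int_ge0 x : (0 <= tail_int x)%R.
Proof. by apply: fine_ge0; apply: integral_ge0 => t _; rewrite lee_fin. Qed.

Context (u : R) (hu : \int[mu]_(t in `[u, +oo[) (S t)%:E < +oo).

Lemma tail_intE x : (tail_int x)%:E = \int[mu]_(t in `[x, +oo[) (S t)%:E.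
Proof. by rewrite fineK// (tail_fin_num _ hu). Qed.

Lemma tail_int_bounds v w : (v <= w)%R ->
  ((w - v) * S w <= tail_int v - tail_int w <= (w - v) * S v)%R.
Proof.
move=> vw; have := integral_co_bounds vw.
have := tail_split vw; rewrite -!tail_intE => h.
have fin : \int[mu]_(x in `[v, w[) (S x)%:E \is a fin_num.
  rewrite ge0_fin_numE; last by apply: integral_ge0 => t _; rewrite lee_fin.
  by have /andP[_ /le_lt_trans] := integral_co_bounds vw; apply; rewrite ltry.
rewrite -(fineK fin) in h *; rewrite !lee_fin.
by case: h => ->; rewrite addrK.
Qed.

Lemma tail_int_scale_le r c x : (0 < r)%R ->
  (forall y, x <= y -> S (r * y) <= c * S y)%R ->
  (tail_int (r * x) <= r * c * tail_int x)%R.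
Proof.
move=> r0 Sc; rewrite -lee_fin !EFinM !tail_intE.
rewrite (integral_scale_itv _ r0)//.
rewrite -muleA lee_pmul2l ?lte_fin//.
have mr : measurable_fun setT (fun t => (S (r * t))%:E).
  by apply/measurable_EFinP; apply: measurableT_comp; [exact: surv_measurable|exact: measurable_funM].
have [c0|c0] := leP 0%R c.
  rewrite -ge0_integralZl_EFin//; last exact: mES.
  apply: ge0_le_integral => //.
  - exact: measurable_funTS.
  - by apply: measurable_funTS; apply: measurable_funeM; exact: mES.
  - by move=> t; rewrite /= in_itv/= andbT -EFinM lee_fin; exact: Sc.
(* A negative [c] is compatible with [0 <= S (r * t) <= c * S t] only if [S] vanishes from [x] on,
   and then both integrals are [0]. *)
have S0 t : (x <= t)%R -> (S t = 0)%R.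
  move=> xt; apply/eqP; rewrite eq_le S_ge0 andbT leNgt; apply/negP => St.
  have := le_trans (S_ge0 _) (Sc t xt); rewrite leNgt => /negP; apply.
  by rewrite nmulr_rlt0.
rewrite !integral0_eq ?mule0// => t; rewrite /= in_itv/= andbT => xt.
  by rewrite S0.
apply/eqP; rewrite eqe eq_le S_ge0 andbT.
by have := Sc t xt; rewrite (S0 _ xt) mulr0.
Qed.

Lemma tail_int_scale_ge r c x : (0 < r)%R -> (0 <= c)%R ->
  (forall y, x <= y -> c * S y <= S (r * y))%R ->
  (r * c * tail_int x <= tail_int (r * x))%R.
Proof.
move=> r0 c0 Sc; rewrite -lee_fin !EFinM !tail_intE.
rewrite (integral_scale_itv _ r0)//.
rewrite -muleA lee_pmul2l ?lte_fin//.
rewrite -ge0_integralZl_EFin//; last exact: mES.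
apply: ge0_le_integral => //.
- by move=> t _; rewrite -EFinM lee_fin mulr_ge0.
- by apply: measurable_funTS; apply: measurable_funeM; exact: mES.
- apply: measurable_funTS; apply/measurable_EFinP.
  by apply: measurableT_comp; [exact: surv_measurable|exact: measurable_funM].
- by move=> t; rewrite /= in_itv/= andbT -EFinM lee_fin; exact: Sc.
Qed.

End survival.

(** Let [J z] be the integral over [[x0, z[]. Splitting at [2 * x0] and halving the variable gives
    [J (2 z) <= x0 * S x0 + 2 * c * J (2 z)]; since [2 * c < 1] this bounds [J], and monotone
    convergence ends the argument. The truncation at [2 z] makes the absorption legitimate. *)
Lemma tail_finite (S : R -> R) (c x0 : R) :
  (forall x, 0 <= S x)%R -> (forall x y, x <= y -> S y <= S x)%R ->
  (0 < x0)%R -> (0 <= c < 2^-1)%R ->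
  (forall x, x0 <= x -> S (2 * x) <= c * S x)%R ->
  \int[mu]_(t in `[x0, +oo[) (S t)%:E < +oo.
Proof.
move=> S0 Sni x00 /andP[c0 c2] Sc.
have mS := surv_measurable Sni.
have mES : measurable_fun setT (EFin \o S) by exact/measurable_EFinP.
have ES0 x : 0 <= (S x)%:E by rewrite lee_fin.
pose J z := \int[mu]_(t in `[x0, z[) (S t)%:E.
pose M := (x0 * S x0 / (1 - 2 * c))%R.
have JM z : (x0 <= z)%R -> J (2 * z)%R <= M%:E.
  move=> x0z.
  have x2 : (x0 <= 2 * x0)%R by lra.
  have xz : (2 * x0 <= 2 * z)%R by lra.
  have Jfin : J (2 * z)%R \is a fin_num.
    rewrite ge0_fin_numE; last exact: integral_ge0.
    have /andP[_ /le_lt_trans] := integral_co_bounds S0 Sni (le_trans x2 xz).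
    by apply; rewrite ltry.
  have h1 : J (2 * z)%R <= (x0 * S x0)%:E + (2 * c)%:E * J (2 * z)%R.
    rewrite {1}/J (@ge0_integral_split _ (2 * x0)%R)// leeD//.
      have /andP[_] := integral_co_bounds S0 Sni x2.
      by rewrite (_ : 2 * x0 - x0 = x0)%R//; ring.
    rewrite (@integral_affine _ 2 0)//; last exact: measurable_funTS.
    rewrite EFinM -muleA lee_pmul2l//.
    have -> : (fun x => 2 * x + 0)%R @^-1` `[(2 * x0)%R, (2 * z)%R[ = `[x0, z[%classic.
      by apply/seteqP; split => t /=; rewrite !in_itv/= addr0 ler_pM2l// ltr_pM2l.
    apply: (@le_trans _ _ (c%:E * J z)).
      rewrite /J -ge0_integralZl_EFin//; last exact: measurable_funTS.
      apply: ge0_le_integral => //.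
      - apply: measurable_funTS; apply/measurable_EFinP.
        by apply: measurableT_comp => //; apply: measurable_funD => //; exact: measurable_funM.
      - by apply: measurable_funTS; exact: measurable_funeM.
      - by move=> t; rewrite /= in_itv/= addr0 -EFinM lee_fin => /andP[? _]; exact: Sc.
    apply: lee_wpmul2l; first by rewrite lee_fin.
    apply: ge0_subset_integral => //; first exact: measurable_funTS.
    by apply: subset_itvl; rewrite bnd_simp; lra.
  move: h1; rewrite -(fineK Jfin) -EFinM -EFinD !lee_fin => h1.
  by rewrite /M ler_pdivlMr; lra.
pose F (n : nat) := `[x0, (2 * (x0 + n%:R))%R[%classic.
have ndF : {homo F : m n / (m <= n)%N >-> (m <= n)%O}.
  move=> m n mn; have mn' : (m%:R <= n%:R :> R)%R by rewrite ler_nat.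
  by apply/subsetPset; apply: subset_itvl; rewrite bnd_simp; lra.
have FE : `[x0, +oo[%classic = \bigcup_i F i.
  apply/seteqP; split => t /=; last first.
    by move=> [n _] /=; rewrite !in_itv/= andbT => /andP[].
  rewrite in_itv/= andbT => xt; exists (Num.trunc t).+1 => //.
  have t0 : (0 <= t)%R by lra.
  rewrite /F/= in_itv/= xt/=.
  have /andP[_] := truncn_itv t0; have := ler0n R (Num.trunc t).+1.
  by lra.
have cJ : \int[mu]_(t in F i) (S t)%:E @[i --> \oo] --> \int[mu]_(t in \bigcup_i F i) (S t)%:E.
  apply: ge0_nondecreasing_set_cvg_integral => // i.
  - exact: measurable_itv.
  - exact: measurable_funTS.
rewrite FE -(cvg_lim _ cJ)//; apply: le_lt_trans (ltry M); apply: lime_le.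
  by apply/cvg_ex; eexists; exact: cJ.
by apply: nearW => n; apply: JM; have := ler0n R n; lra.
Qed.

(* Moving the mass of the weight [g] to the left, under the constraint
   [g <= 1], decreases the integral of a nondecreasing function. *)
Lemma rearrangement (F g : R -> R) (m : R) :
  (forall x, 0 <= F x)%R -> (forall x y, x <= y -> F x <= F y)%R ->
  measurable_fun setT g -> (forall x, 0 <= g x <= 1)%R -> (0 <= m)%R ->
  \int[mu]_(x in `[0%R, +oo[) (g x)%:E = m%:E ->
  \int[mu]_(x in `[0%R, m[) (F x)%:E <= \int[mu]_(x in `[0%R, +oo[) (F x * g x)%:E.
Proof.
move=> F0 Fnd mg g01 m0 gm.
have g0 x : (0 <= g x)%R by have /andP[] := g01 x.
have g1 x : (0 <= 1 - g x)%R by have /andP[] := g01 x; lra.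
have mF : measurable_fun setT F by apply: nondecreasing_measurable => // x y; exact: Fnd.
have mh : measurable_fun setT (fun x => 1 - g x)%R by exact: measurable_funB.
have E (h : R -> R) D : measurable_fun setT h -> measurable_fun D (EFin \o h).
  by move=> ?; apply: measurable_funTS; apply/measurable_EFinP.
have mFg : measurable_fun setT (fun x => F x * g x)%R by exact: measurable_funM.
have mFh : measurable_fun setT (fun x => F x * (1 - g x))%R by exact: measurable_funM.
pose A := \int[mu]_(x in `[0%R, m[) (g x)%:E.
pose B := \int[mu]_(x in `[m, +oo[) (g x)%:E.
pose C := \int[mu]_(x in `[0%R, m[) (1 - g x)%:E.
have AB : A + B = m%:E.
  by rewrite -gm (@ge0_integral_split _ m)//; do ?exact: E; move=> *; rewrite lee_fin.
have AC : A + C = m%:E.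
  rewrite -ge0_integralD//; do ?[exact: E|by move=> *; rewrite lee_fin ?mulr_ge0].
  under eq_integral do rewrite -EFinD addrC subrK.
  by rewrite integral_co_cst// subr0 mulr1.
have A0 : 0 <= A by apply: integral_ge0 => x _; rewrite lee_fin.
have B0 : 0 <= B by apply: integral_ge0 => x _; rewrite lee_fin.
have Afin : A \is a fin_num.
  by rewrite ge0_fin_numE// (le_lt_trans _ (ltry m))// -AB leeDl.
(* The mass of [g] beyond [m] equals the mass missing below [m], and [F m] separates the values of
   [F] on the two sides. *)
have CB : C = B.
  by rewrite -(addeK C Afin) (addeC C) AC -AB (addeC A) addeK.
have h1 : \int[mu]_(x in `[0%R, m[) (F x * (1 - g x))%:E <= (F m)%:E * C.
  rewrite /C -ge0_integralZl_EFin//; do ?[exact: E|by move=> *; rewrite lee_fin ?mulr_ge0].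
  apply: ge0_le_integral => //; do ?[exact: E|by apply: measurable_funeM; exact: E|by move=> *; rewrite -?EFinM lee_fin ?mulr_ge0].
  move=> x; rewrite /= in_itv/= -EFinM lee_fin => /andP[_ /ltW xm].
    by rewrite ler_wpM2r// Fnd.
have h2 : (F m)%:E * B <= \int[mu]_(x in `[m, +oo[) (F x * g x)%:E.
  rewrite /B -ge0_integralZl_EFin//; do ?[exact: E|by move=> *; rewrite lee_fin ?mulr_ge0].
  apply: ge0_le_integral => //; do ?[exact: E|by apply: measurable_funeM; exact: E|by move=> *; rewrite -?EFinM lee_fin ?mulr_ge0].
  move=> x; rewrite /= in_itv/= andbT -EFinM lee_fin => xm.
    by rewrite ler_wpM2r// Fnd.
rewrite [leRHS](@ge0_integral_split _ m)//; do ?[exact: E|by move=> *; rewrite lee_fin ?mulr_ge0].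
apply: (@le_trans _ _ (\int[mu]_(x in `[0%R, m[) (F x * g x)%:E +
    \int[mu]_(x in `[0%R, m[) (F x * (1 - g x))%:E)).
  rewrite -ge0_integralD//; do ?[exact: E|by move=> *; rewrite lee_fin ?mulr_ge0].
  apply: ge0_le_integral => //; do ?[exact: E|by apply: measurable_funeM; exact: E|by move=> *; rewrite -?EFinM lee_fin ?mulr_ge0].
  - by apply: emeasurable_funD; exact: E.
  - by move=> x _; rewrite -EFinD -mulrDr addrC subrK mulr1.
by rewrite leeD2l// (le_trans h1)// CB.
Qed.

End tail_integral.

(** * The Gamma integral *)

Section gamma_integral.
Context {R : realType}.
Local Notation mu := (@lebesgue_measure R).
Local Open Scope ereal_scope.

Let mexpN : measurable_fun setT (fun t : R => expR (- t)).
Proof. by apply: measurableT_comp => //; exact: oppr_measurable. Qed.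

Let mEexpN (D : set R) : measurable_fun D (fun t : R => (expR (- t))%:E).
Proof. by apply: measurable_funTS; apply/measurable_EFinP. Qed.

Let expN0 (t : R) : 0 <= (expR (- t))%:E.
Proof. by rewrite lee_fin expR_ge0. Qed.

Lemma integral_expN0 : \int[mu]_(t in `[0%R, +oo[) (expR (- t))%:E = 1.
Proof.
rewrite -(@integral_exponential_pdf R 1)// [LHS]integral_mkcond.
apply: eq_integral => t _; rewrite /exponential_pdf !patchE.
by case: ifP; rewrite // mul1r mulN1r.
Qed.

Lemma integral_expN_tail (c : R) :
  \int[mu]_(t in `[c, +oo[) (expR (- t))%:E = (expR (- c))%:E.
Proof.
rewrite (integral_shift_itv c)//.
under eq_integral do rewrite opprD addrC expRD EFinM.
rewrite ge0_integralZl_EFin ?expR_ge0//; last exact: mEexpN.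
by rewrite integral_expN0 mule1.
Qed.

Lemma integral_expN_head (c : R) : (0 <= c)%R ->
  \int[mu]_(t in `[0%R, c[) (expR (- t))%:E = (1 - expR (- c))%:E.
Proof.
move=> c0; have := @integral_expN_tail 0%R.
rewrite (@ge0_integral_split _ _ c)// integral_expN_tail oppr0 expR0 => h.
have fin : (expR (- c))%:E \is a fin_num by [].
by rewrite -[LHS](addeK _ fin) h.
Qed.

(** Kept in the extended reals: for [0 < g < 1], finiteness of the integral at [1 - g] is deduced
    from the convergence of the rescaled expected maximum. *)
Definition GammaE (s : R) : \bar R :=
  \int[mu]_(t in `]0%R, +oo[) (t `^ (s - 1) * expR (- t))%:E.

Lemma GammaE_fine (s : R) : Gamma s = fine (GammaE s). Proof. by []. Qed.

Lemma measurable_Gamma_fun (p : R) (D : set R) :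
  measurable_fun D (fun t : R => (t `^ p * expR (- t))%:E).
Proof.
by apply: measurable_funTS; apply/measurable_EFinP; exact: measurable_funM.
Qed.

(** Tonelli's theorem for the exponential weight. Applied to [Z t = k^g * t^(- g)], the inner set is
    an interval ending or starting at [k * x^(- 1 / g)], which turns the Gamma integral into that of
    an extreme value tail. *)
Lemma exponential_layer_cake (Z : R -> R) : measurable_fun setT Z ->
  (forall t, 0 <= Z t)%R ->
  \int[mu]_(t in `]0%R, +oo[) (Z t * expR (- t))%:E =
  \int[mu]_(x in `]0%R, +oo[)
    \int[mu]_(t in [set t | (0 < t)%R && (x < Z t)%R]) (expR (- t))%:E.
Proof.
move=> mZ Z0.
pose f (p : measurableTypeR R * measurableTypeR R) : \bar R :=
  if [&& 0 < p.1, 0 < p.2 & p.2 < Z p.1]%R then (expR (- p.1))%:E else 0.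
have f0 p : 0 <= f p by rewrite /f; case: ifP.
have mf : measurable_fun setT f.
  apply: measurable_fun_ifT => //.
    apply: measurable_and; first exact: measurable_fun_ltr.
    apply: measurable_and; first exact: measurable_fun_ltr.
    by apply: measurable_fun_ltr => //; exact: measurableT_comp.
  apply/measurable_EFinP.
  by apply: (measurableT_comp (f := fun t : R => expR (- t))) => //; exact: mexpN.
have := @fubini_tonelli _ _ _ _ R mu mu f mf f0 => FT.
transitivity (\int[mu]_x \int[mu]_y f (x, y)).
  rewrite integral_mkcond; apply: eq_integral => t _; rewrite patchE.
  case: ifPn; rewrite ?inE ?notin_setE /= in_itv/= andbT => t0; last first.
    apply/esym/integral0_eq => x _; rewrite /f /=.
    by case: ifPn; [move=> /and3P[/t0[]]|].
  rewrite -[X in (X * _)%R]subr0 -(integral_co_cst _ (Z0 t)) -integral_itv_obnd_cbnd.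
    rewrite integral_mkcond; apply: eq_integral => x _; rewrite patchE /f/= t0/=.
    by rewrite mem_setE/= in_itv.
  exact: measurable_cst.
rewrite FT [RHS]integral_mkcond; apply: eq_integral => x _; rewrite patchE.
case: ifPn; rewrite ?inE ?notin_setE /= in_itv/= andbT => x0; last first.
  apply: integral0_eq => t _; rewrite /f /=.
  by case: ifPn; [move=> /and3P[_ /x0[]]|].
rewrite [RHS]integral_mkcond; apply: eq_integral => t _; rewrite patchE /f/= x0/=.
by rewrite mem_setE.
Qed.

(** Logarithms are taken without dividing by [g], so that one equivalence serves both signs of
    [g]. *)
Lemma gamma_cake_set (g k x t : R) : (0 < k -> 0 < x -> 0 < t ->
  (x < k `^ g * t `^ (- g)) = (g * (ln t - ln k + ln x / g) < 0) \/ g = 0)%R.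
Proof.
move=> k0 x0 t0; have [->|g0] := eqVneq g 0%R; [by right|left].
rewrite !powR_expR// -expRD -[in LHS](lnK (x := x))// ltr_expR -subr_lt0.
by congr (_ < _)%R; field.
Qed.

Let gamma_const (g k : R) : (0 < k)%R ->
  \int[mu]_(t in `]0%R, +oo[) ((k `^ g * t `^ (- g)) * expR (- t))%:E =
  (k `^ g)%:E * GammaE (1 - g).
Proof.
move=> k0; rewrite /GammaE -ge0_integralZl_EFin ?powR_ge0//.
- by apply: eq_integral => t _; rewrite -EFinM mulrA (_ : 1 - g - 1 = - g)%R//; ring.
- by move=> t _; rewrite lee_fin mulr_ge0 ?powR_ge0 ?expR_ge0.
- exact: measurable_Gamma_fun.
Qed.

Let mZ (g k : R) : measurable_fun setT (fun t : R => k `^ g * t `^ (- g))%R.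
Proof. by apply: measurable_funM => //; exact: measurable_powR. Qed.

Lemma Gamma_cake_pos (g k : R) : (0 < g)%R -> (0 < k)%R ->
  \int[mu]_(x in `]0%R, +oo[) (1 - expR (- (k * x `^ (- g^-1))))%:E =
  (k `^ g)%:E * GammaE (1 - g).
Proof.
move=> g0 k0; rewrite -gamma_const// exponential_layer_cake//; last first.
  by move=> t; rewrite mulr_ge0 ?powR_ge0.
apply: eq_integral => x; rewrite inE /= in_itv/= andbT => x0.
pose c := (k * x `^ (- g^-1))%R.
have c0 : (0 < c)%R by rewrite mulr_gt0 ?powR_gt0.
have lc : (ln c = ln k - ln x / g)%R.
  by rewrite /c lnM ?posrE ?powR_gt0// ln_powR mulNr (mulrC g^-1%R).
rewrite -(integral_expN_head (ltW c0)) -integral_itv_obnd_cbnd; last exact: mEexpN.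
congr integral; apply/seteqP; split => t /=; rewrite in_itv/=.
  move=> /andP[t0 tc]; rewrite t0/=.
  have [->|g00] := gamma_cake_set g k0 x0 t0; last by rewrite g00 ltxx in g0.
  rewrite pmulr_rlt0// -(ltr_ln) ?posrE// in tc *.
  by move: tc; rewrite lc; lra.
move=> /andP[t0]; have [->|g00] := gamma_cake_set g k0 x0 t0; last by rewrite g00 ltxx in g0.
rewrite pmulr_rlt0// t0/= -[(t < c)%R]ltr_ln ?posrE//.
by rewrite lc; lra.
Qed.

Lemma Gamma_cake_neg (g k : R) : (g < 0)%R -> (0 < k)%R ->
  \int[mu]_(x in `]0%R, +oo[) (expR (- (k * x `^ (- g^-1))))%:E =
  (k `^ g)%:E * GammaE (1 - g).
Proof.
move=> g0 k0; rewrite -gamma_const// exponential_layer_cake//; last first.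
  by move=> t; rewrite mulr_ge0 ?powR_ge0.
apply: eq_integral => x; rewrite inE /= in_itv/= andbT => x0.
pose c := (k * x `^ (- g^-1))%R.
have c0 : (0 < c)%R by rewrite mulr_gt0 ?powR_gt0.
have lc : (ln c = ln k - ln x / g)%R.
  by rewrite /c lnM ?posrE ?powR_gt0// ln_powR mulNr (mulrC g^-1%R).
rewrite -integral_expN_tail -integral_itv_obnd_cbnd; last exact: mEexpN.
congr integral; apply/seteqP; split => t /=; rewrite in_itv/= andbT.
  move=> tc; have t0 : (0 < t)%R by exact: lt_trans tc.
  rewrite t0/=.
  have [->|g00] := gamma_cake_set g k0 x0 t0; last by rewrite g00 ltxx in g0.
  rewrite nmulr_rlt0// -(ltr_ln) ?posrE// in tc *.
  by move: tc; rewrite lc; lra.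
move=> /andP[t0]; have [->|g00] := gamma_cake_set g k0 x0 t0; last by rewrite g00 ltxx in g0.
rewrite nmulr_rlt0// -[(c < t)%R]ltr_ln ?posrE//.
by rewrite lc; lra.
Qed.

Lemma GammaE1 : GammaE 1 = 1.
Proof.
rewrite -integral_expN0 -integral_itv_obnd_cbnd; last exact: mEexpN.
by apply: eq_integral => t _; rewrite subrr powRr0 mul1r.
Qed.

Lemma GammaE_gt0 (g : R) : (g <= 0)%R -> 0 < GammaE (1 - g).
Proof.
move=> g0; apply: (@lt_le_trans _ _ (expR (- 1))%:E); first by rewrite lte_fin expR_gt0.
rewrite -integral_expN_tail /GammaE.
apply: (@le_trans _ _ (\int[mu]_(t in `[1%R, +oo[) (t `^ (1 - g - 1) * expR (- t))%:E)).
  apply: ge0_le_integral; [by []|by move=> t _; exact: expN0|exact: mEexpN|exact: measurable_Gamma_fun|].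
  move=> t; rewrite /= in_itv/= andbT => t1; rewrite lee_fin ler_peMl ?expR_ge0//.
  by rewrite -(powRr0 t) ler_powR//; lra.
apply: ge0_subset_integral; [by []|by []|exact: measurable_Gamma_fun| |].
  by move=> t _; rewrite lee_fin mulr_ge0 ?powR_ge0 ?expR_ge0.
by move=> t; rewrite /= !in_itv/= !andbT; apply: lt_le_trans.
Qed.

(* The tangent line of [ln] at [1 + a] gives [t^a <= (1+a)^a e^(a t/(1+a) - a)]. *)
Lemma GammaE_le (a : R) : (0 <= a)%R -> GammaE (1 + a) <= ((1 + a) `^ a)%:E.
Proof.
move=> a0; have b0 : (0 < 1 + a)%R by lra.
pose C := ((1 + a) `^ a * expR (- a))%R.
have C0 : (0 <= C)%R by rewrite mulr_ge0 ?powR_ge0 ?expR_ge0.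
have mE : measurable_fun setT (fun t : R => (expR (- ((1 + a)^-1 * t)))%:E).
  apply/measurable_EFinP; apply: (measurableT_comp mexpN).
  exact: measurable_funM.
apply: (@le_trans _ _ (\int[mu]_(t in `[0%R, +oo[) (C%:E * (expR (- ((1 + a)^-1 * t)))%:E))).
  rewrite /GammaE -integral_itv_obnd_cbnd; last first.
    by apply: measurable_funTS; exact: measurable_funeM.
  apply: ge0_le_integral; first by [].
  - by move=> t _; rewrite lee_fin mulr_ge0 ?powR_ge0 ?expR_ge0.
  - exact: measurable_Gamma_fun.
  - by apply: measurable_funTS; exact: measurable_funeM.
  - move=> t; rewrite /= in_itv/= andbT => t0; rewrite -EFinM lee_fin.
    rewrite /C !powR_expR// -!expRD ler_expR.
    have h : (ln (t / (1 + a)) <= t / (1 + a) - 1)%R.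
      rewrite -[X in ln X](subrK 1%R) addrC; apply: le_ln1Dx.
      by have := divr_gt0 t0 b0; lra.
    rewrite ln_div ?posrE// in h.
    have h2 := ler_wpM2l a0 h.
    have E : (t = t / (1 + a) + a * (t / (1 + a)))%R by field; rewrite gt_eqF.
    rewrite (mulrC (1 + a)^-1%R) {2}E; lra.
rewrite ge0_integralZl_EFin//; last exact: measurable_funTS.
rewrite (_ : \int[mu]_(t in `[0%R, +oo[) (expR (- ((1 + a)^-1 * t)))%:E = (1 + a)%:E); last first.
  have E0 (t : R) : 0 <= (expR (- ((1 + a)^-1 * t)))%:E by rewrite lee_fin expR_ge0.
  have := integral_scale_itv 0%R b0 mE E0; rewrite mulr0 => ->.
  under eq_integral do rewrite mulKf ?gt_eqF//.
  by rewrite integral_expN0 mule1.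
(* The integral contributes [1 + a], which the factor [exp (- a)] absorbs because
   [1 + a <= exp a]. *)
rewrite -EFinM lee_fin /C -mulrA ler_piMr ?powR_ge0//.
rewrite mulrC -ler_pdivlMr ?expR_gt0// div1r -expRN opprK.
exact: expR_ge1Dx.
Qed.

End gamma_integral.

(** * Convergence of integrals with uniformly small tails *)

Section limit_with_tail.
Context {R : realType}.
Local Notation mu := (@lebesgue_measure R).
Local Open Scope ereal_scope.

(** On []0, A[] the constant [1] dominates; beyond [A] the uniform bound passes to the limit [W] by
    Fatou's lemma. Together they give finiteness and convergence. *)
Lemma integral_cvg_tail (W_ : nat -> R -> R) (W : R -> R) :
  (forall n, measurable_fun setT (W_ n)) -> measurable_fun setT W ->
  (forall n x, 0 <= W_ n x <= 1)%R -> (forall x, 0 <= W x)%R ->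
  (forall x, (0 < x)%R -> W_ n x @[n --> \oo] --> W x) ->
  (forall e, (0 < e)%R -> exists2 A, (0 < A)%R &
    \forall n \near \oo, \int[mu]_(x in `[A, +oo[) (W_ n x)%:E <= e%:E) ->
  \int[mu]_(x in `]0%R, +oo[) (W x)%:E < +oo /\
  \int[mu]_(x in `]0%R, +oo[) (W_ n x)%:E @[n --> \oo] -->
    \int[mu]_(x in `]0%R, +oo[) (W x)%:E.
Proof.
move=> mW_ mW W01 W0 cW tW.
have W_0 n x : (0 <= W_ n x)%R by have /andP[] := W01 n x.
have mE (f : R -> R) D : measurable_fun setT f -> measurable_fun D (EFin \o f).
  by move=> ?; apply: measurable_funTS; apply/measurable_EFinP.
have E0 (f : R -> R) x : (forall x, 0 <= f x)%R -> 0 <= (f x)%:E.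
  by move=> h; rewrite lee_fin.
have split0 (f : R -> R) A : (forall x, 0 <= f x)%R -> measurable_fun setT f -> (0 < A)%R ->
    \int[mu]_(x in `]0%R, +oo[) (f x)%:E =
    \int[mu]_(x in `]0%R, A[) (f x)%:E + \int[mu]_(x in `[A, +oo[) (f x)%:E.
  move=> f0 mf A0; apply: ge0_integral_split => //; exact: mE.
have head A : (0 < A)%R -> [/\ \int[mu]_(x in `]0%R, A[) (W x)%:E \is a fin_num &
    \int[mu]_(x in `]0%R, A[) (W_ n x)%:E @[n --> \oo] --> \int[mu]_(x in `]0%R, A[) (W x)%:E].
  move=> A0.
  have [] := @dominated_convergence _ _ R mu `]0%R, A[%classic (measurable_itv _)
    (fun n x => (W_ n x)%:E) (EFin \o W) (cst 1).
  - by move=> n; exact: mE.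
  - exact: mE.
  - apply: aeW => x; rewrite /= in_itv/= => /andP[x0 _].
    by apply: cvg_EFin; [exact: nearW|exact: cW].
  - apply/integrableP; split; first exact: measurable_cst.
    rewrite (eq_integral (cst 1)); last by move=> x _; rewrite /= normr1.
    by rewrite integral_cst//= mul1e lebesgue_measure_itv/= lte_fin A0 sube0 ltry.
  - apply: aeW => x n _; rewrite gee0_abs; last exact: E0.
    by rewrite lee_fin; have /andP[] := W01 n x.
  - by move=> /(integral_fune_fin_num _) h1 _ h2; split; [exact: h1|exact: h2].
have fat A e : (\forall n \near \oo, \int[mu]_(x in `[A, +oo[) (W_ n x)%:E <= e%:E) ->
    (0 < A)%R -> \int[mu]_(x in `[A, +oo[) (W x)%:E <= e%:E.
  move=> h A0.
  have Wl : \int[mu]_(x in `[A, +oo[) (W x)%:E =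
      \int[mu]_(x in `[A, +oo[) limn_einf (fun n => (W_ n x)%:E).
    apply: eq_integral => x; rewrite inE/= in_itv/= andbT => Ax.
    apply/esym; apply: (cvg_limn_einf_sup _).1.
    by apply: cvg_EFin; [exact: nearW|apply: cW; exact: lt_le_trans Ax].
  rewrite Wl; apply: le_trans (fatou _ _ _ _) _ => //.
  - by move=> n; exact: mE.
  - by move=> n x _; exact: E0.
  - rewrite limn_einf_lim; apply: lime_le; first exact: is_cvg_einfs.
    case: h => N _ hN; near=> n.
    apply: (@le_trans _ _ (\int[mu]_(x in `[A, +oo[) (W_ n x)%:E)).
      by apply: ereal_inf_lbound; exists n => /=.
    by apply: hN => /=; near: n; exact: nbhs_infty_ge.
have Lfin : \int[mu]_(x in `]0%R, +oo[) (W x)%:E < +oo.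
  have [A A0 hA] := tW 1%R ltac:(by []).
  rewrite (split0 _ A)//; have [h _] := head A A0.
  apply: lte_add_pinfty; first by rewrite ltey_eq h.
  by apply: le_lt_trans (fat _ _ hA A0) (ltry _).
split => //.
have Lfn : \int[mu]_(x in `]0%R, +oo[) (W x)%:E \is a fin_num.
  by rewrite ge0_fin_numE//; apply: integral_ge0 => x _; exact: E0.
have fin_tail (f : R -> R) A e : (forall x, 0 <= f x)%R ->
    \int[mu]_(x in `[A, +oo[) (f x)%:E <= e%:E ->
    exists2 t, (0 <= t <= e)%R & \int[mu]_(x in `[A, +oo[) (f x)%:E = t%:E.
  move=> f0 h; have t0 : 0 <= \int[mu]_(x in `[A, +oo[) (f x)%:E.
    by apply: integral_ge0 => x _; exact: E0.
  have ff : \int[mu]_(x in `[A, +oo[) (f x)%:E \is a fin_num.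
    by rewrite ge0_fin_numE// (le_lt_trans h)// ltry.
  exists (fine (\int[mu]_(x in `[A, +oo[) (f x)%:E)); last by rewrite fineK.
  by rewrite -!lee_fin fineK// t0.
have key e : (0 < e)%R -> \forall n \near \oo,
    exists2 r, (`|fine (\int[mu]_(x in `]0%R, +oo[) (W x)%:E) - r| <= e)%R &
    \int[mu]_(x in `]0%R, +oo[) (W_ n x)%:E = r%:E.
  move=> e0; have [|A A0 hA] := tW (e / 2)%R; first by lra.
  have [hfin hc] := head A A0.
  have [tw /andP[tw0 twe] twE] := fin_tail _ _ _ W0 (fat _ _ hA A0).
  move: hc; rewrite -(fineK hfin) => /fine_cvgP[hn /cvgrPdist_le hc].
  have e2 : (0 < e / 2)%R by lra.
  have {}hc := hc _ e2.
  rewrite (split0 _ A)// twE -(fineK hfin).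
  near=> n.
  have [tn /andP[tn0 tne] tnE] : exists2 t, (0 <= t <= e / 2)%R &
      \int[mu]_(x in `[A, +oo[) (W_ n x)%:E = t%:E.
    by apply: fin_tail => //; near: n.
  have anfin : \int[mu]_(x in `]0%R, A[) (W_ n x)%:E \is a fin_num by near: n.
  have : (`|fine (\int[mu]_(x in `]0%R, A[) (W x)%:E) -
      fine (\int[mu]_(x in `]0%R, A[) (W_ n x)%:E)| <= e / 2)%R by near: n.
  rewrite ler_norml => /andP[? ?].
  exists (fine (\int[mu]_(x in `]0%R, A[) (W_ n x)%:E) + tn)%R.
    by rewrite /= ler_norml; apply/andP; split; lra.
  by rewrite (split0 _ A)// tnE -{1}(fineK anfin).
rewrite -(fineK Lfn); apply/fine_cvgP; split.
  by apply: filterS (key 1%R ltac:(by [])) => n [r _ ->].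
apply/cvgrPdist_le => e e0; apply: filterS (key e e0) => n [r re] /= rE.
by rewrite rE.
Unshelve. all: by end_near. Qed.

End limit_with_tail.

(** * The expected maximum against the optimal online value *)

Section expected_maximum.
Context {R : realType}.
Local Notation mu := (@lebesgue_measure R).
Context (S : R -> R).
Context (S_ge0 : forall x, 0 <= S x).
Context (S_le1 : forall x, S x <= 1).
Context (S_ni : forall x y, x <= y -> S y <= S x).
Context (u : R) (hu : (\int[mu]_(t in `[u, +oo[) (S t)%:E < +oo)%E).
Local Notation H := (tail_int S).

Lemma cvg_onem_expn_succ (p : nat -> R) (c : R) : (forall n, 0 <= p n <= 1) ->
  n.+1%:R * p n @[n --> \oo] --> c -> (1 - p n) ^+ n.+1 @[n --> \oo] --> expR (- c).
Proof.
move=> p01 pc; pose q n := p n.-1.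
apply: (cvg_succ (fun n => (1 - q n) ^+ n) _).2.
apply: cvg_onem_expn => [n|]; first exact: p01.
exact: (cvg_succ (fun n => n%:R * q n) c).1.
Qed.

(** The probability that the maximum of [n] draws exceeds [x]; its integral [exp_max] is the
    expected maximum by the layer-cake formula. *)
Definition max_weight (n : nat) (x : R) : R := 1 - (1 - S x) ^+ n.

Let F01 x : 0 <= 1 - S x <= 1.
Proof. by rewrite subr_ge0 S_le1 gerBl S_ge0. Qed.

Lemma max_weight01 n x : 0 <= max_weight n x <= 1.
Proof.
have /andP[h0 h1] := F01 x.
by rewrite subr_ge0 exprn_ile1// gerBl exprn_ge0.
Qed.

Let mS : measurable_fun setT S. Proof. exact: surv_measurable. Qed.

Lemma measurable_max_weight n : measurable_fun setT (max_weight n).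
Proof.
by apply: measurable_funB => //; apply: measurable_funX; exact: measurable_funB.
Qed.

Lemma max_weight_le n x : max_weight n x <= n%:R * S x.
Proof.
elim: n => [|n IH]; first by rewrite /max_weight expr0 subrr mul0r.
have := max_weight01 n x; have /andP[h0 h1] := F01 x.
rewrite /max_weight exprS -natr1 mulrDl mul1r in IH *.
move=> /andP[w0 w1]; have := S_ge0 x => s0.
have : (1 - (1 - S x) ^+ n) * (1 - S x) <= 1 - (1 - S x) ^+ n by rewrite ler_piMr.
lra.
Qed.

Definition exp_max n : \bar R := (\int[mu]_(x in `[0%R, +oo[) (max_weight n x)%:E)%E.

Let mE (f : R -> R) D : measurable_fun setT f -> measurable_fun D (EFin \o f).
Proof. by move=> ?; apply: measurable_funTS; apply/measurable_EFinP. Qed.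

Let w0E n x : (0 <= (max_weight n x)%:E)%E.
Proof. by rewrite lee_fin; have /andP[] := max_weight01 n x. Qed.

Lemma max_weight_tail_le n s :
  (\int[mu]_(x in `[s, +oo[) (max_weight n x)%:E <= (n%:R * H s)%:E)%E.
Proof.
rewrite EFinM (tail_intE S_ge0 S_ni hu) -ge0_integralZl_EFin//; last 2 first.
- by move=> x _; rewrite lee_fin.
- exact: mE.
apply: ge0_le_integral => //.
- exact: mE (measurable_max_weight n).
- by apply: measurable_funeM; exact: mE.
- by move=> x _; rewrite -EFinM lee_fin max_weight_le.
Qed.

Lemma exp_max_le n s : 0 <= s -> (exp_max n <= (s + n%:R * H s)%:E)%E.
Proof.
move=> s0; rewrite /exp_max (@ge0_integral_split _ _ s)//; last first.
  exact: mE (measurable_max_weight n).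
rewrite EFinD; apply: leeD; last exact: max_weight_tail_le.
rewrite -[s in leRHS](subr0 s) -[leRHS]/((s - 0)%:E) -[X in X%:E]mulr1 -integral_co_cst//.
apply: ge0_le_integral => //.
- exact: mE (measurable_max_weight n).
- by move=> x _; rewrite lee_fin; have /andP[] := max_weight01 n x.
Qed.

Lemma exp_max_fin n : exp_max n \is a fin_num.
Proof.
rewrite ge0_fin_numE; last exact: integral_ge0.
exact: le_lt_trans (exp_max_le n (lexx 0)) (ltry _).
Qed.

Lemma exp_max1 : exp_max 1 = (H 0)%:E.
Proof.
rewrite (tail_intE S_ge0 S_ni hu); apply: eq_integral => x _.
by rewrite /max_weight expr1 subKr.
Qed.

(** The map is [v |-> E max(X, v)], of slope [1 - S >= 0]. *)
Lemma step_nd v w : v <= w -> v + H v <= w + H w.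
Proof.
move=> vw; have /andP[_ h] := tail_int_bounds S_ge0 S_ni hu vw.
have : (w - v) * S v <= w - v by rewrite ler_piMr// subr_ge0.
lra.
Qed.

(** This is Jensen's inequality [E max(X, M) >= E max(X, E M)] for an independent maximum [M],
    written with survival functions: the weight of [M] has total mass [m], and [rearrangement]
    pushes it onto [[0, m[] against the nondecreasing [1 - S]. *)
Lemma exp_maxS n m : exp_max n.+1 = m%:E -> ((m + H m)%:E <= exp_max n.+2)%E.
Proof.
move=> mE'.
have m0 : 0 <= m by rewrite -lee_fin -mE'; exact: integral_ge0.
have mg := measurable_max_weight n.+1.
have F0 x : 0 <= 1 - S x by have /andP[] := F01 x.
have mF : measurable_fun setT (fun x => 1 - S x) by exact: measurable_funB.
have r := @rearrangement R (fun x => 1 - S x) (max_weight n.+1) m F0 _ mg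
  (max_weight01 n.+1) m0 mE'.
have {}r := r ltac:(by move=> x y xy; rewrite lerB// S_ni).
rewrite /exp_max.
have -> : (\int[mu]_(x in `[0%R, +oo[) (max_weight n.+2 x)%:E =
    \int[mu]_(x in `[0%R, +oo[) ((S x)%:E + ((1 - S x) * max_weight n.+1 x)%:E))%E.
  apply: eq_integral => x _; rewrite -EFinD; congr EFin.
  by rewrite /max_weight [(1 - S x) ^+ n.+2]exprS; ring.
rewrite ge0_integralD//; last 4 first.
- by move=> x _; rewrite lee_fin.
- exact: mE.
- by move=> x _; rewrite lee_fin mulr_ge0//; have /andP[] := max_weight01 n.+1 x.
- by apply: mE; exact: measurable_funM.
rewrite -(tail_intE S_ge0 S_ni hu).
apply: le_trans (leeD2l _ r).
have E1 : (\int[mu]_(x in `[0%R, m[) (S x)%:E + \int[mu]_(x in `[0%R, m[) (1 - S x)%:E = m%:E)%E.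
  rewrite -ge0_integralD//; last 4 first.
  - by move=> x _; rewrite lee_fin.
  - exact: mE.
  - by move=> x _; rewrite lee_fin.
  - exact: mE.
  under eq_integral do rewrite -EFinD addrC subrK.
  by rewrite integral_co_cst// subr0 mulr1.
have E2 := tail_split S_ge0 S_ni m0.
rewrite -!(tail_intE S_ge0 S_ni hu) in E2.
by rewrite E2 addeAC E1 -EFinD.
Qed.

Section recursion.
Context (y : nat -> R) (y0 : y 0%N = H 0).
Context (yS : forall n, y n.+1 = y n + H (y n)).

(** No online policy beats the prophet. The value [y n] corresponds to [n + 1] draws, whence the
    shift of index. *)
Lemma exp_max_ge n : ((y n)%:E <= exp_max n.+1)%E.
Proof.
elim: n => [|n IH]; first by rewrite exp_max1 y0.
have eE : exp_max n.+1 = (fine (exp_max n.+1))%:E by rewrite fineK// exp_max_fin.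
apply: le_trans (exp_maxS eE); rewrite yS lee_fin step_nd//.
by rewrite -lee_fin -eE.
Qed.

Lemma exp_max_ratio_le1 n : 0 < y n -> y n / fine (exp_max n.+1) <= 1.
Proof.
move=> yn; have h : y n <= fine (exp_max n.+1).
  by rewrite -lee_fin fineK ?exp_max_fin// exp_max_ge.
by rewrite ler_pdivrMr ?mul1r// (lt_le_trans yn).
Qed.

Context (H_gt0 : forall x, 0 < S x -> 0 < H x).
Context (S_gt0 : forall x, 0 < S x).
Context (y_vanish : y @ \oo --> vanishing S).

Let y_gt0 n : 0 < y n.
Proof.
elim: n => [|n IH]; first by rewrite y0 H_gt0.
by rewrite yS addr_gt0// H_gt0.
Qed.

Let H_bounds := tail_int_bounds S_ge0 S_ni hu.

Let yH n : n.+1%:R * H (y n) <= y n.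
Proof.
apply: (rec_tail_le S_ge0 H_gt0 H_bounds yS (fun n => S_gt0 (y n)) y_gt0).
rewrite [leRHS]y0; apply: (tail_ni S_ge0 H_bounds); exact: ltW.
Qed.

(* [r] is either close to [1] (rapid variation) or to [0] (slow variation of [H]) *)
Lemma exp_max_ratio_bound (r l : R) : 0 < r -> 0 <= l ->
  H (r * x) / H x @[x --> vanishing S] --> l ->
  forall e, 0 < e -> \forall n \near \oo,
    (r + l + e)^-1 <= y n / fine (exp_max n.+1) <= 1.
Proof.
move=> r0 l0 hl e e0.
have hly : H (r * y n) / H (y n) @[n --> \oo] --> l.
  exact: (cvg_comp y (fun x => H (r * x) / H x) y_vanish hl).
have n1 : \forall n \near \oo, H (r * y n) / H (y n) < l + e.
  by apply: (cvgr_lt _ hly); rewrite ltrDl.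
near=> n; rewrite exp_max_ratio_le1// andbT.
have Hy : 0 < H (y n) by exact: H_gt0.
have h1 : H (r * y n) / H (y n) < l + e by near: n.
have ry : 0 <= r * y n by apply: mulr_ge0; exact: ltW.
(* Cutting at [r * y n] bounds the expected maximum by [r * y n + (n + 1) * H (r * y n)]. The last
   term is at most [(l + e) * (n + 1) * H (y n)], and [yH] replaces [(n + 1) * H (y n)] by [y n]. *)
have := exp_max_le n.+1 ry; rewrite -[X in (X <= _)%E]fineK ?exp_max_fin// lee_fin.
have yf : y n <= fine (exp_max n.+1).
  by rewrite -lee_fin fineK ?exp_max_fin// exp_max_ge.
have f0 : 0 < fine (exp_max n.+1) by exact: lt_le_trans yf.
move=> h2; rewrite -[leRHS]invrK lef_pV2 ?posrE; last 2 first.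
- by lra.
- by rewrite invr_gt0 divr_gt0.
rewrite invf_div ler_pdivrMr//.
rewrite ltr_pdivrMr// in h1.
have h3 : n.+1%:R * H (r * y n) <= n.+1%:R * ((l + e) * H (y n)).
  by rewrite ler_pM2l ?ltr0n// ltW.
have h4 : (l + e) * (n.+1%:R * H (y n)) <= (l + e) * y n.
  by rewrite ler_wpM2l//; lra.
by rewrite mulrCA in h3; lra.
Unshelve. all: by end_near. Qed.

Lemma exp_max_ratio_cvg1 : (forall e, 0 < e -> exists r l : R,
    [/\ 0 < r, 0 <= l, r + l <= 1 + e &
        H (r * x) / H x @[x --> vanishing S] --> l]) ->
  y n / fine (exp_max n.+1) @[n --> \oo] --> (1 : R).
Proof.
move=> hr; apply/cvgrPdist_le => e e0.
have [r [l [r0 l0 rl hl]]] := hr (e / 2) ltac:(lra).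
have n1 := exp_max_ratio_bound r0 l0 hl (e := e / 2) ltac:(lra).
near=> n.
have /andP[h1 h2] : (r + l + e / 2)^-1 <= y n / fine (exp_max n.+1) <= 1 by near: n.
rewrite ger0_norm ?subr_ge0//.
have h3 : (1 + e)^-1 <= (r + l + e / 2)^-1 by rewrite lef_pV2 ?posrE; lra.
have h4 : 1 - e <= (1 + e)^-1.
  by rewrite -div1r ler_pdivlMr; [have := mulr_gt0 e0 e0; lra|lra].
lra.
Unshelve. all: by end_near. Qed.

Lemma exp_max_scale n :
  exp_max n.+1 = ((y n)%:E * \int[mu]_(x in `]0%R, +oo[) (max_weight n.+1 (y n * x))%:E)%E.
Proof.
have := @integral_scale_itv R (y n) 0 (fun x => (max_weight n.+1 x)%:E) (y_gt0 n)
  (mE (measurable_max_weight n.+1)) (w0E n.+1).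
rewrite mulr0 /exp_max => ->.
congr (_ * _)%E; rewrite integral_itv_obnd_cbnd//.
apply: mE; apply: (measurableT_comp (measurable_max_weight n.+1)).
exact: measurable_funM.
Qed.

Lemma exp_max_cvg_Gamma (g : R) : 0 < g < 1 ->
  (forall r, 0 < r -> S (r * x) / S x @[x --> vanishing S] --> r `^ (- g^-1)) ->
  (forall r, 0 < r -> H (r * x) / H x @[x --> vanishing S] --> r * r `^ (- g^-1)) ->
  y n / H (y n) / n.+1%:R @[n --> \oo] --> g^-1 ->
  n.+1%:R * S (y n) @[n --> \oo] --> 1 - g ->
  GammaE (1 - g) \is a fin_num /\
  fine (exp_max n.+1) / y n @[n --> \oo] --> (1 - g) `^ g * fine (GammaE (1 - g)).
Proof.
move=> /andP[g0 g1] rS rH qy nS; have k0 : 0 < 1 - g by rewrite subr_gt0.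
have mc n : measurable_fun setT (fun x => max_weight n.+1 (y n * x)).
  apply: (measurableT_comp (measurable_max_weight n.+1)); exact: measurable_funM.
pose W x := 1 - expR (- ((1 - g) * x `^ (- g^-1))).
have mW : measurable_fun setT W.
  apply: measurable_funB => //; apply: measurableT_comp => //.
  apply: measurableT_comp; first exact: oppr_measurable.
  by apply: measurable_funM => //; exact: measurable_powR.
have W0 x : 0 <= W x.
  by rewrite subr_ge0 expR_le1 oppr_le0 mulr_ge0 ?powR_ge0// ltW.
have [||||||Wfin Wcvg] := @integral_cvg_tail R (fun n x => max_weight n.+1 (y n * x)) W => //.
- by move=> n x; exact: max_weight01.
- move=> x x0; apply: cvgB; first exact: cvg_cst.
  apply: cvg_onem_expn_succ => [n|]; first by rewrite S_ge0 S_le1.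
  have c : n.+1%:R * S (y n) * (S (x * y n) / S (y n)) @[n --> \oo] --> (1 - g) * x `^ (- g^-1).
    apply: cvgM => //.
    exact: (cvg_comp y (fun t => S (x * t) / S t) y_vanish (rS _ x0)).
  apply: cvg_trans c; apply: near_eq_cvg; near=> n.
  have Sy := S_gt0 (y n).
  by rewrite -mulrA (mulrC (S (y n))) divfK ?gt_eqF// (mulrC x).
- move=> e e0; have b1 : 1 - g^-1 < 0 by rewrite subr_lt0 invf_gt1.
  (* The rescaled tail beyond [A] is at most [(n + 1) * H (A * y n) / y n], with limit
     [g * A^(1 - 1 / g)]; this [A] makes the limit [g * e / 2 < e]. *)
  pose A := (e / 2) `^ (1 - g^-1)^-1.
  have e20 : 0 < e / 2 by lra.
  have A0 : 0 < A by exact: powR_gt0.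
  exists A => //.
  have AE : A * A `^ (- g^-1) = e / 2.
    rewrite -[X in X * _](powRr1 (ltW A0)) -powRD; last by rewrite (gt_eqF A0) implybT.
    by rewrite /A -powRrM mulVf ?lt_eqF// powRr1// ltW.
  have c : (y n / H (y n) / n.+1%:R)^-1 * (H (A * y n) / H (y n)) @[n --> \oo] --> g^-1^-1 * (e / 2).
    apply: cvgM; first by apply: cvgV => //; rewrite invr_eq0 gt_eqF.
    rewrite -AE; exact: (cvg_comp y (fun t => H (A * t) / H t) y_vanish (rH _ A0)).
  have n1 : \forall n \near \oo, (y n / H (y n) / n.+1%:R)^-1 * (H (A * y n) / H (y n)) < e.
    by apply: (cvgr_lt _ c); rewrite invrK; nra.
  near=> n.
  have yn := y_gt0 n; have Hy : 0 < H (y n) by exact: H_gt0.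
  have : (y n / H (y n) / n.+1%:R)^-1 * (H (A * y n) / H (y n)) < e by near: n.
  have -> : (y n / H (y n) / n.+1%:R)^-1 * (H (A * y n) / H (y n)) = (y n)^-1 * (n.+1%:R * H (y n * A)).
    have m0 : n.+1%:R != 0 :> R by rewrite pnatr_eq0.
    rewrite (mulrC A); move: (n.+1%:R : R) m0 => m m0.
    by field; rewrite m0 !gt_eqF.
  move=> h; apply: (@le_trans _ _ ((y n)^-1 * (n.+1%:R * H (y n * A)))%:E); last first.
    by rewrite lee_fin ltW.
  rewrite [leRHS]EFinM -lee_pdivrMl ?invr_gt0// ?invrK.
  rewrite -(integral_scale_itv A yn (f := EFin \o max_weight n.+1)).
  + exact: max_weight_tail_le.
  + exact: mE (measurable_max_weight n.+1).
  + by move=> x; exact: w0E.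
rewrite (Gamma_cake_pos g0 k0) in Wfin Wcvg.
have kp : 0 < (1 - g) `^ g by exact: powR_gt0.
have Gfin : GammaE (1 - g) \is a fin_num.
  rewrite ge0_fin_numE; last first.
    by apply: integral_ge0 => t _; rewrite lee_fin mulr_ge0 ?powR_ge0 ?expR_ge0.
  rewrite ltNge; apply/negP; rewrite leye_eq => /eqP G; move: Wfin.
  by rewrite G gt0_muley ?lte_fin// ltxx.
split => //.
move: Wcvg; rewrite -(fineK Gfin) -EFinM => /fine_cvgP[hn].
apply: cvg_trans; apply: near_eq_cvg; near=> n.
have hfin : (\int[mu]_(x in `]0%R, +oo[) (max_weight n.+1 (y n * x))%:E)%E \is a fin_num by near: n.
rewrite exp_max_scale -(fineK hfin) -EFinM/= mulrC mulKf// gt_eqF//.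
Unshelve. all: by end_near. Qed.

End recursion.
End expected_maximum.

(** * The expected minimum against the optimal online value *)

Lemma half_pred_cvg : (fun n => n.-1./2) @ \oo --> \oo.
Proof.
apply/cvgnyPge => k; exists (2 * k + 2)%N => // n /= nk; lia.
Qed.

Lemma half_pred_bounds n : (0 < n)%N ->
  (n.+1 <= 4 * (n.-1./2).+1)%N /\ ((n.-1./2).+1 + (n.-1./2).+1 <= n.+1)%N.
Proof. by move=> n0; split; lia. Qed.

Section expected_minimum.
Context {R : realType}.
Local Notation mu := (@lebesgue_measure R).
Context (S : R -> R).
Context (S_ge0 : forall x, 0 <= S x).
Context (S_le1 : forall x, S x <= 1).
Context (S_ni : forall x y, x <= y -> S y <= S x).
Context (S_gt0 : forall x, (0 < S x) = (x < 0)).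
Context (hu : (\int[mu]_(t in `[0%R, +oo[) (1 - S (- t))%:E < +oo)%E).
Local Notation H := (tail_int S).

Definition min_weight (n : nat) (x : R) : R := (1 - S (- x)) ^+ n.

Let F01 x : 0 <= 1 - S x <= 1.
Proof. by rewrite subr_ge0 S_le1 gerBl S_ge0. Qed.

Lemma min_weight01 n x : 0 <= min_weight n x <= 1.
Proof.
have /andP[h0 h1] := F01 (- x).
by rewrite /min_weight exprn_ge0// exprn_ile1.
Qed.

Let S0 x : 0 <= x -> S x = 0.
Proof.
move=> x0; apply/eqP; rewrite eq_le S_ge0 andbT leNgt S_gt0 -leNgt.
exact: x0.
Qed.

Let mS : measurable_fun setT S. Proof. exact: surv_measurable. Qed.

Let mSN : measurable_fun setT (fun x : R => S (- x)).
Proof. by apply: measurableT_comp => //; exact: oppr_measurable. Qed.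

Lemma measurable_min_weight n : measurable_fun setT (min_weight n).
Proof. by apply: measurable_funX; exact: measurable_funB. Qed.

Let mE (f : R -> R) D : measurable_fun setT f -> measurable_fun D (EFin \o f).
Proof. by move=> ?; apply: measurable_funTS; apply/measurable_EFinP. Qed.

Let w0E n x : (0 <= (min_weight n x)%:E)%E.
Proof. by rewrite lee_fin; have /andP[] := min_weight01 n x. Qed.

Definition exp_min n : \bar R := (\int[mu]_(x in `[0%R, +oo[) (min_weight n x)%:E)%E.

Lemma exp_min_fin n : exp_min n.+1 \is a fin_num.
Proof.
rewrite ge0_fin_numE; last exact: integral_ge0.
apply: le_lt_trans hu; apply: ge0_le_integral => //.
- exact: mE (measurable_min_weight n.+1).
- by apply: mE; exact: measurable_funB.
- move=> x _; rewrite lee_fin /min_weight exprS.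
  have /andP[h0 h1] := F01 (- x).
  by rewrite ler_piMr// exprn_ile1.
Qed.

Lemma min_tail0 : (\int[mu]_(t in `[0%R, +oo[) (S t)%:E < +oo)%E.
Proof. by rewrite integral0_eq// => x; rewrite /= in_itv/= andbT => /S0 ->. Qed.

Let hu0 := min_tail0.

Lemma tail_reflect m : 0 <= m ->
  (\int[mu]_(x in `[0%R, m[) (S (- x))%:E = (H (- m))%:E)%E.
Proof.
move=> m0; rewrite (tail_intE S_ge0 S_ni hu0).
rewrite (tail_split S_ge0 S_ni (w := 0)); last by rewrite oppr_le0.
rewrite [X in (_ = _ + X)%E]integral0_eq ?adde0; last first.
  by move=> x; rewrite /= in_itv/= andbT => /S0 ->.
have fm : measurable_fun setT ((fun x : R => (S (- x))%:E) \_ `[0%R, m[).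
  by apply/(measurable_restrictT _ _).1 => //; exact: mE.
have := ge0_integration_by_substitution0 fm.
have f0 (r : R) : (0 <= ((fun x : R => (S (- x))%:E) \_ `[0%R, m[) r)%E.
  by apply: erestrict_ge0 => x _; rewrite lee_fin.
move=> /(_ f0) E.
transitivity (\int[mu]_(r in `[0%R, +oo[) ((fun x : R => (S (- x))%:E) \_ `[0%R, m[) r)%E.
  rewrite -integral_mkcondr; congr integral; apply/seteqP; split => x /=.
    by rewrite !in_itv/= andbT => /andP[-> ->].
  by move=> [].
rewrite E -[RHS]integral_itv_obnd_cbnd; last exact: mE.
rewrite integral_mkcond [RHS]integral_mkcond.
apply: eq_integral => x _; rewrite !patchE !mem_setE/= !in_itv/= opprK.
have [->|x0] := eqVneq x 0.
  by rewrite lexx oppr0 lexx ltxx andbF S0//; case: ifP.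
rewrite oppr_ge0 ltrNl; case: (ltgtP x 0) x0 => // x0 _.
  by rewrite andbT.
by rewrite andbF.
Qed.

(** One more draw lowers the expected minimum by the integral of [S (- x)] against the current
    weight, of total mass [m]. By [rearrangement] this is at least the integral over [[0, m[], which
    is [H (- m)]. *)
Lemma exp_minS n m : exp_min n.+1 = m%:E -> (exp_min n.+2 <= (m - H (- m))%:E)%E.
Proof.
move=> mE'.
have m0 : 0 <= m by rewrite -lee_fin -mE'; exact: integral_ge0.
have mg := measurable_min_weight n.+1.
have r := @rearrangement R (fun x => S (- x)) (min_weight n.+1) m
  (fun x => S_ge0 (- x)) _ mg (min_weight01 n.+1) m0 mE'.
have {}r := r ltac:(by move=> x y xy; rewrite S_ni// lerN2).
rewrite (tail_reflect m0) in r.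
have : (exp_min n.+2 + \int[mu]_(x in `[0%R, +oo[) (S (- x) * min_weight n.+1 x)%:E = m%:E)%E.
  rewrite -mE' -ge0_integralD//.
  - apply: eq_integral => x _; rewrite -EFinD; congr EFin.
    by rewrite /min_weight [_ ^+ n.+2]exprS; ring.
  - exact: mE (measurable_min_weight n.+2).
  - by move=> x _; rewrite lee_fin mulr_ge0//; have /andP[] := min_weight01 n.+1 x.
  - by apply: mE; exact: measurable_funM.
rewrite -(fineK (exp_min_fin n.+1)) => h.
rewrite lee_fin lerBrDr -lee_fin EFinD -h.
by rewrite leeD2l.
Qed.

Lemma step_nd_neg v w : v <= w -> v + H v <= w + H w.
Proof. exact: (step_nd S_ge0 S_le1 S_ni hu0). Qed.

Section recursion.
Context (y : nat -> R) (y0 : exp_min 1 = (- y 0%N)%:E).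
Context (yS : forall n, y n.+1 = y n + H (y n)).

Lemma exp_min_le n : (exp_min n.+1 <= (- y n)%:E)%E.
Proof.
elim: n => [|n IH]; first by rewrite y0.
have eE : exp_min n.+1 = (fine (exp_min n.+1))%:E by rewrite fineK// exp_min_fin.
apply: le_trans (exp_minS eE) _; rewrite eE lee_fin in IH.
rewrite yS lee_fin; have h : y n <= - fine (exp_min n.+1) by rewrite lerNr.
by have := step_nd_neg h; lra.
Qed.

Context (H_gt0 : forall x, 0 < S x -> 0 < H x).
Context (y_lt0 : forall n, y n < 0).
Context (y_vanish : y @ \oo --> vanishing S).

Let ny n : 0 < - y n. Proof. by rewrite oppr_gt0. Qed.

(** For [r < 1], Bernoulli's inequality shows that the minimum exceeds [r * - y n] with probability
    at least [1 - (n + 1) * S (r * y n) > r]; hence its mean is at least [r * r * - y n]. *)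
Lemma exp_min_rapid :
  (forall r, 0 < r < 1 -> n.+1%:R * S (r * y n) @[n --> \oo] --> (0 : R)) ->
  - y n / fine (exp_min n.+1) @[n --> \oo] --> (1 : R).
Proof.
move=> hS.
have lo r : 0 < r < 1 -> \forall n \near \oo, r * r <= fine (exp_min n.+1) / (- y n) <= 1.
  move=> /andP[r0 r1].
  have n1 : \forall n \near \oo, n.+1%:R * S (r * y n) < 1 - r.
    by apply: (cvgr_lt _ (hS r _)); rewrite ?r0// subr_gt0.
  near=> n.
  rewrite ler_pdivlMr// ler_pdivrMr// mul1r -!lee_fin fineK ?exp_min_fin// exp_min_le andbT.
  have h : n.+1%:R * S (r * y n) < 1 - r by near: n.
  have bern (p : R) k : 0 <= p <= 1 -> 1 - k%:R * p <= (1 - p) ^+ k.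
    move=> /andP[p0 p1]; elim: k => [|k IH]; first by rewrite mul0r subr0 expr0.
    have q0 : 0 <= 1 - p by lra.
    have := ler_wpM2l q0 IH; rewrite -exprS; apply: le_trans.
    rewrite -natr1; have : 0 <= k%:R * p * p by rewrite !mulr_ge0.
    by lra.
  have rn : 0 <= - (r * y n) by rewrite -mulrN; apply: mulr_ge0; exact: ltW.
  pose bd : R := - (r * y n).
  apply: (@le_trans _ _ (\int[mu]_(x in `[0%R, bd[) (r%:E))%E).
    by rewrite integral_co_cst// lee_fin /bd; lra.
  apply: (@le_trans _ _ (\int[mu]_(x in `[0%R, bd[) (min_weight n.+1 x)%:E)%E).
    apply: ge0_le_integral => //.
    - by move=> x _; rewrite lee_fin ltW.
    - exact: mE (measurable_min_weight n.+1).
    - move=> x; rewrite /= in_itv/= lee_fin /bd => /andP[x0 xr].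
      apply: le_trans (bern (S (- x)) n.+1 _); last by rewrite S_ge0 S_le1.
      have : n.+1%:R * S (- x) <= n.+1%:R * S (r * y n).
        by rewrite ler_pM2l ?ltr0n// S_ni// lerNr ltW.
      by lra.
  apply: ge0_subset_integral => //; first exact: mE (measurable_min_weight n.+1).
  by apply: subset_itvl; rewrite bnd_simp.
have c : fine (exp_min n.+1) / (- y n) @[n --> \oo] --> (1 : R).
  apply/cvgrPdist_le => e e0.
  pose r := 1 - Num.min (e / 2) 2^-1.
  have m0 : 0 < Num.min (e / 2) 2^-1 by rewrite lt_min; apply/andP; split; lra.
  have m1 : Num.min (e / 2) 2^-1 <= e / 2 by rewrite ge_min lexx.
  have m2 : Num.min (e / 2) 2^-1 <= 2^-1 by rewrite ge_min lexx orbT.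
  have n1 := lo r ltac:(rewrite /r; apply/andP; split; lra).
  near=> n.
  have /andP[h1 h2] : r * r <= fine (exp_min n.+1) / (- y n) <= 1 by near: n.
  rewrite ger0_norm ?subr_ge0//.
  by move: h1; rewrite /r; set m := Num.min _ _ in m0 m1 m2 *; nra.
have ci : (fine (exp_min n.+1) / (- y n))^-1 @[n --> \oo] --> (1 : R)^-1.
  by apply: cvgV => //; exact: oner_neq0.
rewrite invr1 in ci; apply: cvg_trans ci; apply: near_eq_cvg; near=> n.
by rewrite invf_div.
Unshelve. all: by end_near. Qed.

Lemma exp_min_scale n :
  exp_min n.+1 = ((- y n)%:E * \int[mu]_(x in `]0%R, +oo[) (min_weight n.+1 (- y n * x))%:E)%E.
Proof.
have := @integral_scale_itv R (- y n) 0 (fun x => (min_weight n.+1 x)%:E) (ny n)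
  (mE (measurable_min_weight n.+1)) (w0E n.+1).
rewrite mulr0 /exp_min => ->.
congr (_ * _)%E; rewrite integral_itv_obnd_cbnd//.
apply: mE; apply: (measurableT_comp (measurable_min_weight n.+1)).
exact: measurable_funM.
Qed.

Lemma exp_min_cvg_Gamma (g : R) : g < 0 ->
  (forall r, 0 < r -> S (r * x) / S x @[x --> vanishing S] --> r `^ (- g^-1)) ->
  n.+1%:R * S (y n) @[n --> \oo] --> 1 - g ->
  fine (exp_min n.+1) / (- y n) @[n --> \oo] --> (1 - g) `^ g * fine (GammaE (1 - g)).
Proof.
move=> g0 rS nS; have k0 : 0 < 1 - g by lra.
pose b := - g^-1; have b0 : 0 < b by rewrite oppr_gt0 invr_lt0.
have Sy n : 0 < S (y n) by rewrite S_gt0.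
have mc n : measurable_fun setT (fun x => min_weight n.+1 (- y n * x)).
  apply: (measurableT_comp (measurable_min_weight n.+1)); exact: measurable_funM.
pose W x := expR (- ((1 - g) * x `^ b)).
have mW : measurable_fun setT W.
  apply: measurableT_comp => //.
  apply: measurableT_comp; first exact: oppr_measurable.
  by apply: measurable_funM => //; exact: measurable_powR.
have nSr x : 0 < x -> n.+1%:R * S (x * y n) @[n --> \oo] --> (1 - g) * x `^ b.
  move=> x0.
  have c : n.+1%:R * S (y n) * (S (x * y n) / S (y n)) @[n --> \oo] --> (1 - g) * x `^ b.
    apply: cvgM => //.
    exact: (cvg_comp y (fun t => S (x * t) / S t) y_vanish (rS _ x0)).
  apply: cvg_trans c; apply: near_eq_cvg; near=> n.
  by rewrite -mulrA (mulrC (S (y n))) divfK ?gt_eqF.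
have [||||||Wfin Wcvg] := @integral_cvg_tail R (fun n x => min_weight n.+1 (- y n * x)) W => //.
- by move=> n x; exact: min_weight01.
- by move=> x; exact: expR_ge0.
- move=> x x0; rewrite /min_weight; under eq_fun do rewrite mulNr opprK (mulrC (y _)).
  by apply: cvg_onem_expn_succ => [n|]; [rewrite S_ge0 S_le1|exact: nSr].
- move=> e e0.
  have root c : 0 < c -> exists2 x : R, 0 < x & x `^ b = c.
    move=> c0; exists (c `^ b^-1); first exact: powR_gt0.
    by rewrite -powRrM mulVf ?gt_eqF// powRr1// ltW.
  (* Any value above [16] would do: the factor [16] is lost in comparing [y (h n)] with [y n],
     namely [4] from the two estimates of [n * S (y n)] and [4] from [n + 1 <= 4 * (h n + 1)]. *)
  have [r r0 rE] := root 17 ltac:(by []).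
  (* With [A^b = M], eventually [(h n + 1) * S (A * y n) > r / e], so the survival factor [q] raised
     to [h n + 1] is at most [exp (- r / e) <= e / r]. *)
  have [M M0 kM] : exists2 M, 0 < M & (1 - g) * M = 8 * (r / e).
    exists (8 * (r / e) / (1 - g)); first by rewrite !(divr_gt0, mulr_gt0).
    by rewrite mulrC divfK// gt_eqF.
  have [A A0 AE] := root M M0.
  have kM0 : 0 < (1 - g) * M by rewrite mulr_gt0.
  exists A => //.
  (* The power [n + 1] is split into two powers [h n + 1]. On the tail one is at most [e / r]; the
     other integrates to at most the mean of a minimum of [h n + 1] draws, bounded by
     [- y (h n) < r * - y n] through the prophet inequality. The product is at most [e]. *)
  pose h n := n.-1./2.
  have h_oo : h @ \oo --> \oo by exact: half_pred_cvg.
  have n1 : \forall n \near \oo, (h n).+1%:R * S (y (h n)) < 2 * (1 - g).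
    have c : (h n).+1%:R * S (y (h n)) @[n --> \oo] --> 1 - g.
      exact: (cvg_comp h (fun n => n.+1%:R * S (y n)) h_oo nS).
    by apply: (cvgr_lt _ c); lra.
  have n2 : \forall n \near \oo, (1 - g) / 2 < n.+1%:R * S (y n).
    by apply: (cvgr_gt _ nS); lra.
  have n3 : \forall n \near \oo, 16 < S (r * y n) / S (y n).
    have c : S (r * y n) / S (y n) @[n --> \oo] --> r `^ b.
      exact: (cvg_comp y (fun t => S (r * t) / S t) y_vanish (rS _ r0)).
    by apply: (cvgr_gt _ c); rewrite rE; lra.
  have n4 : \forall n \near \oo, (1 - g) * M / 2 < n.+1%:R * S (A * y n).
    by apply: (cvgr_gt _ (nSr A A0)); rewrite AE; lra.
  near=> n.
  have nn : (0 < n)%N by near: n; exact: nbhs_infty_gt.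
  have [h4 h2] := half_pred_bounds nn; rewrite -/(h n) in h4 h2.
  have {h4}h4 : n.+1%:R <= 4 * (h n).+1%:R :> R by rewrite -natrM ler_nat.
  have hp : (0 : R) < (h n).+1%:R by rewrite ltr0n.
  have np : (0 : R) < n.+1%:R by rewrite ltr0n.
  have yh : - y (h n) < r * - y n.
    rewrite mulrN ltrN2; apply: (surv_lt S_ni).
    have q1 : (h n).+1%:R * S (y (h n)) < 2 * (1 - g) by near: n.
    have q2 : (1 - g) / 2 < n.+1%:R * S (y n) by near: n.
    have : 16 < S (r * y n) / S (y n) by near: n.
    rewrite ltr_pdivlMr// => q3.
    have q4 : n.+1%:R * S (y n) <= 4 * (h n).+1%:R * S (y n) by rewrite ler_pM2r.
    have : (h n).+1%:R * S (y (h n)) < (h n).+1%:R * S (r * y n).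
      have : (h n).+1%:R * (16 * S (y n)) < (h n).+1%:R * S (r * y n) by rewrite ltr_pM2l.
      by lra.
    by rewrite ltr_pM2l.
  pose q := 1 - S (A * y n).
  have q01 : 0 <= q <= 1 by exact: F01.
  have qe : q ^+ (h n).+1 <= e / r.
    have : (1 - g) * M / 2 < n.+1%:R * S (A * y n) by near: n.
    have : n.+1%:R * S (A * y n) <= 4 * (h n).+1%:R * S (A * y n) by rewrite ler_wpM2r.
    rewrite kM => ? ?.
    have le1 : q <= expR (- S (A * y n)) by exact: expR_ge1Dx.
    apply: (@le_trans _ _ (expR (- S (A * y n)) ^+ (h n).+1)).
      by apply: lerXn2r => //; rewrite nnegrE ?expR_ge0//; case/andP: q01.
    rewrite -expRM_natl mulrN expRN.
    rewrite -[leRHS]invrK invf_div lef_pV2 ?posrE ?expR_gt0 ?divr_gt0//.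
    by have := expR_ge1Dx ((h n).+1%:R * S (A * y n)); lra.
  apply: (@le_trans _ _ ((- y n)^-1 * (e / r * (- y (h n))))%:E); last first.
    rewrite lee_fin ler_pdivrMl//.
    have er : 0 < e / r by rewrite divr_gt0.
    have : e / r * - y (h n) <= e / r * (r * - y n) by rewrite ler_pM2l// ltW.
    by rewrite mulrA divfK ?gt_eqF//; lra.
  rewrite [leRHS]EFinM -lee_pdivrMl ?invr_gt0// invrK.
  rewrite -(integral_scale_itv A (ny n) (f := EFin \o min_weight n.+1)); last 2 first.
  + exact: mE (measurable_min_weight n.+1).
  + by move=> x; exact: w0E.
  have e1 : (0 <= q ^+ (h n).+1) by rewrite exprn_ge0//; case/andP: q01.
  apply: (@le_trans _ _ ((q ^+ (h n).+1)%:E * exp_min (h n).+1)%E); last first.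
    rewrite EFinM; apply: lee_pmul => //; first exact: integral_ge0.
    exact: exp_min_le.
  rewrite /exp_min -ge0_integralZl_EFin//; last exact: mE (measurable_min_weight _).
  apply: (@le_trans _ _ (\int[mu]_(x in `[(- y n * A)%R, +oo[)
      ((q ^+ (h n).+1)%:E * (min_weight (h n).+1 x)%:E)))%E.
    apply: ge0_le_integral => //.
    - by move=> x _; exact: w0E.
    - exact: mE (measurable_min_weight n.+1).
    - by apply: measurable_funeM; exact: mE (measurable_min_weight _).
    - move=> x; rewrite /= in_itv/= andbT => xA.
      rewrite -EFinM lee_fin /min_weight.
      have /andP[s0 s1] := F01 (- x).
      apply: (@le_trans _ _ ((1 - S (- x)) ^+ ((h n).+1 + (h n).+1))).
        exact: ler_wiXn2l.
      rewrite exprD ler_wpM2r ?exprn_ge0//.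
      apply: lerXn2r => //; first by rewrite nnegrE; case/andP: q01.
      by rewrite /q lerB// S_ni//; lra.
  apply: ge0_subset_integral => //.
  + by apply: measurable_funeM; exact: mE (measurable_min_weight _).
  + by move=> x _; rewrite -EFinM lee_fin mulr_ge0//; have /andP[] := min_weight01 (h n).+1 x.
  + by apply: subset_itvr; rewrite bnd_simp mulr_ge0// ltW.
rewrite (Gamma_cake_neg g0 k0) in Wfin Wcvg.
have kp : 0 < (1 - g) `^ g by exact: powR_gt0.
have Gfin : GammaE (1 - g) \is a fin_num.
  rewrite ge0_fin_numE; last exact/ltW/GammaE_gt0/ltW.
  rewrite ltNge; apply/negP; rewrite leye_eq => /eqP G; move: Wfin.
  by rewrite G gt0_muley ?lte_fin// ltxx.
move: Wcvg; rewrite -(fineK Gfin) -EFinM => /fine_cvgP[hn].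
apply: cvg_trans; apply: near_eq_cvg; near=> n.
have hfin : (\int[mu]_(x in `]0%R, +oo[) (min_weight n.+1 (- y n * x))%:E)%E \is a fin_num by near: n.
by rewrite exp_min_scale -(fineK hfin) -EFinM/= mulrC mulKf// gt_eqF.
Unshelve. all: by end_near. Qed.

End recursion.
End expected_minimum.

(** * Distributions, samples and optimal values *)

Section distribution_facts.
Context {R : realType} (D : probability (measurableTypeR R) R) (f : R -> R).
Context (Df : has_density D f) (D0 : left_endpoint D = 0%E).
Local Notation mu := (@lebesgue_measure R).
Local Notation F := (dist_cdf D).

Lemma dist_cdfE x : D `]-oo, x]%classic = (F x)%:E.
Proof. by rewrite /dist_cdf fineK// fin_num_measure. Qed.

Lemma dist_cdf_ge0 x : 0 <= F x.
Proof. by rewrite -lee_fin -dist_cdfE measure_ge0. Qed.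

Lemma dist_cdf_le1 x : F x <= 1.
Proof. by rewrite -lee_fin -dist_cdfE probability_le1. Qed.

Lemma dist_cdf_nd x y : x <= y -> F x <= F y.
Proof.
move=> xy; rewrite -lee_fin -!dist_cdfE le_measure ?inE//.
by apply: subset_itvl; rewrite bnd_simp.
Qed.

Lemma dist_point x : D [set x] = 0%E.
Proof. by have [_ _ ->//] := Df; rewrite integral_set1. Qed.

Lemma dist_ltE x : D `]-oo, x[%classic = (F x)%:E.
Proof.
rewrite -dist_cdfE -(setUitv1 true)// measureU//.
  by rewrite [X in (_ + X)%E]dist_point adde0.
by apply/seteqP; split => z //= [] /=; rewrite in_itv/= => zx zE; move: zx; rewrite zE ltxx.
Qed.

Lemma dist_gtE x : D `]x, +oo[%classic = (1 - F x)%:E.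
Proof.
rewrite -setCitvl probability_setC// dist_cdfE EFinB.
by [].
Qed.

Lemma dist_geE x : D `[x, +oo[%classic = (1 - F x)%:E.
Proof. by rewrite -setCitvl probability_setC// dist_ltE. Qed.

(** At [0] itself the density excludes an atom, and the open half-line is a countable union of null
    half-lines. *)
Lemma dist_cdf_le0 x : x <= 0 -> F x = 0.
Proof.
have neg z : z < 0 -> F z = 0.
  move=> z0; apply/eqP; rewrite eq_le dist_cdf_ge0 andbT leNgt; apply/negP => Fz.
  have : (left_endpoint D <= z%:E)%E by apply: ereal_inf_lbound; exists z.
  by rewrite D0 lee_fin leNgt z0.
rewrite le_eqVlt => /orP[/eqP ->|]; last exact: neg.
apply: EFin_inj; rewrite -dist_ltE.
pose B (n : nat) : set (measurableTypeR R) := `]-oo, (- n.+1%:R^-1 : R)]%classic.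
have -> : `]-oo, (0 : R)[%classic = \bigcup_n B n.
  apply/seteqP; split => z /=; rewrite ?in_itv/=.
    move=> z0; exists (Num.trunc (- z)^-1) => //; rewrite /B/= in_itv/=.
    have zi : 0 <= (- z)^-1 by rewrite invr_ge0 oppr_ge0 ltW.
    have /andP[_ h] := truncn_itv zi.
    rewrite lerNr -[leRHS]invrK lef_pV2 ?posrE ?invr_gt0 ?oppr_gt0//.
    exact: ltW.
  by move=> [n _]; rewrite /B/= in_itv/= => /le_lt_trans; apply; rewrite oppr_lt0 invr_gt0.
have nz n : D (B n) = 0%E by rewrite dist_cdfE neg// oppr_lt0 invr_gt0.
apply/eqP; rewrite eq_le measure_ge0 andbT.
have mB n : measurable (B n) by exact: measurable_itv.
have h : (D (\bigcup_n B n) <= \sum_(n <oo) D (B n))%E.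
  by apply: measure_sigma_subadditive => //; exact: bigcupT_measurable.
by apply: le_trans h _; rewrite eseries0// => n _ _; exact: nz.
Qed.

Lemma dist_cdf_gt0 x : 0 < x -> 0 < F x.
Proof.
move=> x0; have : (left_endpoint D < x%:E)%E by rewrite D0 lte_fin.
move=> /ereal_inf_lt[_ [z /= z0 <-]]; rewrite lte_fin => /ltW /dist_cdf_nd.
exact: lt_le_trans.
Qed.

Lemma dist_neg0 : D [set t : measurableTypeR R | t < 0] = 0%E.
Proof.
rewrite (_ : [set _ | _] = `]-oo, 0[%classic); last first.
  by apply/seteqP; split => z /=; rewrite in_itv.
by rewrite dist_ltE dist_cdf_le0.
Qed.

Lemma measurable_neg_set {d} {T : measurableType d} (Z : T -> R) :
  measurable_fun setT Z -> measurable [set t | Z t < 0].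
Proof.
move=> mZ; rewrite -[X in measurable X]setTI.
exact: (measurable_fun_ltr mZ (measurable_cst _) measurableT (Y := [set true])).
Qed.

(** Replaces an almost surely nonnegative variable by its positive part, the form to which
    [layer_cake] applies. *)
Lemma integral_ge0_part {d} {T : measurableType d} (P : probability T R) (Z : T -> R) :
  measurable_fun setT Z -> P [set t | Z t < 0] = 0%E ->
  (\int[P]_t (Z t)%:E = \int[P]_t (Num.max (Z t - 0) 0)%:E)%E.
Proof.
move=> mZ Z0; apply: ae_eq_integral => //.
- exact/measurable_EFinP.
- by apply/measurable_EFinP; apply: measurable_maxr => //; exact: measurable_funB.
- exists [set t | Z t < 0]; split => //; first exact: measurable_neg_set.
  move=> t /= h; rewrite ltNge; apply/negP => Zt; apply: h => _.
  by rewrite subr0 max_l.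
Qed.

Lemma meanE : (mean D = \int[mu]_(x in `[0%R, +oo[) (1 - F x)%:E)%E.
Proof.
rewrite /mean (@integral_ge0_part _ _ D id)//; last exact: dist_neg0.
apply: (@layer_cake R _ _ D id 0 (fun x => 1 - F x)) => //.
- apply: measurable_funB => //; apply: nondecreasing_measurable => // x y; exact: dist_cdf_nd.
- by move=> x; rewrite subr_ge0 dist_cdf_le1.
- move=> x _; rewrite -dist_gtE; congr (D _).
  by apply/seteqP; split => z /=; rewrite in_itv/= andbT.
Qed.

Let mF : measurable_fun setT F.
Proof. by apply: nondecreasing_measurable => // x y; exact: dist_cdf_nd. Qed.

Lemma opt_max_step n v : 0 <= v -> opt_max D n.+1 = v%:E ->
  (opt_max D n.+2 = v%:E + \int[mu]_(x in `[v, +oo[) (1 - F x)%:E)%E.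
Proof.
move=> v0 vE; rewrite -[LHS]/(\int[D]_x maxe x%:E (opt_max D n.+1))%E vE.
rewrite -(@layer_cake _ _ _ D id v (fun x => 1 - F x))//; last 3 first.
- exact: measurable_funB.
- by move=> x; rewrite subr_ge0 dist_cdf_le1.
- move=> x _; rewrite -dist_gtE; congr (D _).
  by apply/seteqP; split => z /=; rewrite in_itv/= andbT.
have vI : (v%:E = \int[D]_x (cst v%:E x))%E.
  by rewrite integral_cst// [X in (_ * X)%E]probability_setT mule1.
rewrite [X in _ = (X + _)%E]vI -ge0_integralD//; last 2 first.
- by move=> x _; rewrite lee_fin le_max lexx orbT.
- by apply/measurable_EFinP; apply: measurable_maxr => //; exact: measurable_funB.
apply: eq_integral => x _; rewrite /= -EFinD -EFin_max; congr EFin.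
by rewrite addr_maxr addrC subrK addr0.
Qed.

(** Integrates [min(x, v) + (v - x)^+ = v], the second term being a layer cake for [- x] at level
    [- v]. The additive form avoids a subtraction of extended reals. *)
Lemma opt_min_step n v : 0 <= v -> opt_min D n.+1 = v%:E ->
  (opt_min D n.+2 + \int[mu]_(x in `[(- v)%R, +oo[) (F (- x)%R)%:E = v%:E)%E.
Proof.
move=> v0 vE; rewrite -[opt_min D n.+2]/(\int[D]_x mine x%:E (opt_min D n.+1))%E vE.
rewrite -(@layer_cake _ _ _ D (fun x => - x) (- v) (fun x => F (- x)))//; last 4 first.
- exact: oppr_measurable.
- by apply: measurableT_comp => //; exact: oppr_measurable.
- by move=> x; exact: dist_cdf_ge0.
- move=> x _; rewrite -dist_ltE; congr (D _).
  by apply/seteqP; split => z /=; rewrite in_itv/= ltrNr.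
have mneg : measurable [set t : measurableTypeR R | t < 0].
  by rewrite (_ : [set _ | _] = `]-oo, 0[%classic)//; apply/seteqP; split => z /=; rewrite in_itv.
have mmin : measurable_fun setT (fun t : measurableTypeR R => Num.min t v).
  exact: measurable_minr.
have -> : (\int[D]_x mine x%:E v%:E = \int[D]_x (Num.min x v)%:E)%E.
  by apply: eq_integral => x _; rewrite EFin_min.
rewrite (integral_ge0_part mmin); last first.
  rewrite -dist_neg0; congr (D _); apply/seteqP; split => z /=; rewrite gt_min.
    by rewrite [v < 0]ltNge v0 orbF.
  by move=> ->.
have m1 : measurable_fun setT (fun t : measurableTypeR R => Num.max (Num.min t v - 0) 0).
  by apply: measurable_maxr => //; exact: measurable_funB.
have m2 : measurable_fun setT (fun t : measurableTypeR R => Num.max (- t - - v) 0).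
  by apply: measurable_maxr => //; apply: measurable_funB => //; exact: oppr_measurable.
rewrite -ge0_integralD//; try exact/measurable_EFinP;
  try by move=> x _; rewrite lee_fin le_max lexx orbT.
rewrite (@ae_eq_integral _ _ _ D setT (cst v%:E))//.
- by rewrite integral_cst// [X in (_ * X)%E]probability_setT mule1.
- by apply: emeasurable_funD; exact/measurable_EFinP.
- exists [set t : measurableTypeR R | t < 0]; split => //; first exact: dist_neg0.
  move=> t /= h; rewrite ltNge; apply/negP => t0; apply: h => _.
  rewrite -EFinD opprK subr0; congr EFin.
  case: (leP t v) => tv.
    by rewrite max_l// max_l; lra.
  by rewrite max_l// max_r; lra.
Qed.

End distribution_facts.

Section sample_facts.
Context {R : realType} {d : measure_display} {T : measurableType d}.
Context (P : probability T R) (X : nat -> {RV P >-> R}).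
Context (D : probability (measurableTypeR R) R) (f : R -> R).
Context (XD : iid X D) (Df : has_density D f) (D0 : left_endpoint D = 0%E).
Local Notation mu := (@lebesgue_measure R).
Local Notation F := (dist_cdf D).

Lemma iid_bigcap n (B : set (measurableTypeR R)) p : measurable B -> D B = p%:E ->
  P (\bigcap_(i in [set i | (i < n)%N]) (X i @^-1` B)) = (p ^+ n)%:E.
Proof.
move=> mB DB; have [ind dis] := XD.
have := ind [fset i in iota 0 n]%fset (fun=> B) (fun=> mB).
have -> : [set` [fset i in iota 0 n]%fset] = [set i | (i < n)%N].
  by apply/seteqP; split => i /=; rewrite !inE/= mem_iota.
move=> ->.
have E (s : seq nat) : (\prod_(j <- s) P (X j @^-1` B) = (p ^+ size s)%:E)%E.
  elim: s => [|i s IH]; first by rewrite big_nil.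
  rewrite big_cons IH exprS EFinM; congr (_ * _)%E.
  by have := dis i B mB; rewrite DB.
rewrite E; congr (_ ^+ _)%:E.
by rewrite -[LHS]/(#|` [fset i in iota 0 n]%fset|)%N card_fseq undup_id ?iota_uniq// size_iota.
Qed.

Let mX i : measurable_fun setT (X i). Proof. exact: measurable_funPT. Qed.

Let mbig n (B : set (measurableTypeR R)) : measurable B ->
  measurable (\bigcap_(i in [set i | (i < n)%N]) (X i @^-1` B)).
Proof.
move=> mB; apply: bigcap_measurableType => i _.
by rewrite -[X in measurable X]setTI; exact: mX.
Qed.

Lemma sample_max_measurable n : measurable_fun setT (sample_max X n).
Proof.
rewrite /sample_max; elim: (index_enum _) => [|i s IH].
  by under eq_fun do rewrite big_nil; exact: mX.
by under eq_fun do rewrite big_cons; apply: measurable_maxr => //; exact: mX.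
Qed.

Lemma sample_min_measurable n : measurable_fun setT (sample_min X n).
Proof.
rewrite /sample_min; elim: (index_enum _) => [|i s IH].
  by under eq_fun do rewrite big_nil; exact: mX.
by under eq_fun do rewrite big_cons; apply: measurable_minr => //; exact: mX.
Qed.

Lemma sample_max_le n x w :
  sample_max X n.+1 w <= x <-> forall i, (i < n.+1)%N -> X i w <= x.
Proof.
split=> [/bigmax_leP[_ h] i ni|h]; first exact: (h (Ordinal ni)).
by apply/bigmax_leP; split=> [|i _]; [exact: (h 0%N)|exact: h].
Qed.

Lemma sample_min_gt n x w :
  x < sample_min X n.+1 w <-> forall i, (i < n.+1)%N -> x < X i w.
Proof.
split=> [/bigmin_gtP[_ h] i ni|h]; first exact: (h (Ordinal ni)).
by apply/bigmin_gtP; split=> [|i _]; [exact: (h 0%N)|exact: h].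
Qed.

Lemma sample_min_ge n x w :
  x <= sample_min X n.+1 w <-> forall i, (i < n.+1)%N -> x <= X i w.
Proof.
split=> [/bigmin_geP[_ h] i ni|h]; first exact: (h (Ordinal ni)).
by apply/bigmin_geP; split=> [|i _]; [exact: (h 0%N)|exact: h].
Qed.

Lemma mean_sample_max n :
  ('E_P[sample_max X n.+1] = exp_max (fun x => 1 - F x)%R n.+1)%E.
Proof.
rewrite unlock (integral_ge0_part (sample_max_measurable n.+1)); last first.
  apply/eqP; rewrite eq_le measure_ge0 andbT.
  have mneg : measurable [set t : measurableTypeR R | t < 0].
    by apply: (measurable_neg_set (Z := id)).
  rewrite -(dist_neg0 Df D0) -(XD.2 0%N _ mneg).
  rewrite -[leRHS]/(P (X 0%N @^-1` [set t | t < 0])); apply: le_measure; rewrite ?inE.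
  - exact: (measurable_neg_set (sample_max_measurable n.+1)).
  - exact: (measurable_neg_set (mX 0)).
  - move=> w /=; rewrite !ltNge; apply: contra => h.
    by apply: (le_trans h); exact: (le_bigmax _ _ (ord0 : 'I_n.+1)).
rewrite /exp_max; apply: layer_cake.
- exact: sample_max_measurable.
- apply: measurable_funB => //; apply: measurable_funX; apply: measurable_funB => //.
  apply: measurable_funB => //; apply: nondecreasing_measurable => // x y.
  exact: dist_cdf_nd.
- move=> x; rewrite /max_weight subKr subr_ge0 exprn_ile1// ?dist_cdf_ge0//.
  exact: dist_cdf_le1.
- move=> x _; rewrite /max_weight subKr EFinB.
  transitivity (P (~` \bigcap_(i in [set i | (i < n.+1)%N]) (X i @^-1` `]-oo, x]))).
    congr (P _); apply/seteqP; split => w /= h.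
      move=> k; move: h; rewrite ltNge => /negP; apply; apply/sample_max_le => i ni.
      by have := k i ni; rewrite /= in_itv.
    rewrite ltNge; apply/negP => /sample_max_le k; apply: h => i /= ni.
    by rewrite in_itv/= k.
  rewrite probability_setC; last exact: mbig.
  by rewrite (iid_bigcap n.+1 (measurable_itv _) (dist_cdfE D x)).
Qed.

Lemma mean_sample_min n :
  ('E_P[sample_min X n.+1] = exp_min (fun x => F (- x)%R) n.+1)%E.
Proof.
rewrite unlock (integral_ge0_part (sample_min_measurable n.+1)); last first.
  transitivity (P (~` \bigcap_(i in [set i | (i < n.+1)%N]) (X i @^-1` `[0, +oo[))).
    congr (P _); apply/seteqP; split => w /= h.
      move=> k; move: h; rewrite ltNge => /negP; apply; apply/sample_min_ge => i ni.
      by have := k i ni; rewrite /= in_itv/= andbT.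
    rewrite ltNge; apply/negP => /sample_min_ge k; apply: h => i /= ni.
    by rewrite in_itv/= k.
  rewrite probability_setC; last exact: mbig.
  rewrite (iid_bigcap n.+1 (measurable_itv _) (dist_geE Df 0)).
  by rewrite (dist_cdf_le0 Df D0)// subr0 expr1n subee.
rewrite /exp_min; apply: layer_cake.
- exact: sample_min_measurable.
- apply: measurable_funX; apply: measurable_funB => //.
  under eq_fun do rewrite opprK.
  apply: nondecreasing_measurable => // x y; exact: dist_cdf_nd.
- by move=> x; rewrite /min_weight opprK exprn_ge0// subr_ge0 dist_cdf_le1.
- move=> x _; rewrite /min_weight opprK.
  rewrite -(iid_bigcap n.+1 (measurable_itv _) (dist_gtE D x)).
  congr (P _); apply/seteqP; split => w /= h.
    by move=> i /= ni; rewrite in_itv/= andbT; move/sample_min_gt: h; apply.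
  by apply/sample_min_gt => i ni; have := h i ni; rewrite /= in_itv/= andbT.
Qed.

End sample_facts.

(** * The competitive ratios *)

Section constants.
Context {R : realType}.

Lemma ecvg_succ (u : nat -> \bar R) (l : \bar R) :
  u n.+1 @[n --> \oo] --> l -> u n @[n --> \oo] --> l.
Proof. by move=> h; rewrite -cvg_shiftS. Qed.

Lemma cvg_ediv (u e : nat -> R) (l : R) : (\forall n \near \oo, e n != 0) ->
  u n / e n @[n --> \oo] --> l -> ((u n)%:E / (e n)%:E)%E @[n --> \oo] --> l%:E.
Proof.
move=> e0 h; have h' : (u n / e n)%:E @[n --> \oo] --> l%:E.
  by apply: cvg_EFin => //; exact: nearW.
apply: cvg_trans h'; apply: near_eq_cvg; apply: filterS e0 => n /= en.
by rewrite inver (negbTE en) EFinM.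
Qed.

Lemma ge_cvgr {T : Type} (F : set_system T) {FF : ProperFilter F} (u : T -> R) (l z : R) :
  u @ F --> l -> (forall x, z <= u x) -> z <= l.
Proof.
move=> ul uz; rewrite leNgt; apply/negP => zl.
have [x] := filter_ex (cvgr_lt _ ul z zl).
by rewrite ltNge uz.
Qed.

Lemma prophet_constE (g : R) :
  prophet_const g = ((1 - g) `^ g * fine (GammaE (1 - g)))^-1.
Proof. by rewrite /prophet_const GammaE_fine powRN -invfM. Qed.

Lemma GammaE_fin_gt0 (g : R) : g <= 0 -> 0 < fine (GammaE (1 - g)).
Proof.
move=> g0; have g1 : 0 <= - g by rewrite oppr_ge0.
by rewrite fine_gt0// GammaE_gt0//= (le_lt_trans (GammaE_le g1))// ltry.
Qed.

(** This is [GammaE_le] at [a = - g]. *)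
Lemma prophet_const_ge1 (g : R) : g <= 0 -> 1 <= prophet_const g.
Proof.
move=> g0; rewrite /prophet_const GammaE_fine ler_pdivlMr ?GammaE_fin_gt0// mul1r.
have g1 : 0 <= - g by rewrite oppr_ge0.
rewrite -lee_fin fineK ?GammaE_le//.
by rewrite ge0_fin_numE ?(ltW (GammaE_gt0 g0))// (le_lt_trans (GammaE_le g1))// ltry.
Qed.

Lemma prophet_const0 : prophet_const (0 : R) = 1.
Proof. by rewrite prophet_constE subr0 powRr0 GammaE1 mul1r invr1. Qed.

(** At [x = 0], [n * S (b n)] tends to [1], so the values [S (b n)] are eventually positive and
    arbitrarily small. *)
Lemma attraction_nonvoid (S : R -> R) (a b : nat -> R) (g : R) :
  (forall x, 0 < 1 + g * x -> n%:R * S (a n * x + b n) @[n --> \oo] --> tau g x) ->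
  forall d, 0 < d -> exists x, 0 < S x < d.
Proof.
move=> S_cvg d d0.
have h : n%:R * S (a n * 0 + b n) @[n --> \oo] --> tau g 0.
  by apply: S_cvg; rewrite mulr0 addr0.
rewrite tau0 in h.
have h2 : n%:R^-1 @[n --> \oo] --> (0 : R) by exact: cvg_natV0.
have dd : 0 < d / 2 by lra.
have [n [[n0 n1] [n2 n3]]] : exists n : nat, ((0 < n)%N /\ 0 < n%:R * S (a n * 0 + b n)) /\
    (n%:R * S (a n * 0 + b n) < 2 /\ n%:R^-1 < d / 2).
  near \oo => n; exists n; do ![split].
  - by near: n; exact: nbhs_infty_gt.
  - by near: n; apply: (cvgr_gt _ h); exact: ltr01.
  - by near: n; apply: (cvgr_lt _ h); lra.
  - by near: n; apply: (cvgr_lt _ h2).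
have nR : 0 < n%:R :> R by rewrite ltr0n.
exists (a n * 0 + b n); move: n1; rewrite pmulr_rgt0// => ->/=.
rewrite -(ltr_pM2l nR) (lt_trans n2)//.
have := n3; rewrite -(ltr_pM2l nR) divff ?gt_eqF//; lra.
Unshelve. all: by end_near. Qed.

End constants.

(** * The limit ratio for maxima *)

Section max_limit.
Context {R : realType} (S : R -> R).
Context (S_ge0 : forall x, 0 <= S x).
Context (S_le1 : forall x, S x <= 1).
Context (S_ni : forall x y, x <= y -> S y <= S x).
Context (S_one : forall x, x <= 0 -> S x = 1).
Context (a b : nat -> R) (g : R).
Context (a_gt0 : forall n, 0 < a n).
Context (S_cvg : forall x, 0 < 1 + g * x ->
  n%:R * S (a n * x + b n) @[n --> \oo] --> tau g x).
Local Notation mu := (@lebesgue_measure R).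
Local Notation H := (tail_int S).

Let nonvoid := attraction_nonvoid S_cvg.

Let tail_zero z : S z = 0 -> (\int[mu]_(x in `[z, +oo[) (S x)%:E = 0)%E.
Proof.
move=> Sz; apply: integral0_eq => x; rewrite /= in_itv/= andbT => /S_ni.
by rewrite Sz => h; congr EFin; apply/eqP; rewrite eq_le h S_ge0.
Qed.

Let zero_or_gt0 : (exists z, S z = 0) \/ (forall x, 0 < S x).
Proof.
have [h|h] := pselect (exists z, S z = 0); [by left|right => x].
by rewrite lt_neqAle S_ge0 andbT; apply/eqP => Sx; apply: h; exists x.
Qed.

Let neg_absurd : (forall x, 0 < S x) -> g < 0 -> False.
Proof.
move=> Sp g0.
have [M hM] := attraction_bounded S_ge0 S_le1 S_ni nonvoid a_gt0 S_cvg g0.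
by have := hM (M + 1) (Sp _); lra.
Qed.

(** The ratio [S (2 x) / S x] tends to [2^(- 1 / g) < 1 / 2], or to [0] if [g = 0], so [tail_finite]
    applies when the support is unbounded. Thus an infinite mean, where the ratio is [1] by
    convention, forces [g >= 1]. *)
Lemma max_mean_finite : g < 1 -> (\int[mu]_(x in `[0%R, +oo[) (S x)%:E < +oo)%E.
Proof.
move=> g1; suff [u hu] : exists u, (\int[mu]_(x in `[u, +oo[) (S x)%:E < +oo)%E.
  by have /fin_numPlt /andP[] := tail_fin_num S_ge0 S_ni 0 hu.
have [[z Sz]|Sp] := zero_or_gt0; first by exists z; rewrite tail_zero// ltry.
have [l /andP[l0 l1] hl] : exists2 l : R, 0 <= l < 2^-1 &
    S (2 * x) / S x @[x --> vanishing S] --> l.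
  have [/(neg_absurd Sp)//|g0|g0] := ltgtP g 0.
    exists (2 `^ (- g^-1)).
      rewrite powR_ge0/= powRN ltf_pV2 ?posrE ?powR_gt0//.
      have p0 : 0 < g^-1 - 1 by rewrite subr_gt0 invf_gt1.
      rewrite -(@mulr_powRB1 _ 2) ?invr_gt0// ltr_pMr//.
      apply: (@le_lt_trans _ _ (1 `^ (g^-1 - 1))); first by rewrite powR1.
      by rewrite gt0_ltr_powR ?nnegrE//; lra.
    exact: (attraction_regular_infinite S_ge0 S_le1 S_ni nonvoid a_gt0 S_cvg).
  exists 0; first by lra.
  by apply: (attraction_rapid_infinite S_ge0 S_le1 S_ni nonvoid a_gt0 S_cvg) => //; lra.
pose c := (l + 2^-1) / 2.
have lc : l < c by rewrite /c; lra.
have [e e0 he] := vanishing_cvg_lt hl lc.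
have [z /andP[z0 ze]] := nonvoid e0.
exists (Num.max z 1); apply: (@tail_finite _ S c) => //.
- by rewrite lt_max ltr01 orbT.
- by rewrite /c; lra.
- move=> x; rewrite ge_max => /andP[zx _]; rewrite -ler_pdivrMr//.
  by apply/ltW/he; rewrite Sp/= (le_lt_trans (S_ni zx)).
Qed.

Context (hu : (\int[mu]_(x in `[0%R, +oo[) (S x)%:E < +oo)%E).
Context (y : nat -> R) (y0 : y 0%N = H 0).
Context (yS : forall n, y n.+1 = y n + H (y n)).

Let e n := fine (exp_max S n.+1).
Let H_bounds := tail_int_bounds S_ge0 S_ni hu.
Let H_ge0 := tail_int_ge0 S_ge0.
Let eE n : (e n)%:E = exp_max S n.+1.
Proof. by rewrite fineK// (exp_max_fin S_ge0 S_le1 S_ni hu). Qed.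

Lemma max_rec_gt0 n : 0 < y n.
Proof.
elim: n => [|n IH]; last by rewrite yS ltr_pwDl.
have [x /andP[x0 x1]] := nonvoid ltr01.
have xp : 0 < x by rewrite ltNge; apply/negP => /S_one xE; move: x1; rewrite xE ltxx.
have /andP[h _] := H_bounds (ltW xp); rewrite y0.
have := H_ge0 x; have : 0 < (x - 0) * S x by rewrite mulr_gt0 ?subr_gt0.
lra.
Qed.

Let y_gt0 n : 0 < y n := max_rec_gt0 n.

Let y_le_e n : y n <= e n.
Proof. by rewrite -lee_fin eE; exact: (exp_max_ge S_ge0 S_le1 S_ni hu). Qed.

(** No regular variation is involved: [y] increases to some [L], its increments [H (y n)] tend to
    [0], so [H L = 0] and the expected maximum is at most [L + n * H L = L]. *)
Lemma max_limit_bounded z : S z = 0 -> y n / e n @[n --> \oo] --> (1 : R).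
Proof.
move=> Sz; have z0 : 0 <= z.
  by rewrite leNgt; apply/negP => /ltW /S_one; rewrite Sz => /esym/eqP; rewrite oner_eq0.
have Hz : H z = 0.
  by apply: EFin_inj; rewrite (tail_intE S_ge0 S_ni hu) tail_zero.
have y_nd : {homo y : n m / (n <= m)%N >-> n <= m}.
  by apply: homo_leq => [x|x u w|n]; [exact: lexx|exact: le_trans|rewrite yS lerDl].
have yc : cvgn y.
  apply: nondecreasing_is_cvgn => //; exists z => _ [n _ <-].
  rewrite -lee_fin (le_trans (exp_max_ge S_ge0 S_le1 S_ni hu y0 yS n))//.
  by rewrite (le_trans (exp_max_le S_ge0 S_le1 S_ni hu _ z0))// Hz mulr0 addr0.
pose L := limn y; have yL n : y n <= L by exact: nondecreasing_cvgn_le.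
have L0 : 0 < L by exact: lt_le_trans (y_gt0 0%N) (yL 0%N).
have HL : H L = 0.
  apply/eqP; rewrite eq_le H_ge0 andbT.
  have c : y n.+1 - y n @[n --> \oo] --> L - L by apply: cvgB => //; exact/cvg_succ.
  rewrite -(subrr L); apply: (ge_cvgr c) => n.
  by rewrite yS addrAC subrr add0r (tail_ni S_ge0 H_bounds).
have eL n : e n <= L.
  rewrite -lee_fin eE (le_trans (exp_max_le S_ge0 S_le1 S_ni hu _ (ltW L0)))//.
  by rewrite HL mulr0 addr0.
have e0 n : 0 < e n by exact: lt_le_trans (y_gt0 n) (y_le_e n).
apply: (@squeeze_cvgr _ _ _ _ (fun n => y n / L) (cst 1)).
- apply: nearW => n; apply/andP; split.
    by rewrite ler_pM2l// lef_pV2 ?posrE.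
  by rewrite /= ler_pdivrMr// mul1r.
- have c : y n / L @[n --> \oo] --> L / L by apply: cvgMl.
  by rewrite divff ?gt_eqF in c.
- exact: cvg_cst.
Qed.

Lemma max_limit_infinite : (forall x, 0 < S x) ->
  y n / e n @[n --> \oo] -->
  (if g < 1 then Num.min (prophet_const g) 1 else 1 : R).
Proof.
move=> Sp.
have H_gt0 x : 0 < S x -> 0 < H x.
  move=> _; have xw : x <= x + 1 by lra.
  have /andP[h _] := H_bounds xw; have := H_ge0 (x + 1); have := Sp (x + 1).
  by move: h; rewrite addrAC subrr add0r mul1r; lra.
have y_supp n : 0 < S (y n) by exact: Sp.
have y_vanish := rec_vanishing S_ge0 S_ni H_gt0 H_bounds yS y_supp nonvoid.
have rH r l : 0 < r -> S (r * x) / S x @[x --> vanishing S] --> l ->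
    H (r * x) / H x @[x --> vanishing S] --> r * l.
  move=> r0; apply: (tail_ratio S_ge0 S_ni H_gt0) => //.
  - exact: tail_int_scale_le hu.
  - exact: tail_int_scale_ge hu.
  - by move=> x Sx; have := Sp x; rewrite Sx ltxx.
have cvg1 := exp_max_ratio_cvg1 S_ge0 S_le1 S_ni hu y0 yS H_gt0 Sp y_vanish.
have [/(neg_absurd Sp)//|g0|g0] := ltgtP g 0; last first.
  rewrite g0 ltr01 (min_idPr _) ?prophet_const_ge1//; apply: cvg1 => r r0.
  exists (1 + r), 0; split; [lra|lra|lra|].
  rewrite -[X in _ --> X](mulr0 (1 + r)); apply: rH; first lra.
  by apply: (attraction_rapid_infinite S_ge0 S_le1 S_ni nonvoid a_gt0 S_cvg) => //; lra.
have rS r : 0 < r -> S (r * x) / S x @[x --> vanishing S] --> r `^ (- g^-1).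
  by move=> r0; exact: (attraction_regular_infinite S_ge0 S_le1 S_ni nonvoid a_gt0 S_cvg).
have rH' r : 0 < r -> H (r * x) / H x @[x --> vanishing S] --> r * r `^ (- g^-1).
  by move=> r0; exact: rH (rS r r0).
have [g1|g1] := ltP g 1; last first.
  (* For [g >= 1] and [s <= 1] the limit [s * s^(- 1 / g)] of the [H]-ratio is at most [1], so a
     small [s] adds only itself to the bound. *)
  apply: cvg1 => r r0; pose s := Num.min r 1.
  have s0 : 0 < s by rewrite lt_min r0 ltr01.
  have s1 : s <= 1 by rewrite ge_min lexx orbT.
  have sr : s <= r by rewrite ge_min lexx.
  exists s, (s * s `^ (- g^-1)); split => //; last exact: rH'.
    by rewrite mulr_ge0 ?powR_ge0// ltW.
  rewrite addrC lerD// powRN ler_pdivrMr ?powR_gt0// mul1r ger1_powR ?s0//.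
  by rewrite invf_le1.
have g01 : 0 < g < 1 by rewrite g0.
have b1 : g^-1 - 1 != 0 by rewrite subr_eq0 gt_eqF// invf_gt1.
have b0 : g^-1 != 0 by rewrite gt_eqF// invr_gt0.
have K := karamata H_gt0 H_bounds (or_introl (near_vanishing_gt S_ni (Sp 0))) rS rH'.
have q := rec_quotient_cvg S_ge0 H_gt0 H_bounds yS y_supp y_vanish (or_introl y_gt0) b1 K.
have s := rec_survival_cvg S_ge0 H_gt0 H_bounds yS y_supp y_vanish (or_introl y_gt0) b1 b0 K.
rewrite invrK in s.
have [_ c] := exp_max_cvg_Gamma S_ge0 S_le1 S_ni hu y0 yS H_gt0 Sp y_vanish g01 rS rH' q s.
set C := _ * _ in c.
(* That the constant is at most [1] for [0 < g < 1] is read off from [y n <= e n], rather than from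
   an estimate of Gamma. *)
have C1 : 1 <= C by apply: (ge_cvgr c) => n; rewrite ler_pdivlMr// mul1r; exact: y_le_e.
have C0 : 0 < C by lra.
have c' : (fine (exp_max S n.+1) / y n)^-1 @[n --> \oo] --> C^-1.
  by apply: cvgV => //; rewrite gt_eqF.
rewrite prophet_constE -/C (min_idPl _) ?invf_le1//.
by under eq_fun do rewrite -invf_div.
Qed.

Lemma max_limit : y n / e n @[n --> \oo] -->
  (if g < 1 then Num.min (prophet_const g) 1 else 1 : R).
Proof.
have [[z Sz]|] := zero_or_gt0; last exact: max_limit_infinite.
suff g0 : g <= 0.
  by rewrite (le_lt_trans g0)// (min_idPr _) ?prophet_const_ge1//; exact: max_limit_bounded Sz.
rewrite leNgt; apply/negP => g0.
have [x x0 zx] := attraction_unbounded S_ge0 S_le1 S_ni nonvoid a_gt0 S_cvg g0 z.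
by have := S_ni (ltW zx); rewrite Sz leNgt x0.
Qed.

End max_limit.

(** * The limit ratio for minima *)

Section min_limit.
Context {R : realType} (S : R -> R).
Context (S_ge0 : forall x, 0 <= S x).
Context (S_le1 : forall x, S x <= 1).
Context (S_ni : forall x y, x <= y -> S y <= S x).
Context (S_gt0 : forall x, (0 < S x) = (x < 0)).
Context (a b : nat -> R) (g : R).
Context (a_gt0 : forall n, 0 < a n).
Context (S_cvg : forall x, 0 < 1 + g * x ->
  n%:R * S (a n * x + b n) @[n --> \oo] --> tau g x).
Local Notation mu := (@lebesgue_measure R).
Local Notation H := (tail_int S).

Let nonvoid := attraction_nonvoid S_cvg.

Let S_zero x : 0 <= x -> S x = 0.
Proof. by move=> x0; apply/eqP; rewrite eq_le S_ge0 leNgt S_gt0 -leNgt x0. Qed.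

Lemma min_index_le0 : g <= 0.
Proof.
rewrite leNgt; apply/negP => g0.
have [x] := attraction_unbounded S_ge0 S_le1 S_ni nonvoid a_gt0 S_cvg g0 0.
by rewrite S_gt0 => /lt_trans h /h; rewrite ltxx.
Qed.

Context (hu : (\int[mu]_(t in `[0%R, +oo[) (1 - S (- t))%:E < +oo)%E).
Context (y : nat -> R) (y0 : exp_min S 1 = (- y 0%N)%:E).
Context (yS : forall n, y n.+1 = y n + H (y n)).

Let hu0 : (\int[mu]_(t in `[0%R, +oo[) (S t)%:E < +oo)%E := min_tail0 S_ge0 S_gt0.
Let H_bounds := tail_int_bounds S_ge0 S_ni hu0.
Let H_ge0 := tail_int_ge0 S_ge0.

Let H_gt0 x : 0 < S x -> 0 < H x.
Proof.
rewrite S_gt0 => x0; have xw : x <= x / 2 by lra.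
have /andP[h _] := H_bounds xw; have := H_ge0 (x / 2).
have : 0 < (x / 2 - x) * S (x / 2) by rewrite mulr_gt0 ?S_gt0; lra.
lra.
Qed.

Let H0 : H 0 = 0.
Proof.
apply: EFin_inj; rewrite (tail_intE S_ge0 S_ni hu0); apply: integral0_eq => x.
by rewrite /= in_itv/= andbT => /S_zero ->.
Qed.

Lemma min_rec_lt0 n : y n < 0.
Proof.
have [x /andP[x0 x1]] := nonvoid ltr01.
have xn : x < 0 by rewrite -S_gt0.
elim: n => [|n yn].
  pose S' t := 1 - S (- t).
  have S'_ge0 t : 0 <= S' t by rewrite subr_ge0.
  have S'_ni s t : s <= t -> S' t <= S' s by move=> st; rewrite lerB// S_ni// lerN2.
  have xw : 0 <= - x by lra.
  have /andP[h _] := tail_int_bounds S'_ge0 S'_ni hu xw.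
  have yE : - y 0%N = tail_int S' 0.
    apply: EFin_inj; rewrite -y0 (tail_intE S'_ge0 S'_ni hu).
    by apply: eq_integral => t _; rewrite /min_weight expr1.
  have := tail_int_ge0 S'_ge0 (- x).
  have : 0 < (- x - 0) * S' (- x) by rewrite mulr_gt0// ?subr0 ?oppr_gt0// /S' opprK subr_gt0.
  rewrite -yE in h; lra.
(* Splitting at a negative point [w] where [S w < 1] makes [H (y n) < - y n] strict. *)
pose w := Num.max x (y n).
have w0 : w < 0 by rewrite gt_max xn yn.
have yw : y n <= w by rewrite le_max lexx orbT.
have w1 : S w < 1 by apply: le_lt_trans x1; rewrite S_ni// le_max lexx.
have /andP[_ h1] := H_bounds yw; have /andP[_ h2] := H_bounds (ltW w0).
have h3 : (w - y n) * S (y n) <= w - y n by rewrite ler_piMr// subr_ge0.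
have h4 : (0 - w) * S w < 0 - w by rewrite gtr_pMr//; lra.
by rewrite H0 in h2; rewrite yS; lra.
Qed.

Let y_lt0 n : y n < 0 := min_rec_lt0 n.

Let y_supp n : 0 < S (y n). Proof. by rewrite S_gt0. Qed.

Let y_vanish := rec_vanishing S_ge0 S_ni H_gt0 H_bounds yS y_supp nonvoid.

Let rH r l : 0 < r -> S (r * x) / S x @[x --> vanishing S] --> l ->
  H (r * x) / H x @[x --> vanishing S] --> r * l.
Proof.
move=> r0; apply: (tail_ratio S_ge0 S_ni H_gt0) => //.
- exact: tail_int_scale_le hu0.
- exact: tail_int_scale_ge hu0.
- move=> x Sx; apply: S_zero; rewrite pmulr_rge0// leNgt -S_gt0.
  by rewrite Sx ltxx.
Qed.

Let vanishing_lt0 : \forall x \near vanishing S, x < 0.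
Proof. by apply: filterS (near_vanishing_gt0 S) => x; rewrite S_gt0. Qed.

Lemma min_limit_regular : g < 0 ->
  - y n / fine (exp_min S n.+1) @[n --> \oo] --> prophet_const g.
Proof.
move=> g0.
have rS r : 0 < r -> S (r * x) / S x @[x --> vanishing S] --> r `^ (- g^-1).
  by move=> r0; exact: (attraction_regular_zero S_ge0 S_le1 S_ni a_gt0 S_cvg).
have rH' r : 0 < r -> H (r * x) / H x @[x --> vanishing S] --> r * r `^ (- g^-1).
  by move=> r0; exact: rH (rS r r0).
have gi : g^-1 < 0 by rewrite invr_lt0.
have b1 : g^-1 - 1 != 0 by rewrite lt_eqF//; lra.
have b0 : g^-1 != 0 by rewrite lt_eqF.
have K := karamata H_gt0 H_bounds (or_intror vanishing_lt0) rS rH'.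
have s := rec_survival_cvg S_ge0 H_gt0 H_bounds yS y_supp y_vanish (or_intror y_lt0) b1 b0 K.
rewrite invrK in s.
have c := exp_min_cvg_Gamma S_ge0 S_le1 S_ni S_gt0 hu y0 yS y_lt0 y_vanish g0 rS s.
set C := _ * _ in c.
have C0 : 0 < C by rewrite mulr_gt0 ?powR_gt0 ?GammaE_fin_gt0 ?(ltW g0)//; lra.
have c' : (fine (exp_min S n.+1) / - y n)^-1 @[n --> \oo] --> C^-1.
  by apply: cvgV => //; rewrite gt_eqF.
rewrite prophet_constE -/C.
by under eq_fun do rewrite -invf_div.
Qed.

Lemma min_limit_rapid : g = 0 -> - y n / fine (exp_min S n.+1) @[n --> \oo] --> (1 : R).
Proof.
move=> g0.
have hK (M : R) : \forall x \near vanishing S, x * S x / H x < M.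
  (* At least half of [H x] comes from [[x, (1 - dl) * x]], so [dl * |x| * S x >= H x / 2]; this
     [dl] turns that into [x * S x / H x <= - (|M| + 1)]. *)
  pose dl := (2 * (`|M| + 1))^-1.
  have M0 : 0 <= `|M| by [].
  have d0 : 0 < dl by rewrite invr_gt0; lra.
  have d1 : dl < 1 by rewrite invf_lt1; lra.
  have dE : dl * (2 * (`|M| + 1)) = 1 by rewrite mulVf// gt_eqF//; lra.
  have c : H ((1 - dl) * x) / H x @[x --> vanishing S] --> (1 - dl) * 0.
    apply: rH; first lra.
    by apply: (attraction_rapid_zero S_ge0 S_le1 S_ni a_gt0 S_cvg) => //; lra.
  rewrite mulr0 in c.
  have h2 : (0 : R) < 2^-1 by lra.
  near=> x.
  have x0 : x < 0 by near: x; exact: vanishing_lt0.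
  have Hx : 0 < H x by rewrite H_gt0// S_gt0.
  have : H ((1 - dl) * x) / H x < 2^-1 by near: x; exact: vanishing_cvg_lt c h2.
  rewrite ltr_pdivrMr// => hx.
  have dx : dl * x < 0 by rewrite pmulr_rlt0.
  have xw : x <= (1 - dl) * x by rewrite mulrBl mul1r; lra.
  have /andP[_ h] := H_bounds xw.
  have hE : ((1 - dl) * x - x) * S x = - dl * (x * S x) by ring.
  rewrite hE in h.
  have h3 : 2^-1 * H x < - dl * (x * S x) by lra.
  rewrite ltr_pdivrMr//; apply: (@lt_le_trans _ _ (- (`|M| + 1) * H x)).
    have : (2 * (`|M| + 1)) * (2^-1 * H x) < (2 * (`|M| + 1)) * (- dl * (x * S x)).
      by rewrite ltr_pM2l//; lra.
    have -> : (2 * (`|M| + 1)) * (- dl * (x * S x)) = - (dl * (2 * (`|M| + 1))) * (x * S x) by ring.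
    rewrite dE.
    have -> : (2 * (`|M| + 1)) * (2^-1 * H x) = (`|M| + 1) * H x by field.
    by lra.
  rewrite ler_pM2r//; have := ler_norm (- M); rewrite normrN; lra.
have t0 := rec_tail_cvg0 S_ge0 H_gt0 H_bounds yS y_supp y_lt0 y_vanish hK.
apply: (exp_min_rapid S_ge0 S_le1 S_ni S_gt0 hu y0 yS y_lt0) => r /andP[r0 r1].
have c : n.+1%:R * (H (y n) / y n) / (r - 1) @[n --> \oo] --> 0 / (r - 1).
  exact: cvgMl.
rewrite mul0r in c.
apply: (squeeze_cvgr _ (cvg_cst 0) c); apply: nearW => n; apply/andP; split.
  by rewrite mulr_ge0.
rewrite -mulrA ler_pM2l//.
(* On [[y n, r * y n]] the function [S] is at least [S (r * y n)], so
   [(r - 1) * y n * S (r * y n) <= H (y n)]. *)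
have ry0 : (r - 1) * y n > 0 by rewrite nmulr_rgt0 ?subr_lt0.
have yw : y n <= r * y n by rewrite -subr_ge0 -[X in _ - X]mul1r -mulrBl ltW.
have /andP[h _] := H_bounds yw.
have hE : r * y n - y n = (r - 1) * y n by ring.
rewrite hE in h.
have -> : H (y n) / y n / (r - 1) = H (y n) / ((r - 1) * y n).
  by field; rewrite lt_eqF//= lt_eqF// subr_lt0.
by rewrite ler_pdivlMr// mulrC (le_trans h)// gerBl.
Unshelve. all: by end_near. Qed.

Lemma min_limit :
  - y n / fine (exp_min S n.+1) @[n --> \oo] --> Num.max (prophet_const g) 1.
Proof.
rewrite (max_idPl _) ?prophet_const_ge1 ?min_index_le0//.
have := min_index_le0; rewrite le_eqVlt => /orP[/eqP g0|]; last exact: min_limit_regular.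
by rewrite g0 prophet_const0; exact: min_limit_rapid.
Qed.

End min_limit.

Theorem theorem1p4 (R : realType) (d : measure_display) (T : measurableType d)
    (P : probability T R) (X : nat -> {RV P >-> R})
    (D : probability (measurableTypeR R) R) (f : R -> R) (xstar : \bar R) :
  iid X D ->
  has_density D f ->
  left_endpoint D = 0%E ->
  right_endpoint D = xstar ->
  (forall g : R, attracted_max (dist_cdf D) g ->
     ratio_max X D n @[n --> \oo] -->
       (if g < 1 then Num.min (prophet_const g) 1 else 1)%:E) /\
  (forall g : R, attracted_min (dist_cdf D) g ->
     g <= 0 /\
     ((mean D < +oo)%E ->
        ratio_min X D n @[n --> \oo] --> (Num.max (prophet_const g) 1)%:E)).
Proof.
move=> XD Df D0 _; split=> g [a [b [a_gt0 ab]]].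
- pose S x := 1 - dist_cdf D x.
  have S_ge0 x : 0 <= S x by rewrite subr_ge0 dist_cdf_le1.
  have S_le1 x : S x <= 1 by rewrite gerBl dist_cdf_ge0.
  have S_ni x y : x <= y -> S y <= S x by move=> xy; rewrite lerB// dist_cdf_nd.
  have S_one x : x <= 0 -> S x = 1 by move=> x0; rewrite /S (dist_cdf_le0 Df D0)// subr0.
  have S_cvg x : 0 < 1 + g * x -> n%:R * S (a n * x + b n) @[n --> \oo] --> tau g x.
    move=> gx; apply: cvg_expn_onem; last by rewrite -gev_maxE; exact: ab.
    by move=> n; rewrite dist_cdf_ge0 dist_cdf_le1.
  have mE : mean D = (\int[lebesgue_measure]_(x in `[0%R, +oo[) (S x)%:E)%E by exact: meanE Df D0.
  have [moo|mfin] := eqVneq (mean D) +oo%E.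
    have -> : ratio_max X D = cst 1%E by apply/funext => n; rewrite /ratio_max moo eqxx.
    have [g1|_] := ltP g 1; last exact: cvg_cst.
    have := max_mean_finite S_ge0 S_le1 S_ni a_gt0 S_cvg g1.
    by rewrite -mE moo.
  have hu : (\int[lebesgue_measure]_(x in `[0%R, +oo[) (S x)%:E < +oo)%E.
    by rewrite -mE ltey.
  have H_ge0 := tail_int_ge0 S_ge0.
  pose y n := iter n (fun v => v + tail_int S v) (tail_int S 0).
  have yS n : y n.+1 = y n + tail_int S (y n) by [].
  have y_ge0 n : 0 <= y n.
    by elim: n => [|n IH]; [exact: H_ge0|rewrite yS addr_ge0].
  have yE n : opt_max D n.+1 = (y n)%:E.
    elim: n => [|n IH]; first by rewrite (tail_intE S_ge0 S_ni hu) -mE.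
    by rewrite (opt_max_step (y_ge0 n) IH) yS EFinD (tail_intE S_ge0 S_ni hu).
  have lim := max_limit S_ge0 S_le1 S_ni S_one a_gt0 S_cvg hu erefl yS.
  have e0 : \forall n \near \oo, fine (exp_max S n.+1) != 0.
    apply: nearW => n; rewrite gt_eqF//.
    rewrite (lt_le_trans (max_rec_gt0 S_ge0 S_ni S_one S_cvg hu erefl yS n))//.
    by rewrite -lee_fin fineK ?(exp_max_fin S_ge0 S_le1 S_ni hu)// (exp_max_ge S_ge0 S_le1 S_ni hu).
  apply: ecvg_succ; have := cvg_ediv e0 lim; apply: cvg_trans.
  apply: near_eq_cvg; apply: nearW => n.
  rewrite /ratio_max (negbTE mfin) yE (mean_sample_max XD Df D0).
  by rewrite fineK// (exp_max_fin S_ge0 S_le1 S_ni hu).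
- pose S x := dist_cdf D (- x).
  have S_ge0 x : 0 <= S x by exact: dist_cdf_ge0.
  have S_le1 x : S x <= 1 by exact: dist_cdf_le1.
  have S_ni x y : x <= y -> S y <= S x by move=> xy; rewrite dist_cdf_nd// lerN2.
  have S_gt0 x : (0 < S x) = (x < 0).
    have [x0|x0] := ltP x 0; first by rewrite (dist_cdf_gt0 D0)// oppr_gt0.
    by rewrite /S (dist_cdf_le0 Df D0) ?ltxx// oppr_le0.
  (* Reflection turns the normalisation [(a, b)] into [(a, - b)] and the domain [1 - g * x > 0] into
     [1 + g * x > 0]. *)
  have S_cvg x : 0 < 1 + g * x -> n%:R * S (a n * x + - b n) @[n --> \oo] --> tau g x.
    move=> gx; rewrite -[x in tau g x]opprK.
    have h : n%:R * (1 - (1 - dist_cdf D (a n * - x + b n))) @[n --> \oo] --> tau g (- - x).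
      apply: cvg_expn_onem => [n|]; first by rewrite subr_ge0 dist_cdf_le1 gerBl dist_cdf_ge0.
      by rewrite -gev_minE; apply: ab; rewrite mulrN opprK.
    under eq_fun do rewrite /S opprD opprK -mulrN -[X in _ * X](subKr 1).
    exact: h.
  split; first exact: (min_index_le0 S_ge0 S_le1 S_ni S_gt0 a_gt0 S_cvg).
  move=> mfin.
  have hE : (\int[lebesgue_measure]_(t in `[0%R, +oo[) (1 - S (- t))%:E)%E = mean D.
    by rewrite (meanE Df D0); apply: eq_integral => t _; rewrite /S opprK.
  have hu : (\int[lebesgue_measure]_(t in `[0%R, +oo[) (1 - S (- t))%:E < +oo)%E by rewrite hE.
  have e1 : exp_min S 1 = mean D.
    by rewrite -hE; apply: eq_integral => t _; rewrite /min_weight expr1.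
  have e_fin := exp_min_fin S_ge0 S_le1 S_ni hu.
  pose y n := iter n (fun v => v + tail_int S v) (- fine (mean D)).
  have yS n : y n.+1 = y n + tail_int S (y n) by [].
  have y0 : exp_min S 1 = (- y 0%N)%:E by rewrite opprK -e1 fineK.
  have y_lt0 := min_rec_lt0 S_ge0 S_le1 S_ni S_gt0 S_cvg hu y0 yS.
  have yE n : opt_min D n.+1 = (- y n)%:E.
    elim: n => [|n IH]; first by rewrite -y0 e1.
    have v0 : 0 <= - y n by rewrite oppr_ge0 ltW.
    have := opt_min_step Df D0 v0 IH; rewrite opprK.
    rewrite -(tail_intE S_ge0 S_ni (min_tail0 S_ge0 S_gt0)) => h.
    by rewrite yS opprD EFinD -h EFinN addeK.
  have lim := min_limit S_ge0 S_le1 S_ni S_gt0 a_gt0 S_cvg hu y0 yS.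
  have l0 : 0 < Num.max (prophet_const g) 1 by rewrite lt_max ltr01 orbT.
  have e0 : \forall n \near \oo, fine (exp_min S n.+1) != 0.
    (* Division by [0] yields [0], whereas the ratios have a positive limit, so the denominators are
       eventually nonzero. *)
    apply: filterS (cvgr_gt _ lim _ l0) => n; apply: contraTneq => ->.
    by rewrite invr0 mulr0 ltxx.
  apply: ecvg_succ; have := cvg_ediv e0 lim; apply: cvg_trans.
  apply: near_eq_cvg; apply: nearW => n.
  by rewrite /ratio_min yE (mean_sample_min XD Df D0) fineK.
Qed.
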